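(* Let $0<p<q\le\infty$, and let $L^p$, $L^q$ be the Lebesgue spaces over $(0,\infty)$ with the Lebesgue measure. Then every quasi-Banach lattice $X$ such that $X\in Int(L^p,L^q)$ is a $K$-space, i.e., $X=(L^p,L^q)_{E:K}$ (with equivalent quasi-norms) for some quasi-Banach lattice $E\in Int(\overline{L^\infty})$.
   Context: Spaces are real. $L^p$, $0<p\le\infty$, has quasi-norm $(\int_0^\infty|f|^p\,dt)^{1/p}$ (ess sup if $p=\infty$). A quasi-Banach (function) lattice $X$ on $(0,\infty)$ is a quasi-Banach space of classes of measurable functions such that $f\in X$, $|g|\le|f|$ a.e. imply $g\in X$, $\|g\|_X\le\|f\|_X$. For a couple $\overline{X}=(X_0,X_1)$ of quasi-Banach spaces: $\Delta(\overline X)=X_0\cap X_1$ and $\Sigma(\overline X)=X_0+X_1$ have quasi-norms $\max(\|x\|_{X_0},\|x\|_{X_1})$ and $\inf\{\|x_0\|_{X_0}+\|x_1\|_{X_1}:x=x_0+x_1\}$; $K(t,x;\overline{X})=\inf\{\|x_0\|_{X_0}+t\|x_1\|_{X_1}:x=x_0+x_1,\ x_i\in X_i\}$. $Int(\overline X)=Int(X_0,X_1)$ is the collection of interpolation spaces: quasi-Banach spaces $X$ with $\Delta(\overline X)\subset X\subset\Sigma(\overline X)$ continuously such that every linear operator $T:\Sigma(\overline X)\to\Sigma(\overline X)$ bounded on $X_0$ and on $X_1$ is bounded on $X$. $\overline{L^\infty}=(L^\infty,L^\infty(1/t))$ is the couple on $(0,\infty)$ with norms $\operatorname{ess\,sup}|f(t)|$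 and $\operatorname{ess\,sup}|f(t)|/t$. For a quasi-Banach function lattice $E\in Int(\overline{L^\infty})$, $\overline{X}_{E:K}$ is the space of $x\in\Sigma(\overline X)$ with $\|x\|=\|K(\cdot,x;\overline X)\|_E<\infty$. *)

(* Defs.v *)
From HB Require Import structures.
From mathcomp Require Import all_boot all_order all_algebra.
From mathcomp Require Import all_classical all_reals all_analysis measurable_realfun.

Set Implicit Arguments.
Unset Strict Implicit.
Unset Printing Implicit Defensive.

Import Order.TTheory GRing.Theory Num.Theory.
Import numFieldNormedType.Exports.

Local Open Scope classical_set_scope.
Local Open Scope ring_scope.

(* The library quotient {mfun_ mu, T >-> R} carries no algebraic structure; L0
   is this quotient made into a real vector space. *)
Section L0.
Context d (T : measurableType d) (R : realType).
Variable mu : {measure set T -> \bar R}.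
Local Open Scope quotient_scope.

Definition L0 : Type := {mfun_ mu, T >-> R}.
HB.instance Definition _ := Choice.on L0.
HB.instance Definition _ := EqQuotient.on L0.

Definition class0 (f : {mfun T >-> R}) : L0 := \pi_L0 f.
Definition repr0 (f : L0) : {mfun T >-> R} := repr f.
Definition fun0 (f : L0) : T -> R := repr0 f.
Coercion fun0 : L0 >-> Funclass.

Lemma class0K (f : L0) : class0 (repr0 f) = f.
Proof. exact: reprK. Qed.

Lemma class0P (f g : {mfun T >-> R}) :
  class0 f = class0 g <-> (f : T -> R) = (g : T -> R) %[ae mu].
Proof.
split => [/eqP|] h; last by apply/eqP; rewrite /class0 eqmodE; exact/asboolP.
by move: h; rewrite /class0 eqmodE => /asboolP.
Qed.

Lemma repr0K (f : {mfun T >-> R}) : (repr0 (class0 f) : T -> R) = f %[ae mu].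
Proof. by apply/class0P; rewrite class0K. Qed.

Definition add0 (f g : L0) : L0 := class0 (repr0 f + repr0 g).
Definition opp0 (f : L0) : L0 := class0 (- repr0 f).
Definition scale0 (a : R) (f : L0) : L0 := class0 (a *: repr0 f).

Lemma class0D (f g : {mfun T >-> R}) :
  class0 (f + g) = add0 (class0 f) (class0 g).
Proof.
apply/class0P; have := repr0K f; have := repr0K g.
apply: filterS2 => x /= /(_ I) gE /(_ I) fE _.
by rewrite -[LHS]/(f x + g x) -gE -fE.
Qed.

Lemma class0N (f : {mfun T >-> R}) : class0 (- f) = opp0 (class0 f).
Proof.
apply/class0P; have := repr0K f; apply: filterS => x /= /(_ I) fE _.
by rewrite -[LHS]/(- f x) -fE.
Qed.

Lemma class0Z a (f : {mfun T >-> R}) : class0 (a *: f) = scale0 a (class0 f).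
Proof.
apply/class0P; have := repr0K f; apply: filterS => x /= /(_ I) fE _.
by rewrite -[LHS]/(a * f x) -fE.
Qed.

Let add0A : associative add0.
Proof.
move=> f g h; rewrite -(class0K f) -(class0K g) -(class0K h).
by rewrite -!class0D addrA.
Qed.
Let add0C : commutative add0.
Proof. by move=> f g; rewrite /add0 addrC. Qed.
Let add00 : left_id (class0 0) add0.
Proof. by move=> f; rewrite -(class0K f) -class0D add0r. Qed.
Let add0N : left_inverse (class0 0) opp0 add0.
Proof. by move=> f; rewrite -(class0K f) -class0N -class0D addNr. Qed.

HB.instance Definition _ := GRing.isZmodule.Build L0 add0A add0C add00 add0N.

Let addE (f g : {mfun T >-> R}) : class0 f + class0 g = class0 (f + g) :> L0.
Proof. by rewrite class0D. Qed.
Let scale0A a b v : scale0 a (scale0 b v) = scale0 (a * b) v.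
Proof. by rewrite -(class0K v) -!class0Z scalerA. Qed.
Let scale01 : left_id 1 scale0.
Proof. by move=> v; rewrite -(class0K v) -class0Z scale1r. Qed.
Let scale0Dr : right_distributive scale0 +%R.
Proof.
move=> a u v; rewrite -(class0K u) -(class0K v).
by rewrite addE -!class0Z addE scalerDr.
Qed.
Let scale0Dl v : {morph scale0^~ v : a b / a + b}.
Proof. by move=> a b; rewrite -(class0K v) -!class0Z addE scalerDl. Qed.

HB.instance Definition _ :=
  GRing.Zmodule_isLmodule.Build R L0 scale0A scale01 scale0Dr scale0Dl.

End L0.

(* Every space occurring here lives in an ambient vector space V, and is given
   by its quasi-norm, extended by +oo outside of the space; so "x is in the
   space" reads N x < +oo. *)
Section interpolation.
Context {R : realType} {V : lmodType R}.
Local Open Scope ereal_scope.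
Implicit Types (N M : V -> \bar R) (x y : V).

Definition quasi_norm N :=
  [/\ forall x, 0 <= N x,
      forall x, N x = 0 <-> x = 0%R,
      forall (a : R) x, N (a *: x)%R = `|a|%:E * N x
    & exists2 C : R, (0 < C)%R & forall x y, N (x + y)%R <= C%:E * (N x + N y)].

Definition complete_qnorm N := forall u : nat -> V,
  (forall n, N (u n) < +oo) ->
  (forall e : R, (0 < e)%R ->
     exists n0, forall m n, (n0 <= m)%N -> (n0 <= n)%N ->
       N (u m - u n)%R < e%:E) ->
  exists2 x, N x < +oo & N (u n - x)%R @[n --> \oo] --> 0.

Definition quasi_banach N := quasi_norm N /\ complete_qnorm N.

Definition continuously_included N M :=
  exists C : R, forall x, N x < +oo -> M x <= C%:E * N x.

Definition equivalent_qnorms N M :=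
  exists2 C : R, (0 < C)%R & forall x, N x <= C%:E * M x /\ M x <= C%:E * N x.

Definition bounded_on (T : V -> V) N :=
  exists C : R, forall x, N x < +oo -> N (T x) <= C%:E * N x.

Definition Delta N0 N1 x := maxe (N0 x) (N1 x).

Definition Sigma N0 N1 x := ereal_inf [set r | exists x0 x1,
  [/\ x = (x0 + x1)%R, N0 x0 < +oo, N1 x1 < +oo & r = N0 x0 + N1 x1]].

Definition Kfunctional N0 N1 (t : R) x := ereal_inf [set r | exists x0 x1,
  [/\ x = (x0 + x1)%R, N0 x0 < +oo, N1 x1 < +oo & r = N0 x0 + t%:E * N1 x1]].

(* T is only required to be linear on Sigma; its values elsewhere in V are
   irrelevant. *)
Definition linear_on_Sigma N0 N1 (T : V -> V) :=
  (forall x, Sigma N0 N1 x < +oo -> Sigma N0 N1 (T x) < +oo) /\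
  (forall (a : R) x y, Sigma N0 N1 x < +oo -> Sigma N0 N1 y < +oo ->
     T (a *: x + y)%R = (a *: T x + T y)%R).

Definition interpolation_space N0 N1 N :=
  [/\ quasi_banach N,
      continuously_included (Delta N0 N1) N,
      continuously_included N (Sigma N0 N1)
    & forall T : V -> V, linear_on_Sigma N0 N1 T ->
        bounded_on T N0 -> bounded_on T N1 -> bounded_on T N].

End interpolation.

Section halfline.
Variable R : realType.

Definition halfline : set (measurableTypeR R) := `]0, +oo[.

Lemma measurable_halfline : measurable halfline.
Proof. exact: measurable_itv. Qed.

(* Lebesgue measure on (0, +oo), as a measure on the whole line which does not
   charge its complement. *)
Definition halfline_measure : {measure set (measurableTypeR R) -> \bar R} :=
  mrestr lebesgue_measure measurable_halfline.

End halfline.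
Arguments halfline : clear implicits.
Arguments measurable_halfline : clear implicits.

Notation L0h R := (L0 (halfline_measure R)).

Section lattices.
Context {R : realType}.
Local Open Scope ereal_scope.

Definition Lp (p : \bar R) (f : L0h R) : \bar R :=
  'N[halfline_measure R]_p[EFin \o f].

Definition Linfty : L0h R -> \bar R := Lp +oo.

Definition Linfty_inv (f : L0h R) : \bar R :=
  'N[halfline_measure R]_(+oo)[(fun t => (f t / t)%:E)].

Definition quasi_banach_lattice (N : L0h R -> \bar R) :=
  quasi_banach N /\
  forall f g : L0h R, N f < +oo ->
    {ae halfline_measure R, forall t, (`|g t| <= `|f t|)%R} -> N g <= N f.

End lattices.

Section Kspace.
Context {R : realType} {V : lmodType R}.
Local Open Scope ereal_scope.
Variables (N0 N1 : V -> \bar R).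

(* The value on the negative half-line is irrelevant; it only serves to have a
   total measurable function. *)
Definition Kfun (x : V) : measurableTypeR R -> R :=
  (fun t => fine (Kfunctional N0 N1 t x)) \_ (halfline R).

Lemma open_affine_lt (A B a : \bar R) :
  open [set t : R | (0 < t)%R /\ A + t%:E * B < a].
Proof.
have cstP (c : \bar R) : (forall t : R, (0 < t)%R -> A + t%:E * B = c) ->
    open [set t : R | (0 < t)%R /\ A + t%:E * B < a].
  move=> Ec; have [ca|ca] := boolP (c < a).
    rewrite (_ : mkset _ = [set t | (0 < t)%R]); first exact: open_gt.
    by apply/seteqP; split=> [t []//|t /= t0]; rewrite Ec.
  rewrite (_ : mkset _ = set0); first exact: open0.
  by apply/seteqP; split=> [t [t0]|//]; rewrite Ec// (negbTE ca).
case: B cstP => [b| |] cstP; last 2 first.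
- by apply: (cstP (A + +oo)) => t t0; rewrite gt0_muley// lte_fin.
- by apply: (cstP (A + -oo)) => t t0; rewrite gt0_muleNy// lte_fin.
case: A cstP => [u| |] cstP; last 2 first.
- by apply: (cstP +oo) => t t0; rewrite -EFinM addye.
- by apply: (cstP -oo) => t t0; rewrite -EFinM addNye.
case: a cstP => [a| |] _.
- rewrite (_ : mkset _ = [set t | (0 < t)%R] `&`
      (fun t => u + t * b)%R @^-1` [set s | (s < a)%R]).
    apply: openI; first exact: open_gt.
    apply: open_comp; last exact: open_lt.
    move=> t _; apply: cvgD; first exact: cvg_cst.
    by apply: cvgM; [exact: cvg_id|exact: cvg_cst].
  by apply/seteqP; split=> t [/= t0]; rewrite -EFinM -EFinD lte_fin.
- rewrite (_ : mkset _ = [set t | (0 < t)%R]); first exact: open_gt.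
  by apply/seteqP; split=> [t []//|t /= t0]; rewrite -EFinM -EFinD ltry.
- rewrite (_ : mkset _ = set0); first exact: open0.
  by apply/seteqP; split=> [t [_]|//]; rewrite ltNge leNye.
Qed.

Lemma measurable_Kfun x : measurable_fun [set: measurableTypeR R] (Kfun x).
Proof.
apply: (iffLR (measurable_restrictT _ (measurable_halfline R))).
apply: (measurableT_comp (f := @fine R)) => //.
move=> mD; apply: (measurability _ (ErealGenInftyO.measurableE R)) => //.
move=> _ [_ [a ->] <-].
apply: open_measurable.
rewrite (_ : _ `&` _ = \bigcup_(y in [set y | [/\ x = (y.1 + y.2)%R,
  N0 y.1 < +oo & N1 y.2 < +oo]])
  [set t : R | (0 < t)%R /\ N0 y.1 + t%:E * N1 y.2 < a%:E]).
  by apply: bigcup_open => y _; exact: open_affine_lt.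
apply/seteqP; split=> t /=.
- rewrite /halfline /= !in_itv /= andbT => -[t0 /ereal_inf_lt].
  move=> [_ [x0 [x1 [-> Nx0 Nx1 ->]]] lta].
  by exists (x0, x1).
- move=> [[x0 x1] /= [-> Nx0 Nx1]] [t0 lta].
  rewrite /halfline /= !in_itv /= andbT; split=> //.
  by apply: le_lt_trans lta; apply: ereal_inf_lbound; exists x0, x1.
Qed.

HB.instance Definition _ x := isMeasurableFun.Build _ _ _ _ (Kfun x)
  (measurable_Kfun x).

(* The space X_{E:K} for the couple (N0, N1), where NE is the quasi-norm of E. *)
Definition Kspace (NE : L0h R -> \bar R) (x : V) : \bar R :=
  if Sigma N0 N1 x < +oo then NE (class0 (halfline_measure R) (Kfun x)) else +oo.

End Kspace.

(* Main.v *)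
From HB Require Import structures.
From mathcomp Require Import all_boot all_order all_algebra.
From mathcomp Require Import all_classical all_reals all_analysis.
From mathcomp Require Import measurable_realfun ring lra zify ess_sup_inf.
Require Import Defs.

(** Say that g is K-dominated by f when K(t, g) <= K(t, f) for all t > 0. The
theorem comes down to K-monotonicity: there is a constant C such that X g <= C
* X f whenever g is K-dominated by f.

Given this, E is the space [hull] of the functions phi on the half-line with
|phi| <= K(., f) for some f in X, with the infimum of X f as quasi-norm. It is
a lattice by construction, and complete because countably many small elements
of X have a common majorant in X ([countable_majorant]). It is an
interpolation space for the couple of weighted L^oo spaces: cutting phi at a
point t splits it into a part bounded by K(t, f) and a part bounded by K(t, f)
s / t, so that an operator bounded on both spaces maps phi below a multiple of
K(., f) ([hull_bounded]). Finally E(K(., x)) is, up to a factor, the infimum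
of X f over the f that K-dominate x, which K-monotonicity compares with X x
([hull_equivalent]).

K-monotonicity is first proved without a constant: X f < +oo implies X g < +oo
([K_dominated_finite], [K_dominated_infinite]). Here the interpolation
hypothesis is used through operators of the form T h = (g / (f o sigma)) * (h
o sigma), cut off to a set B, so that T f = g on B. Such an operator is
bounded on L^r if sigma carries the measure |g|^r dx on B into a multiple of
|f|^r dx, and it is bounded on the spaces L^s with s > r (respectively s < r)
if moreover |g x| <= C |f (sigma x)| (respectively >=) on B. Both requirements
hold for the monotone rearrangement sigma, provided that the mass of |g|^r
above (respectively below) each level e^n is at most C times that of |f|^r
([level_operator]). If q < +oo, cutting f at the level e^n and applying the
K-domination at the corresponding t gives for every n either the upper
inequality with r = p or the lower one with r = q ([tail_dichotomy]);
splitting the values of g according to the alternative that holds at their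
level, two operators recover g. If q = +oo the upper inequality holds at all
levels, up to a shift ([upper_domination]); what it leaves out is a bounded
part of g, at levels where f has infinite mass, and this occurs only when f is
at least a constant on a set of infinite measure, which a measure preserving
map spreads over the half-line ([spread_operator]).

The constant is obtained by gluing ([uniform_constant]). If there were none,
take pairs (f_n, g_n) violating larger and larger constants, normalized so
that the f_n have a common majorant f in X while X g_n grows fast. Since
suprema with summable weights are bounded on Lebesgue spaces, the function sup
a_n |g_n| is K-dominated by 2 f; so it belongs to X, although its quasi-norm
is larger than every integer. *)

Set Implicit Arguments.
Unset Strict Implicit.
Unset Printing Implicit Defensive.

Import Order.TTheory GRing.Theory Num.Theory.
Import numFieldNormedType.Exports.

Local Open Scope classical_set_scope.
Local Open Scope ring_scope.

(** * Measures with a density *)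

Section density.
Context d (T : measurableType d) (R : realType).
Variable mu : {measure set T -> \bar R}.
Local Open Scope ereal_scope.
Variable a : T -> R.
Hypotheses (a0 : forall x, (0 <= a x)%R) (ma : measurable_fun setT a).

Definition density of (forall x, (0 <= a x)%R) & measurable_fun setT a :=
  fun A : set T => \int[mu]_(x in A) (a x)%:E.

Let density0 : density a0 ma set0 = 0.
Proof. by rewrite /density integral_set0. Qed.

Let density_ge0 A : 0 <= density a0 ma A.
Proof. by apply: integral_ge0 => x _; rewrite lee_fin. Qed.

Let density_sigma_additive : semi_sigma_additive (density a0 ma).
Proof.
move=> F mF tF mUF; rewrite /density ge0_integral_bigcup//.
- by apply: is_cvg_ereal_nneg_natsum_cond => n _ _; exact: density_ge0.
- by apply/measurable_EFinP; exact: measurable_funTS.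
- by move=> x _; rewrite lee_fin.
Qed.

HB.instance Definition _ := isMeasure.Build _ _ _ (density a0 ma)
  density0 density_ge0 density_sigma_additive.

Import HBNNSimple.

(** Both sides are monotone limits along the simple approximations of [h], for
which the formula is the definition of the density measure. *)
Lemma integral_density (h : T -> \bar R) : (forall x, 0 <= h x) ->
  measurable_fun setT h ->
  \int[density a0 ma]_x h x = \int[mu]_x ((a x)%:E * h x).
Proof.
move=> h0 mh.
pose u := nnsfun_approx measurableT mh.
have mae : measurable_fun setT (EFin \o a) by exact/measurable_EFinP.
transitivity (limn (fun n => \int[density a0 ma]_x (u n x)%:E)).
  rewrite -monotone_convergence//.
  - apply: eq_integral => y _; apply/esym/cvg_lim => //.
    exact: cvg_nnsfun_approx.
  - by move=> n; exact/measurable_EFinP/measurable_funP.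
  - by move=> n y _; rewrite lee_fin.
  - by move=> y _ m n mn; rewrite lee_fin; exact/lefP/nd_nnsfun_approx.
transitivity (limn (fun n => \int[mu]_x ((a x)%:E * (u n x)%:E))); last first.
  rewrite -monotone_convergence//.
  - apply: eq_integral => y _; apply/cvg_lim => //.
    by apply: cvgeZl => //; exact: cvg_nnsfun_approx.
  - move=> n; apply: emeasurable_funM => //.
    exact/measurable_EFinP/measurable_funP.
  - by move=> n y _; rewrite mule_ge0 ?lee_fin.
  - move=> y _ m n mn; rewrite lee_wpmul2l ?lee_fin//.
    exact/lefP/nd_nnsfun_approx.
congr (limn _); apply/funext => n.
transitivity (\int[density a0 ma]_x
   (\sum_(y \in range (u n)) (y * \1_(u n @^-1` [set y]) x)%:E)).
  by apply: eq_integral => t tE; rewrite /= fimfunE -fsumEFin.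
rewrite ge0_integral_fsum//; last 2 first.
  - by move=> r; exact/measurable_EFinP/measurable_funM.
  - by move=> m y Ey; exact: nnfun_muleindic_ge0.
transitivity (\int[mu]_x (\sum_(y \in range (u n))
    ((a x)%:E * (y * \1_(u n @^-1` [set y]) x)%:E))); last first.
  apply: eq_integral => x _.
  rewrite -ge0_mule_fsumr => [|y]; last exact: nnfun_muleindic_ge0.
  by rewrite fsumEFin // -(fimfunE _ x).
rewrite ge0_integral_fsum//; last 2 first.
  - move=> y; apply: emeasurable_funM => //.
    exact/measurable_EFinP/measurable_funM.
  - by move=> m y Ey; rewrite mule_ge0 ?lee_fin// -?lee_fin nnfun_muleindic_ge0.
apply: eq_fsbigr => r rhn.
rewrite integralZl_indic_nnsfun// integral_indic// setIT.
have [r0|r0] := ltP r 0%R.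
  by rewrite preimage_nnfun0// measure0 mule0 integral0_eq// => x _;
    rewrite indicE in_set0 mulr0 mule0.
under eq_integral do rewrite EFinM muleCA.
rewrite ge0_integralZl//; last 2 first.
- by apply: emeasurable_funM => //; exact/measurable_EFinP.
- by move=> x _; rewrite mule_ge0 ?lee_fin.
congr (_ * _).
rewrite -[LHS]/(\int[mu]_(x in u n @^-1` [set r]) (a x)%:E).
rewrite [LHS]integral_mkcond; apply: eq_integral => x _.
by rewrite epatch_indic.
Qed.

End density.

(** * Measures on the line with finite mass on rays *)

Section rays.
Context {R : realType}.
Local Open Scope ereal_scope.
Local Notation T := (measurableTypeR R).
Local Notation ray z := (`]-oo, z]%classic : set T).

Lemma ray_measurable (z : R) : measurable ((ray z) : set T).
Proof. exact: measurable_itv. Qed.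

Lemma measure_eq_rays (m1 m2 : {measure set T -> \bar R}) :
  (forall z : R, m1 (ray z) = m2 (ray z)) ->
  (forall z : R, m1 (ray z) < +oo) ->
  forall A, measurable A -> m1 A = m2 A.
Proof.
move=> m12 m1fin.
pose G : set (set T) := [set A | exists z : R, A = (ray z)].
apply: (@measure_unique _ _ T G (fun n => (ray (n%:R)%R))).
- rewrite RGenOInfty.measurableE; apply/seteqP; split.
    apply: smallest_sub; first exact: smallest_sigma_algebra.
    move=> _ [z ->]; rewrite -setCitvl.
    by apply: sigma_algebraC; apply: sub_sigma_algebra; exists z.
  apply: smallest_sub; first exact: smallest_sigma_algebra.
  move=> _ [z ->]; rewrite -setCitvr.
  by apply: sigma_algebraC; apply: sub_sigma_algebra; exists z.
- move=> _ _ [x ->] [y ->]; exists (Num.min x y).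
  apply/seteqP; split => t /=; rewrite !in_itv/= le_min.
    by move=> [-> ->].
  by move=> /andP[].
- by move=> i; exists i%:R.
- apply/seteqP; split => // t _.
  exists (Num.trunc `|t|).+1 => //=.
  by rewrite in_itv/= (le_trans (ler_norm t))// ltW// truncnS_gt.
- by move=> _ [z ->].
- by move=> k.
Qed.

Variable m : {measure set T -> \bar R}.
Hypothesis mfin : forall z : R, m (ray z) < +oo.

Lemma le_rays (x y : R) : (x <= y)%R -> m (ray x) <= m (ray y).
Proof.
move=> xy; apply: le_measure; rewrite ?inE//; try exact: ray_measurable.
by move=> t; rewrite /= !in_itv/= => /le_trans; exact.
Qed.

(** Continuity of the measure along increasing or decreasing sequences of
rays; this and the next three lemmas say how the distribution function of [m]
behaves at +oo, at -oo, and from either side of a point. *)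
Lemma rays_top (u : \bar R) : u < m setT -> exists z : R, u < m (ray z).
Proof.
move=> um.
have TE : \bigcup_n (ray (n%:R)%R) = [set: T].
  apply/seteqP; split => // t _.
  exists (Num.trunc `|t|).+1 => //=.
  by rewrite in_itv/= (le_trans (ler_norm t))// ltW// truncnS_gt.
have cv : m \o (fun n => (ray (n%:R)%R)) @ \oo --> m (\bigcup_n (ray (n%:R)%R)).
  apply: nondecreasing_cvg_mu => //.
  - by rewrite TE.
  - move=> i j ij; apply/subsetPset => t; rewrite /= !in_itv/= => /le_trans.
    by apply; rewrite ler_nat.
rewrite TE in cv; apply: contrapT => nex.
move: um; apply/negP; rewrite -leNgt -(cvg_lim _ cv)//.
apply: lime_le; first by apply/cvg_ex; exists (m setT).
by apply: nearW => n; rewrite leNgt; apply/negP => ?; apply: nex; exists n%:R.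
Qed.

Lemma rays_bot (u : \bar R) : 0 < u -> exists z : R, m (ray z) < u.
Proof.
move=> u0.
have TE : \bigcap_n (ray (- n%:R)%R) = set0 :> set T.
  apply/seteqP; split => // t /(_ (Num.trunc `|t|).+1 I) /=.
  rewrite in_itv/= lerNr => /(lt_le_trans (truncnS_gt `|t|)).
  by rewrite ltNge -normrN ler_norm.
have cv : m \o (fun n => (ray (- n%:R)%R)) @ \oo -->
    m (\bigcap_n (ray (- n%:R)%R)).
  apply: nonincreasing_cvg_mu => //.
  - by rewrite TE.
  - move=> i j ij; apply/subsetPset => t; rewrite /= !in_itv/= => /le_trans.
    by apply; rewrite lerN2 ler_nat.
rewrite TE measure0 in cv; apply: contrapT => nex.
move: u0; apply/negP; rewrite -leNgt -(cvg_lim _ cv)//.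
apply: lime_ge; first by apply/cvg_ex; exists 0.
by apply: nearW => n; rewrite leNgt; apply/negP => ?; apply: nex; exists (- n%:R)%R.
Qed.

Lemma rays_right (u : \bar R) (z : R) :
  (forall y, (z < y)%R -> u <= m (ray y)) -> u <= m (ray z).
Proof.
move=> uy.
have TE : \bigcap_n (ray (z + n.+1%:R^-1)%R) = (ray z) :> set T.
  apply/seteqP; split => t; last first.
    rewrite /= in_itv/= => tz n _; rewrite /= in_itv/= (le_trans tz)// lerDl.
    by rewrite invr_ge0.
  move=> H; rewrite /= in_itv/=; apply/ler_addgt0Pr => e e0.
  have := H (Num.trunc e^-1) I; rewrite /= in_itv/= => /le_trans; apply.
  rewrite lerD2l -[leRHS]invrK lef_pV2 ?posrE ?invr_gt0//.
  exact/ltW/truncnS_gt.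
have cv : m \o (fun n => (ray (z + n.+1%:R^-1)%R)) @ \oo -->
    m (\bigcap_n (ray (z + n.+1%:R^-1)%R)).
  apply: nonincreasing_cvg_mu => //.
  - by rewrite TE.
  - move=> i j ij; apply/subsetPset => t; rewrite /= !in_itv/= => /le_trans.
    by apply; rewrite lerD2l lef_pV2 ?posrE// ler_nat.
rewrite TE in cv; rewrite -(cvg_lim _ cv)//.
apply: lime_ge; first by apply/cvg_ex; exists (m (ray z)).
by apply: nearW => n; apply: uy; rewrite ltrDl invr_gt0.
Qed.

Lemma rays_left (u : \bar R) (z : R) : m [set z] = 0 ->
  (forall y, (y < z)%R -> m (ray y) <= u) -> m (ray z) <= u.
Proof.
move=> mz uy.
have TE : \bigcup_n (ray (z - n.+1%:R^-1)%R) = `]-oo, z[%classic :> set T.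
  apply/seteqP; split => t.
    move=> [n _]; rewrite /= !in_itv/= => /le_lt_trans; apply.
    by rewrite ltrBlDr ltrDl invr_gt0.
  rewrite /= in_itv/= => tz; exists (Num.trunc (z - t)^-1) => //=.
  rewrite in_itv/= lerBrDr -lerBrDl -[leRHS]invrK lef_pV2 ?posrE ?invr_gt0 ?subr_gt0//.
  exact/ltW/truncnS_gt.
have cv : m \o (fun n => (ray (z - n.+1%:R^-1)%R)) @ \oo -->
    m (\bigcup_n (ray (z - n.+1%:R^-1)%R)).
  apply: nondecreasing_cvg_mu => //.
  - by rewrite TE.
  - move=> i j ij; apply/subsetPset => t; rewrite /= !in_itv/= => /le_trans.
    by apply; rewrite lerD2l lerN2 lef_pV2 ?posrE// ler_nat.
rewrite TE in cv.
have -> : (ray z) = `]-oo, z[%classic `|` [set z] :> set T.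
  apply/seteqP; split => t; rewrite /= !in_itv/= le_eqVlt.
    by case/orP=> [/eqP|]; [right|left].
  by case=> [->|/eqP ->//]; rewrite orbT.
apply: (le_trans (measureU2 m (measurable_itv _) (measurable_set1 z))).
rewrite [X in _ + X](_ : _ = 0); last exact: mz.
rewrite adde0 -[leLHS]/(m (`]-oo, z[%classic)) -(cvg_lim _ cv)//.
apply: lime_le; first by apply/cvg_ex; exists (m `]-oo, z[%classic).
by apply: nearW => n; apply: uy; rewrite ltrBlDr ltrDl invr_gt0.
Qed.

End rays.

(** * Monotone rearrangement on the line *)

Section line_transport.
Context {R : realType}.
Local Open Scope ereal_scope.
Local Notation T := (measurableTypeR R).
Local Notation ray z := (`]-oo, z]%classic : set T).
Local Notation lambda := (@lebesgue_measure R).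

(** The possible ranks for a measure of total mass [m]: an open interval of
length [m] starting at 0. *)
Definition below (m : \bar R) : set T := [set u : R | (0 < u)%R /\ u%:E < m].

Lemma belowE (m : \bar R) : 0 <= m ->
  below m = match m with u%:E => `]0%R, u[%classic | _ => `]0%R, +oo[%classic end.
Proof.
case: m => [u||]//= _; apply/seteqP; split => t; rewrite /below /= in_itv/= ?lte_fin.
- by case=> -> ->.
- by case/andP.
- by case=> -> _.
- by rewrite andbT => ->; rewrite ltry.
Qed.

Lemma below_measurable (m : \bar R) : 0 <= m -> measurable (below m).
Proof. by move=> /belowE ->; case: m => [u||]; exact: measurable_itv. Qed.

Lemma lebesgue_below (m : \bar R) : 0 <= m -> lambda (below m) = m.
Proof.
move=> m0; rewrite belowE//; case: m m0 => [u||]//= u0.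
  rewrite lebesgue_measure_itv/= lte_fin.
  move: u0; rewrite lee_fin le_eqVlt => /orP[/eqP <-|u0]; first by rewrite ltxx.
  by rewrite u0 oppr0 adde0.
by rewrite lebesgue_measure_itv/= ltry.
Qed.

(** This identifies the image of a measure under its distribution function,
and of Lebesgue measure under a quantile function: both are computed on rays.
*)
Lemma lebesgue_below_ray (m : \bar R) (u : R) : (0 <= u)%R -> u%:E <= m ->
  lambda (below m `&` ray u) = u%:E.
Proof.
move=> u0 um.
have m0 : 0 <= m by rewrite (le_trans _ um).
have [mu|mu] := eqVneq m u%:E.
  rewrite setIidl ?lebesgue_below// mu => t [_ /=].
  by rewrite lte_fin in_itv/= => /ltW.
have -> : below m `&` ray u = `]0%R, u]%classic.
  apply/seteqP; split => t /=; rewrite !in_itv/=.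
    by move=> [[-> _] ->].
  move=> /andP[t0 tu]; split => //; split => //.
  by rewrite (@le_lt_trans _ _ u%:E)// ?lee_fin// lt_neqAle eq_sym mu.
rewrite lebesgue_measure_itv/= lte_fin.
move: u0; rewrite le_eqVlt => /orP[/eqP <-|u0]; first by rewrite ltxx.
by rewrite u0 oppr0 adde0.
Qed.

Section rank.
Variable m : {measure set T -> \bar R}.
Hypothesis mfin : forall z : R, m (ray z) < +oo.

Definition cdist (z : T) : T := fine (m (ray z)).

Lemma cdistE z : (cdist z)%:E = m (ray z).
Proof. by rewrite /cdist fineK// ge0_fin_numE// mfin. Qed.

Lemma cdist_measurable : measurable_fun setT cdist.
Proof.
apply: nondecreasing_measurable => // x y xy.
by rewrite -lee_fin !cdistE; exact: le_rays.
Qed.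

Hypothesis atomless : forall z : R, m [set z] = 0.

(** In probabilistic terms: the rank of a random point is uniformly
distributed. *)
Lemma cdist_law A : measurable A ->
  m (cdist @^-1` A) = lambda (below (m setT) `&` A).
Proof.
move=> mA.
pose Ci := isMeasurableFun.Build _ _ _ _ _ cdist_measurable.
pose C : {mfun T >-> T} := HB.pack cdist Ci.
have mD : measurable (below (m setT)) by exact: below_measurable.
have key u : m (cdist @^-1` ray u) = lambda (below (m setT) `&` ray u).
  have [u0|u0] := ltP u 0%R.
    rewrite (_ : _ @^-1` _ = set0); last first.
      apply/seteqP; split => // t /=; rewrite in_itv/= => tu.
      by have := le_lt_trans tu u0; rewrite /cdist ltNge fine_ge0.
    rewrite (_ : _ `&` _ = set0) ?measure0//.
    apply/seteqP; split => // t [[t0 _]] /=; rewrite in_itv/= => tu.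
    by have := lt_trans (lt_le_trans t0 tu) u0; rewrite ltxx.
  have [mu|um] := leP (m setT) u%:E.
    rewrite (_ : _ @^-1` _ = setT); last first.
      apply/seteqP; split => // t _ /=; rewrite in_itv/= -lee_fin cdistE.
      by rewrite (le_trans _ mu)// le_measure ?inE//; exact: ray_measurable.
    rewrite setIidl ?lebesgue_below// => t [_ /=] tm.
    by rewrite in_itv/= -lee_fin ltW// (lt_le_trans tm).
  rewrite (lebesgue_below_ray u0 (ltW um)).
  have [Z0|/set0P[z0 Zz0]] := eqVneq (cdist @^-1` ray u) set0.
    rewrite Z0 measure0; move: u0; rewrite le_eqVlt => /orP[/eqP <-//|u0].
    have [|z /ltW zu] := @rays_bot _ m mfin u%:E; first by rewrite lte_fin.
    have : (cdist @^-1` ray u) z by rewrite /= in_itv/= -lee_fin cdistE.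
    by rewrite Z0.
  (* the points of rank at most u form a ray, closed at its supremum because m
     has no atom; its mass is u by continuity from both sides *)
  set Z := cdist @^-1` ray u.
  have ZE z : Z z <-> m (ray z) <= u%:E.
    by rewrite /Z /= in_itv/= -lee_fin cdistE.
  have [b bu] := rays_top um.
  have Zb : has_ubound Z.
    exists b => z /ZE zu; rewrite leNgt; apply/negP => bz.
    move: bu; apply/negP; rewrite -leNgt (le_trans _ zu)// le_rays//.
    exact: ltW.
  have sZ : has_sup Z by split => //; exists z0.
  have Zs : Z (sup Z).
    apply/ZE; apply: rays_left => // y ys.
    have [z Zz yz] := sup_gt (ex_intro _ z0 Zz0) ys.
    by move/ZE: Zz; apply: le_trans; apply: le_rays => //; exact: ltW.
  have -> : Z = ray (sup Z).
    apply/seteqP; split => t.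
      by move=> Zt; rewrite /= in_itv/=; apply: ub_le_sup.
    rewrite /= in_itv/= => ts; apply/ZE.
    by move/ZE: Zs; apply: le_trans; exact: le_rays.
  apply/eqP; rewrite eq_le; apply/andP; split; first by apply/ZE.
  apply: rays_right => // y sy; rewrite leNgt; apply/negP => yu.
  move: sy; apply/negP; rewrite -leNgt; apply: ub_le_sup => //.
  by apply/ZE/ltW.
rewrite setIC.
have H := @measure_eq_rays R (pushforward m C) (mrestr lambda mD).
refine (H cdist_measurable _ _ A mA).
- move=> z; rewrite -[LHS]/(m (cdist @^-1` ray z)) key.
  by rewrite -[RHS]/(lambda (ray z `&` _)) setIC.
- move=> z; rewrite -[X in X < _]/(m (cdist @^-1` ray z)) key (@le_lt_trans _ _ (lambda (`[0%R, z] : set R)))//.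
    apply: le_measure; rewrite ?inE//.
      by apply: measurableI => //; exact: ray_measurable.
    by move=> t [[/ltW t0 _]] /=; rewrite !in_itv/= => ->; rewrite t0.
  rewrite lebesgue_measure_itv/= lte_fin; case: ifP => // _.
  by rewrite -EFinB ltry.
Qed.

End rank.

Section quantile.
Variable m : {measure set T -> \bar R}.
Hypothesis mfin : forall z : R, m (ray z) < +oo.

(** The generalized inverse of the distribution function of [m]; the
convention outside of the possible ranks only serves to have a total
measurable function. *)
Definition quantile : T -> T :=
  (fun u : R => inf [set y : R | u%:E <= m (ray y)]) \_ (below (m setT)).

(** The Galois connection between the quantile and the distribution function:
the infimum is attained since distribution functions are right continuous. *)
Lemma quantileP (u y : R) : below (m setT) u ->
  (quantile u <= y)%R <-> u%:E <= m (ray y).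
Proof.
move=> Du; rewrite /quantile patchT ?inE//; have [u0 um] := Du.
set E := [set z | _].
have E0 : E !=set0.
  by have [z /ltW zu] := rays_top um; exists z.
have [b bu] := @rays_bot _ m mfin u%:E u0.
have Eb : lbound E b.
  move=> z Ez; rewrite leNgt; apply/negP => zb.
  move: bu; apply/negP; rewrite -leNgt (le_trans Ez)// le_rays//.
  exact: ltW.
split => [Ey|uy]; last by apply: ge_inf => //; exists b.
apply: rays_right => // z yz.
have [e Ee ez] := inf_lt E0 (le_lt_trans Ey yz).
by rewrite (le_trans Ee)// le_rays//; exact: ltW.
Qed.

Lemma quantile_measurable : measurable_fun setT quantile.
Proof.
have mD : measurable (below (m setT)) by exact: below_measurable.
apply/(measurable_restrictT _ mD) => _.
pose G : set (set T) := [set A | exists z : R, A = ray z].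
apply: (@measurability _ _ T T _ _ G) => //.
  rewrite RGenOInfty.measurableE; apply/seteqP; split.
    apply: smallest_sub; first exact: smallest_sigma_algebra.
    move=> _ [z ->]; rewrite -setCitvl.
    by apply: sigma_algebraC; apply: sub_sigma_algebra; exists z.
  apply: smallest_sub; first exact: smallest_sigma_algebra.
  move=> _ [z ->]; rewrite -setCitvr.
  by apply: sigma_algebraC; apply: sub_sigma_algebra; exists z.
move=> _ [_ [z ->] <-].
rewrite (_ : _ `&` _ = below (m setT) `&` ray (cdist m z)).
  by apply: measurableI => //; exact: ray_measurable.
apply/seteqP; split => t [Dt]; rewrite /= !in_itv/=.
  move=> H; split=> //; rewrite -lee_fin cdistE//.
  by apply/quantileP => //; rewrite /quantile patchT ?inE.
rewrite -lee_fin cdistE// => /(quantileP _ Dt) H; split=> //.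
by move: H; rewrite /quantile patchT ?inE.
Qed.

Lemma quantile_law A : measurable A ->
  lambda (below (m setT) `&` quantile @^-1` A) = m A.
Proof.
move=> mA.
pose Qi := isMeasurableFun.Build _ _ _ _ _ quantile_measurable.
pose Q : {mfun T >-> T} := HB.pack quantile Qi.
have mD : measurable (below (m setT)) by exact: below_measurable.
have key z : lambda (below (m setT) `&` quantile @^-1` ray z) = m (ray z).
  rewrite (_ : _ `&` _ = below (m setT) `&` ray (cdist m z)).
    rewrite lebesgue_below_ray ?cdistE//; first by rewrite /cdist fine_ge0.
    by rewrite le_measure ?inE//; exact: ray_measurable.
  apply/seteqP; split => t [Dt]; rewrite /= !in_itv/=.
    by move=> /(quantileP _ Dt) H; split=> //; rewrite -lee_fin cdistE.
  by rewrite -lee_fin cdistE// => /(quantileP _ Dt).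
rewrite setIC.
have H := @measure_eq_rays R (pushforward (mrestr lambda mD) Q) m.
refine (H quantile_measurable _ _ A mA).
- move=> z; rewrite -[LHS]/(lambda (quantile @^-1` ray z `&` _)).
  by rewrite setIC key.
- move=> z; rewrite -[X in X < _]/(lambda (quantile @^-1` ray z `&` _)).
  by rewrite setIC key.
Qed.

End quantile.

(** The increasing rearrangement of [m1] into [m2]: the rank of a point for
[m1] is sent to the point of the same rank for [m2].  Both halves preserve
measure, hence so does their composite, up to the part of [m2] that is left
over when [m1] has less mass. *)
Lemma monotone_transport (m1 m2 : {measure set T -> \bar R}) :
  (forall z : R, m1 (ray z) < +oo) -> (forall z : R, m2 (ray z) < +oo) ->
  (forall z : R, m1 [set z] = 0) -> m1 setT <= m2 setT ->
  exists tau : T -> T, [/\ measurable_fun setT tau,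
    forall A, measurable A -> m1 (tau @^-1` A) <= m2 A
    & {ae m1, forall z, forall y, m1 (ray z) <= m2 (ray y) -> (tau z <= y)%R}].
Proof.
move=> fin1 fin2 at1 m12.
have mD1 : measurable (below (m1 setT)) by exact: below_measurable.
have mD2 : measurable (below (m2 setT)) by exact: below_measurable.
have D12 : below (m1 setT) `<=` below (m2 setT).
  by move=> t [t0 tm]; split => //; exact: lt_le_trans m12.
have mq := quantile_measurable fin2.
have mc := cdist_measurable fin1.
exists (quantile m2 \o cdist m1); split.
- exact: measurableT_comp.
- move=> A mA; rewrite comp_preimage cdist_law//; last first.
    by rewrite -[X in measurable X]setTI; exact: mq.
  rewrite -(quantile_law fin2)//; apply: le_measure; rewrite ?inE.
  + by apply: measurableI => //; rewrite -[X in measurable X]setTI; exact: mq.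
  + by apply: measurableI => //; rewrite -[X in measurable X]setTI; exact: mq.
  + exact: setSI.
- exists (cdist m1 @^-1` (~` below (m1 setT))); split.
  + by rewrite -[X in measurable X]setTI; apply: mc => //; exact: measurableC.
  + by rewrite cdist_law ?setICr ?measure0//; exact: measurableC.
  + move=> z /= nz Dz; apply: nz => y ?.
    by apply/quantileP => //; [exact: D12|rewrite cdistE].
Qed.
End line_transport.

(** * Transport of densities respecting integer levels *)

Section level_transport.
Context {R : realType}.
Local Open Scope ereal_scope.
Local Notation T := (measurableTypeR R).
Local Notation mu := (halfline_measure R).
Local Notation ray z := (`]-oo, z]%classic : set T).

Lemma halfline_ae : {ae mu, forall x : R, (0 < x)%R}.
Proof.
exists (~` halfline R); split.
- by apply: measurableC; exact: measurable_halfline.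
- rewrite /halfline_measure /= /mrestr setIC setICr measure0//.
- move=> x /= nx xh; apply: nx; move: xh.
  by rewrite /halfline /= in_itv/= andbT.
Qed.

(** Monotonicity of almost everywhere statements, stated for this measure so
that the filter instance need not be found by unification. *)
Lemma aeS (P Q : T -> Prop) : (forall x, P x -> Q x) ->
  {ae mu, forall x, P x} -> {ae mu, forall x, Q x}.
Proof.
exact: (@filterS _ _ (ae_filter_ringOfSetsType mu)).
Qed.

Lemma aeS2 (P1 P2 Q : T -> Prop) : (forall x, P1 x -> P2 x -> Q x) ->
  {ae mu, forall x, P1 x} -> {ae mu, forall x, P2 x} -> {ae mu, forall x, Q x}.
Proof.
exact: (@filterS2 _ _ (ae_filter_ringOfSetsType mu)).
Qed.

Lemma aeS3 (P1 P2 P3 Q : T -> Prop) : (forall x, P1 x -> P2 x -> P3 x -> Q x) ->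
  {ae mu, forall x, P1 x} -> {ae mu, forall x, P2 x} -> {ae mu, forall x, P3 x} ->
  {ae mu, forall x, Q x}.
Proof.
exact: (@filterS3 _ _ (ae_filter_ringOfSetsType mu)).
Qed.

Lemma preimage_measurable d1 d2 (T1 : measurableType d1) (T2 : measurableType d2)
  (f : T1 -> T2) A : measurable_fun setT f -> measurable A -> measurable (f @^-1` A).
Proof. by move=> mf mA; rewrite -[X in measurable X]setTI; exact: mf. Qed.

Lemma density_null d (U : measurableType d) (m : {measure set U -> \bar R})
    (a : U -> R) (a0 : forall x, (0 <= a x)%R) (ma : measurable_fun setT a) N :
  measurable N -> \int[m]_(x in N) (a x)%:E = 0 ->
  {ae m, forall x, N x -> a x = 0%R}.
Proof.
move=> mN aN.
have mae : measurable_fun N (EFin \o a).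
  by apply/measurable_EFinP; exact: measurable_funTS.
have /(ae_eq_integral_abs m mN mae) : \int[m]_(x in N) `|(EFin \o a) x| = 0.
  by rewrite -[RHS]aN; apply: eq_integral => x _; rewrite gee0_abs ?lee_fin.
by apply: filterS => x /= H /H [].
Qed.

(** A positive point is encoded together with an integer level as one real
number, with the level as integer part and an increasing function of the point
as fractional part. Ordering these codes orders points by level first, and the
code is injective, so that no atom is created when a density is pushed forward
to the line of codes. *)
Definition frac (x : R) : R := (1 - expR (- `|x|))%R.
Definition key (l : T -> int) : T -> T := fun x => ((l x)%:~R + frac x)%R.
Definition unkey : T -> T := fun z : R => (- ln (1 - (z - (Num.floor z)%:~R)))%R.

Lemma frac_itv x : (0 <= frac x < 1)%R.
Proof.
rewrite /frac subr_ge0 -expR0 ler_expR lerNl oppr0 normr_ge0/=.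
by rewrite ltrBlDr ltrDl expR_gt0.
Qed.

Lemma floor_key l x : Num.floor (key l x) = l x.
Proof.
apply: floor_def; rewrite /key intrD lerDl ltrD2l; exact: frac_itv.
Qed.

Lemma keyK l x : (0 < x)%R -> unkey (key l x) = x.
Proof.
move=> x0; rewrite /unkey floor_key /key addrAC subrr add0r /frac subKr expRK.
by rewrite opprK gtr0_norm.
Qed.

Lemma floor_measurable : measurable_fun setT (fun z : R => (Num.floor z)%:~R : R).
Proof.
by apply: nondecreasing_measurable => // x y xy; rewrite ler_int le_floor.
Qed.

Lemma key_measurable l : measurable_fun setT (fun x => (l x)%:~R : R) ->
  measurable_fun setT (key l).
Proof.
move=> ml; apply: measurable_funD => //; apply: measurable_funB => //.
apply: (measurableT_comp (@measurable_expR R)).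
by apply: measurable_funN; exact: normr_measurable.
Qed.

Lemma unkey_measurable : measurable_fun setT unkey.
Proof.
apply: measurable_funN; apply: (measurableT_comp (@measurable_ln R)).
apply: measurable_funB => //; apply: measurable_funB => //.
exact: floor_measurable.
Qed.

Lemma halfline_set1 (z : R) : mu [set z] = 0.
Proof.
rewrite -[LHS]/(lebesgue_measure ([set z] `&` halfline R)).
apply/eqP; rewrite -measure_le0 -(lebesgue_measure_set1 z).
apply: le_measure; rewrite ?inE//.
by apply: measurableI => //; exact: measurable_halfline.
Qed.

Lemma halfline_le_integral (b : T -> R) (A B : set T) :
  (forall x, (0 <= b x)%R) -> measurable_fun setT b ->
  measurable A -> measurable B ->
  (forall x : R, (0 < x)%R -> A x -> B x) ->
  \int[mu]_(x in A) (b x)%:E <= \int[mu]_(x in B) (b x)%:E.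
Proof.
move=> b0 mb mA mB AB.
have mbe D : measurable_fun D (EFin \o b).
  by apply/measurable_EFinP; exact: measurable_funTS.
rewrite integral_mkcond [leRHS]integral_mkcond.
apply: ae_ge0_le_integral => //.
- by move=> x _; apply: erestrict_ge0 => y _; rewrite lee_fin.
- exact/(measurable_restrictT _ mA).
- by move=> x _; apply: erestrict_ge0 => y _; rewrite lee_fin.
- exact/(measurable_restrictT _ mB).
have := halfline_ae; apply: aeS => x x0 _; rewrite !patchE.
case: ifPn; case: ifPn; rewrite ?lee_fin// !(inE, notin_setE) => nB Ax.
by exfalso; apply: nB; exact: AB.
Qed.

Section two_densities.
Variables (a b : T -> R) (a0 : forall x, (0 <= a x)%R) (b0 : forall x, (0 <= b x)%R).
Hypotheses (ma : measurable_fun setT a) (mb : measurable_fun setT b).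
Variables (l k : T -> int) (d : int).
Hypotheses (ml : measurable_fun setT (fun x => (l x)%:~R : R))
           (mk : measurable_fun setT (fun x => (k x)%:~R : R)).

Lemma level_measurable (h : T -> int) (n : int) :
  measurable_fun setT (fun x => (h x)%:~R : R) ->
  measurable [set x | (h x <= n)%R].
Proof.
move=> mh.
rewrite (_ : mkset _ = (fun x => (h x)%:~R : R) @^-1` ray n%:~R).
  by apply: preimage_measurable => //; exact: ray_measurable.
by apply/seteqP; split => x /=; rewrite in_itv/= ler_int.
Qed.

(** The monotone rearrangement between the images of the two densities under
their codes, read back on the half-line. A point of code z has level floor z,
so the mass of [a] below z is at most the mass of [b] at levels up to floor z
+ d, hence at codes up to floor z + d + 1: this is where the level of the
image can lose one unit more than [d]. *)
Lemma level_transport :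
  (forall n : int, \int[mu]_(x in [set x | (k x <= n)%R]) (b x)%:E < +oo) ->
  (forall n : int, \int[mu]_(x in [set x | (l x <= n)%R]) (a x)%:E <=
                   \int[mu]_(x in [set x | (k x <= n + d)%R]) (b x)%:E) ->
  exists sigma : T -> T, [/\ measurable_fun setT sigma,
    forall A, measurable A ->
      \int[mu]_(x in sigma @^-1` A) (a x)%:E <= \int[mu]_(x in A) (b x)%:E
    & {ae mu, forall x, (0 < a x)%R ->
        (0 < b (sigma x))%R /\ (k (sigma x) <= l x + d + 1)%R}].
Proof.
move=> bfin ab.
have mkl := key_measurable ml; have mkk := key_measurable mk.
pose m1_ : {measure set T -> \bar R} := pushforward (density mu a0 ma) (key l).
pose m2_ : {measure set T -> \bar R} := pushforward (density mu b0 mb) (key k).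
pose m1 := m1_ mkl; pose m2 := m2_ mkk.
have m1E A : m1 A = \int[mu]_(x in key l @^-1` A) (a x)%:E by [].
have m2E A : m2 A = \int[mu]_(x in key k @^-1` A) (b x)%:E by [].
have mae D : measurable_fun D (EFin \o a).
  by apply/measurable_EFinP; exact: measurable_funTS.
have mbe D : measurable_fun D (EFin \o b).
  by apply/measurable_EFinP; exact: measurable_funTS.
have mray (h : T -> int) z : measurable_fun setT (key h) ->
    measurable (key h @^-1` ray z).
  by move=> ?; apply: preimage_measurable => //; exact: ray_measurable.
have key_le h x (z : R) : (key h x <= z)%R -> (h x <= Num.floor z)%R.
  by move=> kz; rewrite -(floor_key h x) le_floor.
have le_key h x (n : int) : (h x <= n)%R -> (key h x <= (n + 1)%:~R)%R.
  move=> hn; apply/ltW; rewrite -floor_lt_int floor_key; lia.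
have m1fin z : m1 (ray z) <= \int[mu]_(x in [set x | (l x <= Num.floor z)%R]) (a x)%:E.
  rewrite m1E; apply: ge0_subset_integral => //.
  - exact: mray.
  - exact: level_measurable.
  - by move=> x _; rewrite lee_fin.
  - by move=> x; rewrite /= in_itv/=; exact: key_le.
have m2fin z : m2 (ray z) < +oo.
  rewrite m2E (le_lt_trans _ (bfin (Num.floor z)))//.
  apply: ge0_subset_integral => //.
  - exact: mray.
  - exact: level_measurable.
  - by move=> x _; rewrite lee_fin.
  - by move=> x; rewrite /= in_itv/=; exact: key_le.
have m2big (n : int) : \int[mu]_(x in [set x | (k x <= n)%R]) (b x)%:E <=
    m2 (ray ((n + 1)%:~R)%R).
  rewrite m2E; apply: ge0_subset_integral => //.
  - exact: level_measurable.
  - exact: mray.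
  - by move=> x _; rewrite lee_fin.
  - by move=> x; rewrite /= in_itv/=; exact: le_key.
have m12 z : m1 (ray z) <= m2 (ray ((Num.floor z + d + 1)%:~R)%R).
  exact: le_trans (m1fin z) (le_trans (ab _) (m2big _)).
have [||||tau [mtau tauA tauz]] := @monotone_transport R m1 m2.
- move=> z; exact: le_lt_trans (m12 z) (m2fin _).
- exact: m2fin.
- move=> z; rewrite m1E null_set_integral//.
    by apply: preimage_measurable => //; exact: measurable_set1.
  rewrite -[LHS]/(lebesgue_measure (key l @^-1` [set z] `&` halfline R)).
  apply/eqP; rewrite -measure_le0 -(lebesgue_measure_set1 (unkey z)).
  apply: le_measure; rewrite ?inE//.
    apply: measurableI; last exact: measurable_halfline.
    by apply: preimage_measurable => //; exact: measurable_set1.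
  move=> x [/= kx]; rewrite /halfline /= in_itv/= andbT => x0.
  by rewrite -kx keyK.
- rewrite leNgt; apply/negP => /rays_top[z].
  apply/negP; rewrite -leNgt (le_trans (m12 z))// le_measure ?inE//.
have mu_ := unkey_measurable.
exists (unkey \o tau \o key l); split.
- by apply: measurableT_comp => //; exact: measurableT_comp.
- move=> A mA; have mUA : measurable (unkey @^-1` A) by exact: preimage_measurable.
  apply: le_trans (tauA _ mUA) _; rewrite m2E.
  by apply: halfline_le_integral => //; [exact: preimage_measurable|
    move=> x x0 /=; rewrite keyK].
(* codes z that come from a point where b is positive; the other ones are null
   for the image of b, hence for that of a under tau *)
- pose good := [set z : T | key k (unkey z) = z /\ (0 < b (unkey z))%R].
  have mgood : measurable good.
    have -> : good = [set z | key k (unkey z) = z] `&`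
        [set z | (0 < b (unkey z))%R] by [].
    apply: measurableI.
      rewrite (_ : mkset _ = (fun z => key k (unkey z) - z)%R @^-1` [set 0%R]).
        apply: preimage_measurable; last exact: measurable_set1.
        by apply: measurable_funB => //; exact: measurableT_comp.
      apply/seteqP; split => z /=; first by move=> ->; rewrite subrr.
      by move/eqP; rewrite subr_eq0 => /eqP.
    rewrite (_ : mkset _ = (b \o unkey) @^-1` `]0%R, +oo[).
      by apply: preimage_measurable => //; exact: measurableT_comp.
    by apply/seteqP; split => z /=; rewrite in_itv/= andbT.
  have m2good : m2 (~` good) = 0.
    apply/eqP; rewrite -measure_le0 -[leLHS]/(m2 (~` good)) m2E.
    rewrite (@le_trans _ _ (\int[mu]_(x in [set x | b x = 0%R]) (b x)%:E))//.
      apply: halfline_le_integral => //.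
      + by apply: preimage_measurable => //; exact: measurableC.
      + rewrite (_ : mkset _ = b @^-1` [set 0%R])//.
        by apply: preimage_measurable => //; exact: measurable_set1.
      + move=> x x0 /= /not_andP; rewrite keyK// => -[//|/negP].
        by rewrite -leNgt => bx; apply/eqP; rewrite eq_le bx b0.
    by rewrite integral0_eq// => x /= ->.
  have m1good : m1 (tau @^-1` ~` good) = 0.
    apply/eqP; rewrite -measure_le0 -m2good; apply: tauA.
    exact: measurableC.
  have mtg : measurable (tau @^-1` ~` good).
    by apply: preimage_measurable => //; exact: measurableC.
  have := density_null a0 ma (preimage_measurable mkl mtg) m1good.
  have [N [mN N0 sN]] := tauz.
  have := density_null a0 ma (preimage_measurable mkl mN) N0.
  apply: aeS2 => x /= Nx gx ax0.
  have /contrapT[gk gb] : ~ ~ good (tau (key l x)).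
    by move=> ng; move: ax0; rewrite (gx ng) ltxx.
  split => //.
  have tx y : m1 (ray (key l x)) <= m2 (ray y) -> (tau (key l x) <= y)%R.
    move=> H; apply/negPn/negP => nH.
    have /Nx ax : N (key l x) by apply: sN => /= /(_ y H); apply/negP.
    by move: ax0; rewrite ax ltxx.
  have := tx _ (m12 (key l x)); rewrite floor_key => /le_floor.
  by rewrite intrKfloor -(floor_key k) gk.
Qed.

End two_densities.
End level_transport.

(** * Classes of functions and Lebesgue quasi-norms *)

Section L0_toolkit.
Context {R : realType}.
Local Open Scope ereal_scope.
Local Notation T := (measurableTypeR R).
Local Notation mu := (halfline_measure R).
Local Notation V := (L0h R).

Definition toL0 (h : T -> R) (mh : measurable_fun setT h) : V :=
  class0 mu (HB.pack_for {mfun T >-> R} h (isMeasurableFun.Build _ _ _ _ h mh)).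

Lemma toL0E (h : T -> R) (mh : measurable_fun setT h) :
  {ae mu, forall x, toL0 mh x = h x}.
Proof. have := @repr0K _ _ R mu (HB.pack_for {mfun T >-> R} h (isMeasurableFun.Build _ _ _ _ h mh)); by apply: aeS => x /= /(_ I). Qed.

Lemma L0P (f g : V) : f = g <-> {ae mu, forall x, f x = g x}.
Proof.
rewrite -[in X in X <-> _](class0K f) -[in X in X <-> _](class0K g) class0P.
by split; apply: aeS => x; [move=> /(_ I)|].
Qed.

Lemma measurable_L0 (f : V) : measurable_fun setT (f : T -> R).
Proof. exact: measurable_funPT. Qed.
Hint Resolve measurable_L0 : core.

Lemma L0D (f g : V) : {ae mu, forall x, ((f + g)%R : V) x = (f x + g x)%R}.
Proof.
rewrite -[(f + g)%R]/(class0 mu (repr0 f + repr0 g)%R).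
have := @repr0K _ _ R mu (repr0 f + repr0 g)%R; by apply: aeS => x /= /(_ I).
Qed.

Lemma L0N (f : V) : {ae mu, forall x, ((- f)%R : V) x = (- f x)%R}.
Proof.
rewrite -[(- f)%R]/(class0 mu (- repr0 f)%R).
have := @repr0K _ _ R mu (- repr0 f)%R; by apply: aeS => x /= /(_ I).
Qed.

Lemma L0Z (a : R) (f : V) : {ae mu, forall x, ((a *: f)%R : V) x = (a * f x)%R}.
Proof.
rewrite -[(a *: f)%R]/(class0 mu (a *: repr0 f)%R).
have := @repr0K _ _ R mu (a *: repr0 f)%R; by apply: aeS => x /= /(_ I).
Qed.

Lemma L00 : {ae mu, forall x, (0%R : V) x = 0%R}.
Proof.
rewrite -[(0%R : V)]/(class0 mu 0%R).
have := @repr0K _ _ R mu (0%R : {mfun T >-> R}); by apply: aeS => x /= /(_ I).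
Qed.

Lemma L0B (f g : V) : {ae mu, forall x, ((f - g)%R : V) x = (f x - g x)%R}.
Proof. by move: (L0D f (- g)%R) (L0N g); apply: aeS2 => x -> ->. Qed.

Definition abs0 (f : V) : V :=
  toL0 (measurableT_comp (@normr_measurable R setT) (measurable_L0 f)).

Lemma abs0E (f : V) : {ae mu, forall x, abs0 f x = `|f x|%R}.
Proof. exact: toL0E. Qed.

Lemma abs0_le (f : V) : {ae mu, forall x, (`|abs0 f x| <= `|f x|)%R}.
Proof. by move: (abs0E f); apply: aeS => x ->; rewrite normr_id. Qed.

Lemma halfline_gt0 : 0 < mu setT.
Proof.
rewrite -[X in _ < X]/(lebesgue_measure (setT `&` halfline R)) setTI.
by rewrite /halfline lebesgue_measure_itv/= ltry addye// ltry.
Qed.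

(** The power of the quasi-norm, easier to handle than the quasi-norm itself.
*)
Definition pint (r : R) (f : T -> R) := \int[mu]_x (`|f x| `^ r)%:E.

Lemma pow_measurable (r : R) (f : T -> R) : measurable_fun setT f ->
  measurable_fun setT (fun x => `|f x| `^ r)%R.
Proof.
move=> mf; apply: (measurableT_comp (@measurable_powR R r)).
by apply: measurableT_comp => //; exact: normr_measurable.
Qed.

Lemma epow_measurable D (r : R) (f : T -> R) : measurable_fun setT f ->
  measurable_fun D (fun x => (`|f x| `^ r)%:E).
Proof.
by move=> mf; apply/measurable_EFinP; apply: measurable_funTS; exact: pow_measurable.
Qed.

Lemma pint_ge0 r f : 0 <= pint r f.
Proof. by apply: integral_ge0 => x _; rewrite lee_fin powR_ge0. Qed.

Lemma LpE (r : R) (f : V) : Lp r%:E f = pint r f `^ r^-1.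
Proof. by rewrite /Lp unlock. Qed.

Lemma Lp_ge0 (p : \bar R) (f : V) : 0 <= Lp p f.
Proof. exact: Lnorm_ge0. Qed.

Lemma Lp_le (r A : R) (f : V) : (0 < r)%R -> (0 <= A)%R ->
  Lp r%:E f <= A%:E <-> pint r f <= (A `^ r)%:E.
Proof.
move=> r0 A0.
have rE : pint r f = (Lp r%:E f) `^ r.
  by rewrite LpE -poweRrM mulVf ?gt_eqF// poweRe1// pint_ge0.
have AE : A%:E = (A `^ r)%:E `^ r^-1.
  by rewrite poweR_EFin -powRrM mulfV ?gt_eqF// powRr1.
split => H.
  rewrite rE -poweR_EFin gt0_ler_poweR ?in_itv/= ?andbT ?leey//.
  - exact: ltW.
  - by rewrite Lp_ge0.
  - by rewrite lee_fin A0.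
rewrite LpE AE gt0_ler_poweR ?in_itv/= ?andbT ?leey ?lee_fin//.
- by rewrite invr_ge0 ltW.
- by rewrite pint_ge0.
- by rewrite powR_ge0.
Qed.

Lemma Linf_le (A : R) (f : V) :
  Lp +oo f <= A%:E <-> {ae mu, forall x, (`|f x| <= A)%R}.
Proof.
rewrite /Lp unlock /Lnorm halfline_gt0.
split => [/ess_supP|H].
  by apply: aeS => x /=; rewrite lee_fin.
by apply/ess_supP; move: H; apply: aeS => x /=; rewrite lee_fin.
Qed.

Lemma le_pint r (f g : T -> R) : (0 <= r)%R -> measurable_fun setT f ->
  measurable_fun setT g ->
  {ae mu, forall x, (`|g x| <= `|f x|)%R} -> pint r g <= pint r f.
Proof.
move=> r0 mf mg gf; apply: ae_ge0_le_integral => //.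
- exact: epow_measurable.
- exact: epow_measurable.
move: gf; apply: aeS => x gf _; rewrite lee_fin ge0_ler_powR// nnegrE//.
Qed.

Lemma Lp_solid (p : \bar R) (f g : V) : 0 < p ->
  {ae mu, forall x, (`|g x| <= `|f x|)%R} -> Lp p g <= Lp p f.
Proof.
case: p => [r||]// r0 gf; last first.
  rewrite /Lp unlock /Lnorm halfline_gt0.
  by apply: le_ess_sup; move: gf; apply: aeS => x /=; rewrite lee_fin.
have [->|] := eqVneq (Lp r%:E f) +oo; first by rewrite leey.
move=> H1; have : Lp r%:E f \is a fin_num by rewrite ge0_fin_numE ?Lp_ge0// lt_neqAle H1 leey.
case E : (Lp r%:E f) => [A||]// _.
have A0 : (0 <= A)%R by rewrite -lee_fin -E Lp_ge0.
apply/Lp_le => //; apply: (@le_trans _ _ (pint r f)).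
  by apply: le_pint => //; exact: ltW.
by apply/Lp_le => //; rewrite E.
Qed.

Lemma LpZ (p : \bar R) (a : R) (f : V) : 0 < p ->
  Lp p (a *: f)%R = `|a|%:E * Lp p f.
Proof.
case: p => [r||]// r0.
  rewrite !LpE.
  have -> : pint r ((a *: f)%R : V) = (`|a| `^ r)%:E * pint r f.
    rewrite /pint -ge0_integralZl; [|exact: measurableT|exact: epow_measurable|
      by move=> x _; rewrite lee_fin powR_ge0|by rewrite lee_fin powR_ge0].
    apply: ge0_ae_eq_integral; [exact: measurableT|exact: epow_measurable| |
      by move=> x _; rewrite lee_fin powR_ge0|
      by move=> x _; rewrite -EFinM lee_fin mulr_ge0// powR_ge0|].
      by apply: emeasurable_funM => //; exact: epow_measurable.
    move: (L0Z a f); apply: aeS => x -> _.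
    by rewrite normrM powRM.
  rewrite poweRM ?pint_ge0 ?lee_fin ?powR_ge0//.
  by rewrite poweR_EFin -powRrM mulfV ?powRr1// gt_eqF.
rewrite /Lp unlock /Lnorm halfline_gt0 -ess_supZl// ?halfline_gt0//.
by apply: eq_ess_sup; move: (L0Z a f); apply: aeS => x /= ->; rewrite normrM EFinM.
Qed.

Lemma Lp0 (p : \bar R) : 0 < p -> Lp p (0%R : V) = 0.
Proof. by move=> p0; rewrite -(scale0r (0%R : V)) LpZ// normr0 mul0e. Qed.

End L0_toolkit.
#[export] Hint Resolve measurable_L0 : core.

(** * Weighted composition operators *)

Section wcomp.
Context {R : realType}.
Local Open Scope ereal_scope.
Local Notation T := (measurableTypeR R).
Local Notation mu := (halfline_measure R).
Local Notation V := (L0h R).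

Variables (a b w : T -> R) (sigma : T -> T).
Hypotheses (a0 : forall x, (0 <= a x)%R) (b0 : forall x, (0 <= b x)%R).
Hypotheses (ma : measurable_fun setT a) (mb : measurable_fun setT b).
Hypotheses (mw : measurable_fun setT w) (ms : measurable_fun setT sigma).
Hypothesis sab : forall A, measurable A ->
  \int[mu]_(x in sigma @^-1` A) (a x)%:E <= \int[mu]_(x in A) (b x)%:E.
Hypothesis wab : {ae mu, forall x, w x <> 0%R ->
  (0 < a x)%R /\ (0 < b (sigma x))%R}.

Lemma wcomp_measurable (h : V) : measurable_fun setT (fun x => w x * h (sigma x))%R.
Proof.
apply: measurable_funM => //.
exact: (measurableT_comp (measurable_L0 h) ms).
Qed.

Definition wcomp (h : V) : V := toL0 (wcomp_measurable h).

Lemma wcompE h : {ae mu, forall x, wcomp h x = (w x * h (sigma x))%R}.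
Proof. exact: toL0E. Qed.

(** Composition with [sigma] does not respect almost everywhere equality in
general. It does where the weight does not vanish: the preimage of a null set
has no mass for [a], and [a] is positive there. *)
Lemma wcomp_ae (P : T -> Prop) : {ae mu, forall x, P x} ->
  {ae mu, forall x, w x <> 0%R -> P (sigma x)}.
Proof.
move=> [N [mN N0 sN]].
have aN : \int[mu]_(x in sigma @^-1` N) (a x)%:E = 0.
  apply/eqP; rewrite eq_le integral_ge0 ?andbT; last by move=> x _; rewrite lee_fin.
  apply: le_trans (sab mN) _; rewrite null_set_integral//.
  by apply/measurable_EFinP; exact: measurable_funTS.
have := density_null a0 ma (preimage_measurable ms mN) aN.
move: wab; apply: aeS2 => x wx ax w0.
apply: contrapT => nP; have /ax ax0 : N (sigma x) by apply: sN.
by have [] := wx w0; rewrite ax0 ltxx.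
Qed.

Lemma wcomp_linear (c : R) (f g : V) :
  wcomp (c *: f + g)%R = (c *: wcomp f + wcomp g)%R.
Proof.
apply/L0P.
have H1 : {ae mu, forall x, ((c *: f + g)%R : V) x = (c * f x + g x)%R}.
  by move: (L0D (c *: f)%R g) (L0Z c f); apply: aeS2 => x -> ->.
have H2 : {ae mu, forall x, ((c *: wcomp f + wcomp g)%R : V) x =
    (c * (w x * f (sigma x)) + w x * g (sigma x))%R}.
  move: (L0D (c *: wcomp f)%R (wcomp g)) (L0Z c (wcomp f)) => h1 h2.
  have h3 : {ae mu, forall x, ((c *: wcomp f + wcomp g)%R : V) x =
     (c * wcomp f x + wcomp g x)%R}.
    by move: h1 h2; apply: aeS2 => x -> ->.
  by move: h3 (wcompE f) (wcompE g); apply: aeS3 => x -> -> ->.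
move: (wcomp_ae H1) H2 (wcompE (c *: f + g)%R); apply: aeS3 => x h1 -> ->.
have [->|/eqP w0] := eqVneq (w x) 0%R; first by rewrite !mul0r mulr0 addr0.
by rewrite (h1 w0) mulrDr mulrCA.
Qed.

Lemma transport_integral (u : T -> R) : (forall y, (0 <= u y)%R) ->
  measurable_fun setT u ->
  \int[mu]_x (a x * u (sigma x))%:E <= \int[mu]_y (b y * u y)%:E.
Proof.
move=> u0 mu_.
pose m1_ : {measure set T -> \bar R} := pushforward (density mu a0 ma) sigma.
pose m1 := m1_ ms.
have mue : measurable_fun setT (EFin \o u) by exact/measurable_EFinP.
have := @ge0_le_measure_integral _ T R m1 (density mu b0 mb) sab (EFin \o u) setT
  measurableT _ mue.
have H := @ge0_integral_pushforward _ _ _ _ R _ ms (density mu a0 ma) setT (EFin \o u)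
  measurableT mue.
rewrite {}H; last by move=> y _; rewrite lee_fin.
rewrite preimage_setT !integral_density//=.
- by apply => x; rewrite lee_fin.
- by move=> x; rewrite lee_fin.
- exact: (measurableT_comp mue ms).
Qed.

(** On the support of [w] the function |w h(sigma)|^r is at most C a times the
value at [sigma] of |h|^r / b, whose integral is at most that of |h|^r by
transport. *)
Lemma wcomp_pint (r C : R) (h : V) : (0 < r)%R -> (0 <= C)%R ->
  {ae mu, forall x, w x <> 0%R -> (`|w x| `^ r <= C * (a x / b (sigma x)))%R} ->
  pint r (wcomp h) <= C%:E * pint r h.
Proof.
move=> r0 C0 wC.
pose u y := (`|h y| `^ r * b y `^ (-1))%R.
have u0 y : (0 <= u y)%R by rewrite mulr_ge0// powR_ge0.
have mu_ : measurable_fun setT u.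
  apply: measurable_funM; first exact: pow_measurable.
  by apply: (measurableT_comp (@measurable_powR R _)).
have mau : measurable_fun setT (fun x => a x * u (sigma x))%R.
  by apply: measurable_funM => //; exact: (measurableT_comp mu_ ms).
apply: (@le_trans _ _ (\int[mu]_x (C * (a x * u (sigma x)))%:E)).
  apply: ae_ge0_le_integral.
  - exact: measurableT.
  - by move=> x _; rewrite lee_fin powR_ge0.
  - exact: epow_measurable.
  - by move=> x _; rewrite lee_fin mulr_ge0// mulr_ge0.
  - by apply/measurable_EFinP; exact: measurable_funM.
  move: (wcompE h) wC; apply: aeS2 => x -> wC _; rewrite lee_fin.
  have [->|/eqP w0] := eqVneq (w x) 0%R.
    rewrite mul0r normr0 powR0 ?gt_eqF//.
    by rewrite mulr_ge0// mulr_ge0.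
  rewrite normrM powRM// (le_trans (ler_wpM2r _ (wC w0)))// ?powR_ge0//.
  by rewrite /u powR_inv1// -!mulrA [(_ * (_ `^ r))%R]mulrC.
under eq_integral do rewrite EFinM.
rewrite ge0_integralZl; [|exact: measurableT|exact/measurable_EFinP|
  by move=> x _; rewrite lee_fin mulr_ge0|by rewrite lee_fin].
apply: lee_wpmul2l; first by rewrite lee_fin.
apply: le_trans (transport_integral u0 mu_) _.
apply: ge0_le_integral.
- exact: measurableT.
- by move=> x _; rewrite lee_fin mulr_ge0.
- by apply/measurable_EFinP; exact: measurable_funM.
- exact: epow_measurable.
- move=> x _; rewrite lee_fin /u powR_inv1// mulrCA ler_piMr ?powR_ge0//.
  have [->|bx] := eqVneq (b x) 0%R; first by rewrite mul0r.
  by rewrite mulfV.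
Qed.

Lemma wcomp_bounded (r C : R) : (0 < r)%R -> (0 <= C)%R ->
  {ae mu, forall x, w x <> 0%R -> (`|w x| `^ r <= C * (a x / b (sigma x)))%R} ->
  bounded_on wcomp (Lp r%:E).
Proof.
move=> r0 C0 wC; exists (C `^ r^-1)%R => h _.
rewrite !LpE -poweR_EFin -poweRM ?lee_fin ?pint_ge0//.
rewrite gt0_ler_poweR ?in_itv/= ?andbT ?leey ?pint_ge0//.
- by rewrite invr_ge0 ltW.
- by rewrite mule_ge0 ?pint_ge0.
- exact: wcomp_pint.
Qed.

Lemma wcomp_bounded_inf (M : R) : (0 <= M)%R ->
  {ae mu, forall x, (`|w x| <= M)%R} ->
  bounded_on wcomp (Lp +oo).
Proof.
move=> M0 wM; exists M => h hfin.
have /fineK hE : Lp +oo h \is a fin_num by rewrite ge0_fin_numE// Lp_ge0.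
have h0 : (0 <= fine (Lp +oo h))%R by rewrite fine_ge0// Lp_ge0.
rewrite -hE -EFinM; apply/Linf_le.
have /Linf_le/wcomp_ae H : Lp +oo h <= (fine (Lp +oo h))%:E by rewrite hE.
move: (wcompE h) wM H; apply: aeS3 => x -> wM H.
have [->|/eqP w0] := eqVneq (w x) 0%R.
  by rewrite mul0r normr0 mulr_ge0.
by rewrite normrM ler_pM//; exact: H.
Qed.

End wcomp.

(** * The K-functional of two lattices *)

Section Kfunctional_theory.
Context {R : realType}.
Local Open Scope ereal_scope.
Local Notation T := (measurableTypeR R).
Local Notation mu := (halfline_measure R).
Local Notation V := (L0h R).

(** The first part is [g] truncated at height |f0|. *)
Lemma riesz_split (g f0 f1 : V) :
  {ae mu, forall x, (`|g x| <= `|f0 x| + `|f1 x|)%R} ->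
  exists g0 g1 : V, [/\ g = (g0 + g1)%R,
    {ae mu, forall x, (`|g0 x| <= `|f0 x|)%R}
    & {ae mu, forall x, (`|g1 x| <= `|f1 x|)%R}].
Proof.
move=> gf.
have mf0 : measurable_fun setT (fun x => `|f0 x|)%R.
  exact: (measurableT_comp (@normr_measurable R setT) (measurable_L0 f0)).
have mc : measurable_fun setT (fun x => Num.max (Num.min (g x) `|f0 x|) (- `|f0 x|))%R.
  apply: measurable_maxr; first exact: measurable_minr.
  exact: measurable_funN.
pose g0 : V := toL0 mc.
exists g0, (g - g0)%R; split.
- by rewrite addrC subrK.
- move: (toL0E mc); apply: aeS => x ->; rewrite ler_norml.
  have n0 := normr_ge0 (f0 x).
  rewrite le_max lexx orbT/= ge_max ge_min lexx orbT/=.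
  by rewrite (le_trans _ n0)// oppr_le0.
- move: gf (toL0E mc) (L0B g g0); apply: aeS3 => x h -> ->; move: h.
  have n0 := normr_ge0 (f0 x); have n1 := normr_ge0 (f1 x).
  move: {f0 g0 mf0 mc} `|f0 x|%R `|f1 x|%R n0 n1 => n0 n1 n00 n10.
  rewrite ler_norml => /andP[gl gu].
  rewrite ler_norml lerBrDr lerBlDr addrC.
  by case: (leP (g x) n0) => h1; case: (leP _ (- n0)%R) => h2; apply/andP; split; lra.
Qed.

Variables N0 N1 : V -> \bar R.
Hypotheses (N0_ge0 : forall f, 0 <= N0 f) (N1_ge0 : forall f, 0 <= N1 f).

Local Notation K := (Kfunctional N0 N1).
Local Notation Sig := (Sigma N0 N1).

Lemma K_ge0 t x : (0 <= t)%R -> 0 <= K t x.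
Proof.
move=> t0; apply: le_ereal_inf_tmp => _ [x0 [x1 [_ _ _ ->]]].
by rewrite adde_ge0// mule_ge0// lee_fin.
Qed.

Lemma K_le t (x x0 x1 : V) : x = (x0 + x1)%R -> N0 x0 < +oo -> N1 x1 < +oo ->
  K t x <= N0 x0 + t%:E * N1 x1.
Proof. by move=> *; apply: ereal_inf_lbound; exists x0, x1. Qed.

Lemma K1 x : K 1 x = Sig x.
Proof.
congr ereal_inf; apply/seteqP; split => _ [x0 [x1 [-> h0 h1 ->]]];
  by exists x0, x1; rewrite mul1e.
Qed.

Lemma Sigma_ltP x : Sig x < +oo <->
  exists x0 x1, [/\ x = (x0 + x1)%R, N0 x0 < +oo & N1 x1 < +oo].
Proof.
split=> [/ereal_inf_lt[_ [x0 [x1 [-> h0 h1 _]]] _]|[x0 [x1 [-> h0 h1]]]].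
  by exists x0, x1.
apply: (@le_lt_trans _ _ (N0 x0 + N1 x1)); last exact: lte_add_pinfty.
by apply: ereal_inf_lbound; exists x0, x1.
Qed.

Lemma K_lty t x : (0 <= t)%R -> Sig x < +oo -> K t x < +oo.
Proof.
move=> t0 /Sigma_ltP[x0 [x1 [-> h0 h1]]].
apply: (le_lt_trans (K_le t erefl h0 h1)).
by rewrite lte_add_pinfty// lte_mul_pinfty// lee_fin.
Qed.

Lemma K_fineK t x : (0 <= t)%R -> Sig x < +oo -> (fine (K t x))%:E = K t x.
Proof. by move=> t0 sx; rewrite fineK// ge0_fin_numE ?K_ge0// K_lty. Qed.

Lemma le_K s t x : (0 <= s <= t)%R -> K s x <= K t x.
Proof.
move=> /andP[s0 st]; apply: le_ereal_inf_tmp => _ [x0 [x1 [-> h0 h1 ->]]].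
apply: le_trans (K_le s erefl h0 h1) _.
by rewrite leeD2l// lee_wpmul2r// lee_fin.
Qed.

Lemma K_quasiconcave s t x : (0 < s <= t)%R -> K t x <= (t / s)%:E * K s x.
Proof.
move=> /andP[s0 st].
rewrite -lee_pdivrMl ?divr_gt0 ?(lt_le_trans s0)//.
apply: le_ereal_inf_tmp => _ [x0 [x1 [-> h0 h1 ->]]].
have t0 := lt_le_trans s0 st.
rewrite lee_pdivrMl ?divr_gt0//.
apply: le_trans (K_le t erefl h0 h1) _.
rewrite ge0_muleDr//; last by rewrite mule_ge0// lee_fin ltW.
rewrite muleA -EFinM divfK ?gt_eqF// leeD2r// lee_pemull// lee_fin.
by rewrite ler_pdivlMr// mul1r.
Qed.

Hypotheses (N0_solid : forall f g : V,
    {ae mu, forall x, (`|g x| <= `|f x|)%R} -> N0 g <= N0 f)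
  (N1_solid : forall f g : V,
    {ae mu, forall x, (`|g x| <= `|f x|)%R} -> N1 g <= N1 f).

Lemma K_solid2 t (g f0 f1 : V) : (0 <= t)%R -> N0 f0 < +oo -> N1 f1 < +oo ->
  {ae mu, forall x, (`|g x| <= `|f0 x| + `|f1 x|)%R} ->
  K t g <= N0 f0 + t%:E * N1 f1.
Proof.
move=> t0 h0 h1 /riesz_split[g0 [g1 [-> /N0_solid gf0 /N1_solid gf1]]].
apply: le_trans (K_le t erefl (le_lt_trans gf0 h0) (le_lt_trans gf1 h1)) _.
by rewrite leeD// lee_wpmul2l// lee_fin.
Qed.

Lemma K_solid t (f g : V) : (0 <= t)%R ->
  {ae mu, forall x, (`|g x| <= `|f x|)%R} -> K t g <= K t f.
Proof.
move=> t0 gf; apply: le_ereal_inf_tmp => _ [x0 [x1 [fE h0 h1 ->]]].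
apply: K_solid2 => //; move: gf (L0D x0 x1); rewrite fE; apply: aeS2 => x h1' h2.
by rewrite (le_trans h1')// h2 ler_normD.
Qed.

Hypotheses (N0Z : forall a f, N0 (a *: f)%R = `|a|%:E * N0 f)
  (N1Z : forall a f, N1 (a *: f)%R = `|a|%:E * N1 f).

Lemma KZ t a x : (0 <= t)%R -> a != 0%R -> K t (a *: x)%R = `|a|%:E * K t x.
Proof.
move=> t0 a0.
have H c y : c != 0%R -> K t (c *: y)%R <= `|c|%:E * K t y.
  move=> c0; rewrite -lee_pdivrMl ?normr_gt0//.
  apply: le_ereal_inf_tmp => _ [x0 [x1 [-> h0 h1 ->]]].
  rewrite lee_pdivrMl ?normr_gt0//.
  rewrite ge0_muleDr//; last by rewrite mule_ge0// lee_fin.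
  rewrite muleCA -N0Z -N1Z; apply: K_le; rewrite ?scalerDr// ?N0Z ?N1Z.
  - by rewrite lte_mul_pinfty// lee_fin.
  - by rewrite lte_mul_pinfty// lee_fin.
apply/eqP; rewrite eq_le H//=.
rewrite -{1}[x](scalerK a0) -[leRHS]mul1e -lee_pdivlMl ?normr_gt0//.
rewrite mul1e -normfV; apply: H; exact: invr_neq0.
Qed.

(** Take t = a / b: then K(t, f) <= a + t b = 2 a, so some decomposition of g
costs less than 3 a, which bounds N0 g0 and t N1 g1. *)
Lemma K_le_decomposition (f g f0 f1 : V) (a b : R) :
  (0 < a)%R -> (0 < b)%R ->
  {ae mu, forall x, (`|f x| <= `|f0 x| + `|f1 x|)%R} ->
  N0 f0 <= a%:E -> N1 f1 <= b%:E ->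
  (forall t, (0 < t)%R -> K t g <= K t f) ->
  exists g0 g1 : V, [/\ g = (g0 + g1)%R, N0 g0 <= (3 * a)%:E & N1 g1 <= (3 * b)%:E].
Proof.
move=> a0 b0 ff Na Nb gf; pose t := (a / b)%R.
have t0 : (0 < t)%R by rewrite divr_gt0.
have Kg : K t g < (3 * a)%:E.
  rewrite (le_lt_trans (gf t t0))//.
  have := K_solid2 (ltW t0) (le_lt_trans Na (ltry _)) (le_lt_trans Nb (ltry _)) ff.
  move/le_lt_trans; apply; apply: (@le_lt_trans _ _ (a%:E + t%:E * b%:E)).
    by rewrite leeD// lee_wpmul2l// lee_fin ltW.
  rewrite -EFinM -EFinD lte_fin /t divfK ?gt_eqF//; lra.
move: Kg => /ereal_inf_lt[_ [g0 [g1 [-> h0 h1 ->]]]] lt3.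
exists g0, g1; split => //.
  by rewrite (le_trans _ (ltW lt3))// leeDl// mule_ge0// lee_fin ltW.
rewrite -(@lee_pmul2l _ t%:E) ?lte_fin//.
have -> : t%:E * (3 * b)%:E = (3 * a)%:E.
  by rewrite -EFinM /t mulrCA divfK ?gt_eqF.
by rewrite (le_trans _ (ltW lt3))// leeDr.
Qed.

End Kfunctional_theory.

(** * Limits and majorants in quasi-Banach lattices *)

Section majorants.
Context {R : realType}.
Local Open Scope ereal_scope.
Local Notation T := (measurableTypeR R).
Local Notation mu := (halfline_measure R).
Local Notation V := (L0h R).

(** The real part of the supremum in the extended reals: it is measurable, and
it is the supremum at the points where the sequence is bounded. *)
Lemma pointwise_sup (v : nat -> T -> R) :
  (forall n, measurable_fun setT (v n)) ->
  exists2 g : T -> R, measurable_fun setT g &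
    forall x B, (forall n, v n x <= B)%R ->
      (forall n, v n x <= g x)%R /\ (g x <= B)%R.
Proof.
move=> mv; pose s x := esups (fun n => (v n x)%:E) 0%N.
exists (fun x => fine (s x)).
  apply: (measurableT_comp (f := @fine R)) => //.
  by apply: measurable_fun_esups => n; exact/measurable_EFinP.
move=> x B vB.
have sB : s x <= B%:E.
  by apply: ge_ereal_sup => _ [n _ <-]; rewrite lee_fin.
have vs n : (v n x)%:E <= s x by apply: ereal_sup_ubound; exists n.
have sfin : s x \is a fin_num.
  by rewrite fin_numE; apply/andP; split; apply/eqP => sE;
    [have := vs 0%N|have := sB]; rewrite sE.
by split=> [n|]; rewrite -lee_fin fineK.
Qed.

(** The limit is the supremum of the lower bounds v k - 2 * 2^-k c, which
increase with k while the upper bounds v k + 2 * 2^-k c decrease. *)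
Lemma geometric_limit (v : nat -> V) (c : T -> R) : measurable_fun setT c ->
  {ae mu, forall x, (0 <= c x)%R} ->
  (forall k, {ae mu, forall x, (`|v k.+1 x - v k x| <= 2^-1 ^+ k * c x)%R}) ->
  exists phi : V, forall k,
    {ae mu, forall x, (`|v k x - phi x| <= 2 * 2^-1 ^+ k * c x)%R}.
Proof.
move=> mc c0 vc.
pose l k x := (v k x - 2 * 2^-1 ^+ k * c x)%R.
have ml k : measurable_fun setT (l k).
  by apply: measurable_funB => //; exact: measurable_funM.
have [g mg gP] := pointwise_sup ml.
exists (toL0 mg) => k.
have /ae_foralln vc' := vc.
move: c0 vc' (toL0E mg); apply: aeS3 => x c0 vcx ->.
pose r j := (v j x + 2 * 2^-1 ^+ j * c x)%R.
have step j : (l j x <= l j.+1 x)%R /\ (r j.+1 <= r j)%R.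
  have := vcx j; rewrite ler_norml /l /r exprS => /andP[].
  by move: (2^-1 ^+ j)%R => e h1 h2; split; lra.
have lr j : (l j x <= r j)%R.
  rewrite /l /r; have : (0 <= 2 * 2^-1 ^+ j * c x)%R.
    by rewrite mulr_ge0// mulr_ge0// exprn_ge0.
  lra.
have lnd : {homo (l ^~ x) : i j / (i <= j)%N >-> (i <= j)%R}.
  by apply: homo_leq => // [i j k' /le_trans|j]; [exact|have [] := step j].
have rni : {homo r : i j / (i <= j)%N >-> (j <= i)%R}.
  apply: homo_leq => // [i j k' h1 h2|j]; last by have [] := step j.
  exact: le_trans h2 h1.
have lrk i j : (l i x <= r j)%R.
  rewrite (le_trans (lnd _ _ (leq_maxl i j)))// (le_trans (lr _))//.
  exact: rni (leq_maxr i j).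
have [/(_ k) lg gr] := gP x (r k) (lrk^~ k).
rewrite distrC ler_norml; move: lg gr; rewrite /l /r; lra.
Qed.

Variable X : V -> \bar R.
Hypothesis X_lattice : quasi_banach_lattice X.

Lemma lattice_ge0 f : 0 <= X f. Proof. by have [[[]]] := X_lattice. Qed.

Lemma lattice_eq0 f : X f = 0 -> f = 0%R.
Proof. by have [[[_ H _ _]] _ _ /H] := X_lattice. Qed.

Lemma lattice_0 : X 0%R = 0.
Proof. by have [[[_ H _ _]] _ _] := X_lattice; apply/H. Qed.

Lemma latticeZ a f : X (a *: f)%R = `|a|%:E * X f.
Proof. by have [[[]]] := X_lattice. Qed.

Lemma latticeN f : X (- f)%R = X f.
Proof. by rewrite -scaleN1r latticeZ normrN1 mul1e. Qed.

Lemma lattice_solid (f g : V) :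
  {ae mu, forall x, (`|g x| <= `|f x|)%R} -> X g <= X f.
Proof.
move=> gf; have [Xf|] := ltP (X f) +oo; first by have [_] := X_lattice; apply.
by rewrite leye_eq => /eqP ->; rewrite leey.
Qed.

Lemma lattice_quasi : exists2 C : R, (1 <= C)%R &
  forall f g, X (f + g)%R <= C%:E * (X f + X g).
Proof.
have [[[_ _ _ [C C0 XC]] _] _] := X_lattice.
exists (Num.max C 1)%R; first by rewrite le_max lexx orbT.
move=> f g; apply: le_trans (XC f g) _.
by rewrite lee_wpmul2r ?adde_ge0 ?lattice_ge0// lee_fin le_max lexx.
Qed.

Lemma lattice_complete : complete_qnorm X.
Proof. by have [[]] := X_lattice. Qed.

(** With delta = 1 / (2 C), where C is the constant of the quasi-triangle
inequality, the partial sums of |h n| form a Cauchy sequence although C is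
applied once more at each term. Their limit is above each of them: the
positive part of |h m| - f is dominated by s n - f for all large n, and the
quasi-norm of s n - f tends to 0. *)
Lemma countable_majorant : exists2 delta : R, (0 < delta <= 2^-1)%R &
  forall h : nat -> V, (forall n, X (h n) <= (delta ^+ n)%:E) ->
  exists2 f : V, X f < +oo & forall n, {ae mu, forall x, (`|h n x| <= `|f x|)%R}.
Proof.
have [C C1 XC] := lattice_quasi.
have C0 : (0 < C)%R by lra.
pose delta := (2 * C)^-1%R.
have d0 : (0 < delta)%R by rewrite invr_gt0; lra.
have d2 : (delta <= 2^-1)%R by rewrite lef_pV2 ?posrE; lra.
exists delta; first by rewrite d0.
move=> h hd; pose u n := abs0 (h n).
have ud n : X (u n) <= (delta ^+ n)%:E.
  exact: le_trans (lattice_solid (abs0_le (h n))) (hd n).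
have dn n : (0 <= delta ^+ n)%R by apply: exprn_ge0; exact: ltW.
have tail k m : X (\sum_(m <= i < m + k) u i)%R <= (2 * C * delta ^+ m)%:E.
  elim: k m => [|k IH] m.
    rewrite addn0 big_geq// lattice_0 lee_fin mulr_ge0//; lra.
  rewrite addnS big_ltn ?ltnS ?leq_addr// -addSn.
  apply: le_trans (XC _ _) _.
  apply: (@le_trans _ _ (C * (delta ^+ m + 2 * C * delta ^+ m.+1))%:E).
    by rewrite EFinM EFinD lee_pmul2l// leeD// IH.
  rewrite lee_fin exprS mulrA divff ?mul1r; last by lra.
  lra.
pose s n : V := (\sum_(0 <= i < n) u i)%R.
have sB m n : (m <= n)%N -> (s n - s m)%R = (\sum_(m <= i < n) u i)%R.
  by move=> mn; rewrite /s (big_cat_nat (leq0n m) mn) /=; apply/eqP; rewrite subr_eq addrC.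
have sd m n : (m <= n)%N -> X (s n - s m)%R <= (2 * C * delta ^+ m)%:E.
  by move=> mn; rewrite sB// -(subnKC mn) tail.
have small e : (0 < e)%R -> exists n0, (2 * C * delta ^+ n0 < e)%R.
  move=> e0.
  have : (delta ^+ n)%R @[n --> \oo] --> (0 : R)%R.
    by apply: cvg_expr; rewrite ger0_norm ?ltW//; lra.
  move=> /cvgrPdist_lt/(_ (e / (2 * C)))%R.
  rewrite divr_gt0//; last by lra.
  move=> /(_ isT)[n0 _ /(_ n0 (leqnn _))] /=.
  rewrite sub0r normrN ger0_norm// ltr_pdivlMr; last by lra.
  by exists n0; rewrite mulrC.
have [|e e0|f_ Xf sf] := @lattice_complete s.
- move=> n; rewrite -(subr0 (s n)).
  have -> : 0%R = s 0%N by rewrite /s big_geq.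
  exact: le_lt_trans (sd _ _ (leq0n n)) (ltry _).
- have [n0 n0e] := small e e0; exists n0 => m n.
  have decr m' : (n0 <= m')%N -> (2 * C * delta ^+ m' < e)%R.
    move=> nm; apply: le_lt_trans n0e; rewrite ler_pM2l//; last by lra.
    by rewrite ler_wiXn2l// ltW//; lra.
  wlog mn : m n / (m <= n)%N.
    move=> H; have [mn|/ltnW nm] := leqP m n; first exact: H.
    by move=> n0m n0n; rewrite -opprB latticeN; exact: H.
  move=> n0m _; rewrite -opprB latticeN (le_lt_trans (sd _ _ mn))//.
  by rewrite lte_fin decr.
pose f : V := f_; exists f => // m.
have md : measurable_fun setT (fun x => Num.max (`|h m x| - f x) 0)%R.
  apply: measurable_maxr => //; apply: measurable_funB => //.
  exact: (measurableT_comp (@normr_measurable R setT) (measurable_L0 (h m))).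
pose d : V := toL0 md.
have sge n : (m < n)%N -> {ae mu, forall x, (`|h m x| <= s n x)%R}.
  move=> mn; have H k : {ae mu, forall x,
      (0 <= s k x)%R /\ ((m < k)%N -> (`|h m x| <= s k x)%R)}.
    elim: k => [|k IH].
      rewrite /s big_geq//; move: (@L00 R); apply: aeS => x ->.
      by split.
    have sS : s k.+1 = (s k + u k)%R by rewrite /s big_nat_recr.
    rewrite sS; move: IH (L0D (s k) (u k)) (abs0E (h k)).
    apply: aeS3 => x [H1 H2] -> -> ; have h0 := normr_ge0 (h k x); split.
      exact: addr_ge0.
    rewrite ltnS leq_eqVlt => /orP[/eqP ->|mk]; first by lra.
    by have := H2 mk; lra.
  by move: (H n); apply: aeS => x [_]; exact.
have dX n : (m < n)%N -> X d <= X (s n - f)%R.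
  move=> mn; apply: lattice_solid.
  move: (sge n mn) (toL0E md) (L0B (s n) f); apply: aeS3 => x h1 -> ->.
  rewrite ger0_norm ?le_max ?lexx ?orbT// ge_max normr_ge0 andbT.
  by rewrite (le_trans _ (ler_norm _))// lerB.
have Xd : X d <= 0.
  rewrite -(cvg_lim _ sf)//; apply: lime_ge; first exact: cvgP sf.
  by exists m.+1 => // n /= mn; exact: dX.
(* the positive part of |h m| - f is zero *)
have d0E : d = 0%R by apply: lattice_eq0; apply/eqP; rewrite eq_le Xd lattice_ge0.
have := toL0E md; rewrite -/d d0E => dE.
move: dE (@L00 R); apply: aeS2 => x -> /eqP; rewrite eq_le ge_max lexx andbT.
move=> /andP[H _]; rewrite (le_trans _ (ler_norm _))//; lra.
Qed.

End majorants.

(** * The parameter space generated by K-functionals *)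

Section hull.
Context {R : realType}.
Local Open Scope ereal_scope.
Local Notation T := (measurableTypeR R).
Local Notation mu := (halfline_measure R).
Local Notation V := (L0h R).

Lemma cut (D : set T) (f : V) : measurable D -> exists f0 f1 : V,
  [/\ f = (f0 + f1)%R,
      {ae mu, forall x, D x -> f0 x = f x /\ f1 x = 0%R}
    & {ae mu, forall x, ~ D x -> f0 x = 0%R /\ f1 x = f x}].
Proof.
move=> mD.
have m0 : measurable_fun setT (fun x => f x * \1_D x)%R.
  by apply: measurable_funM => //; exact: measurable_indic.
pose f0 : V := toL0 m0.
exists f0, (f - f0)%R; split; first by rewrite addrC subrK.
  move: (toL0E m0) (L0B f f0); apply: aeS2 => x h1 -> Dx.
  by rewrite h1 indicE mem_set// mulr1 subrr.
move: (toL0E m0) (L0B f f0); apply: aeS2 => x h1 -> Dx.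
by rewrite h1 indicE memNset// mulr0 subr0.
Qed.

Lemma Linfty_inv_le (A : R) (f : V) :
  Linfty_inv f <= A%:E <-> {ae mu, forall t, (`|f t / t| <= A)%R}.
Proof.
rewrite /Linfty_inv unlock /Lnorm halfline_gt0.
split => [/ess_supP|H].
  by apply: aeS => x /=; rewrite lee_fin.
by apply/ess_supP; move: H; apply: aeS => x /=; rewrite lee_fin.
Qed.

Lemma Linfty_inv_ge0 (f : V) : 0 <= Linfty_inv f.
Proof. exact: Lnorm_ge0. Qed.

(** This turns an almost everywhere statement into one at a point close to a
given one, which is enough for the K-functional since it varies little there.
*)
Lemma halfline_hits (a b : R) (P : T -> Prop) : (0 < a < b)%R ->
  {ae mu, forall x, P x} -> exists2 x : R, (a < x < b)%R & P x.
Proof.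
move=> /andP[a0 ab] [N [mN N0 sN]]; apply: contrapT => nex.
have : mu `]a, b[%classic <= mu N.
  apply: le_measure; rewrite ?inE//.
  move=> x /=; rewrite in_itv/= => xab; apply: sN => /= Px.
  by apply: nex; exists x.
rewrite N0 -[X in X <= _]/(lebesgue_measure (`]a, b[%classic `&` halfline R)).
rewrite setIidl; last first.
  move=> x; rewrite /halfline /= !in_itv/= andbT => /andP[ax _].
  exact: lt_trans ax.
by rewrite lebesgue_measure_itv/= lte_fin ab -EFinD lee_fin subr_le0 leNgt ab.
Qed.

Lemma cvge_to0 (h : nat -> \bar R) : (forall n, 0 <= h n) ->
  (forall e : R, (0 < e)%R -> exists n0, forall n, (n0 <= n)%N -> h n <= e%:E) ->
  h n @[n --> \oo] --> 0.
Proof.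
move=> h0 he; apply/fine_cvgP; split.
  have [n0 n0P] := he _ ltr01; exists n0 => // n /= /n0P hn.
  by rewrite ge0_fin_numE// (le_lt_trans hn)// ltry.
apply/cvgrPdist_le => e e0; have [n0 n0P] := he _ e0.
exists n0 => // n /= /n0P hn.
rewrite sub0r normrN ger0_norm ?fine_ge0//.
by rewrite -lee_fin fineK// ge0_fin_numE// (le_lt_trans hn)// ltry.
Qed.

Variables N0 N1 X : V -> \bar R.
Hypotheses (N0_ge0 : forall f, 0 <= N0 f) (N1_ge0 : forall f, 0 <= N1 f).
Hypotheses (N0_solid : forall f g : V,
    {ae mu, forall x, (`|g x| <= `|f x|)%R} -> N0 g <= N0 f)
  (N1_solid : forall f g : V,
    {ae mu, forall x, (`|g x| <= `|f x|)%R} -> N1 g <= N1 f).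
Hypotheses (N0Z : forall a f, N0 (a *: f)%R = `|a|%:E * N0 f)
  (N1Z : forall a f, N1 (a *: f)%R = `|a|%:E * N1 f).
Hypothesis X_lattice : quasi_banach_lattice X.
Hypothesis X_Sigma : continuously_included X (Sigma N0 N1).

Local Notation K := (Kfunctional N0 N1).
Local Notation Sig := (Sigma N0 N1).

Implicit Types (f g h phi psi : V) (s t : R).

Let X_ge0 := lattice_ge0 X_lattice.
Let X_solid := lattice_solid X_lattice.

Lemma lty_Sigma f : X f < +oo -> Sig f < +oo.
Proof.
move=> Xf; have [C /(_ _ Xf)] := X_Sigma; move/le_lt_trans; apply.
have /fineK <- : X f \is a fin_num by rewrite ge0_fin_numE.
by rewrite -EFinM ltry.
Qed.

Definition kf (f : V) (t : R) : R := fine (K t f).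

Lemma kfE f t : X f < +oo -> (0 < t)%R -> (kf f t)%:E = K t f.
Proof. by move=> Xf t0; apply: K_fineK => //; [exact: ltW|exact: lty_Sigma]. Qed.

Lemma kf_ge0 f t : (0 < t)%R -> (0 <= kf f t)%R.
Proof. by move=> t0; rewrite /kf fine_ge0// K_ge0// ltW. Qed.

Lemma le_kf f g t : X g < +oo -> {ae mu, forall x, (`|f x| <= `|g x|)%R} ->
  (0 < t)%R -> (kf f t <= kf g t)%R.
Proof.
move=> Xg fg t0; have Xf := le_lt_trans (X_solid fg) Xg.
by rewrite -lee_fin !kfE// K_solid// ltW.
Qed.

Lemma kfZ a f t : X f < +oo -> a != 0%R -> (0 < t)%R ->
  kf (a *: f)%R t = (`|a| * kf f t)%R.
Proof.
move=> Xf a0 t0; apply: EFin_inj; rewrite kfE//; last first.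
  by rewrite latticeZ// lte_mul_pinfty ?lee_fin.
by rewrite KZ// ?ltW// EFinM kfE.
Qed.

Lemma kf_nd f s t : X f < +oo -> (0 < s <= t)%R -> (kf f s <= kf f t)%R.
Proof.
move=> Xf /andP[s0 st]; have t0 := lt_le_trans s0 st.
by rewrite -lee_fin !kfE// le_K// ltW.
Qed.

Lemma kf_quasiconcave f s t : X f < +oo -> (0 < s <= t)%R ->
  (kf f t <= t / s * kf f s)%R.
Proof.
move=> Xf /andP[s0 st]; have t0 := lt_le_trans s0 st.
by rewrite -lee_fin EFinM !kfE// K_quasiconcave// s0.
Qed.

(** K(1, f) is the quasi-norm of f in the sum space, and K(., f) grows at most
linearly. *)
Lemma kf_bound : exists2 C : R, (1 <= C)%R & forall f t, X f < +oo ->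
  (0 < t)%R -> (kf f t <= Num.max 1 t * (C * fine (X f)))%R.
Proof.
have [C XC] := X_Sigma; exists (Num.max C 1)%R; first by rewrite le_max lexx orbT.
move=> f t Xf t0.
have Xfin : X f \is a fin_num by rewrite ge0_fin_numE.
have k1 : (kf f 1 <= Num.max C 1 * fine (X f))%R.
  rewrite -lee_fin kfE// K1 EFinM fineK//; apply: le_trans (XC _ Xf) _.
  by rewrite lee_wpmul2r// lee_fin le_max lexx.
have k0 := kf_ge0 f (ltr01 : 0 < 1 :> R)%R.
have [t1|t1] := leP t 1%R.
  by rewrite mul1r (le_trans _ k1)// kf_nd// t0.
apply: (@le_trans _ _ (t / 1 * kf f 1)%R).
  by apply: kf_quasiconcave => //; rewrite ltr01 ltW.
by rewrite divr1 ler_wpM2l// ltW.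
Qed.

(** The smallest lattice containing the functions K(., f), with f in X. *)
Definition hull (phi : V) : \bar R := ereal_inf [set r | exists f : V,
  [/\ X f < +oo, {ae mu, forall t, (`|phi t| <= kf f t)%R} & r = X f]].

Lemma hull_le phi f : X f < +oo -> {ae mu, forall t, (`|phi t| <= kf f t)%R} ->
  hull phi <= X f.
Proof. by move=> *; apply: ereal_inf_lbound; exists f. Qed.

Lemma hull_lt phi r : hull phi < r ->
  exists f : V, [/\ X f < +oo, {ae mu, forall t, (`|phi t| <= kf f t)%R} & X f < r].
Proof. by move=> /ereal_inf_lt[_ [f [Xf h ->]]]; exists f. Qed.

Lemma le_hull phi r : (forall f : V, X f < +oo ->
    {ae mu, forall t, (`|phi t| <= kf f t)%R} -> r <= X f) -> r <= hull phi.
Proof. by move=> H; apply: le_ereal_inf_tmp => _ [f [Xf h ->]]; exact: H. Qed.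

Lemma hull_ge0 phi : 0 <= hull phi.
Proof. by apply: le_hull. Qed.

Lemma hull_solid phi psi : {ae mu, forall x, (`|psi x| <= `|phi x|)%R} ->
  hull psi <= hull phi.
Proof.
move=> H; apply: le_hull => f Xf h; apply: hull_le => //.
by move: H h; apply: aeS2 => x; exact: le_trans.
Qed.

Lemma hull0 : hull 0%R = 0.
Proof.
apply/eqP; rewrite eq_le hull_ge0 andbT.
rewrite -(lattice_0 X_lattice); apply: hull_le; first by rewrite lattice_0.
move: (@L00 R) (@halfline_ae R); apply: aeS2 => x -> x0.
by rewrite normr0 kf_ge0.
Qed.

Lemma hullZ a phi : hull (a *: phi)%R = `|a|%:E * hull phi.
Proof.
have [->|a0] := eqVneq a 0%R; first by rewrite scale0r normr0 mul0e hull0.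
have H c psi : c != 0%R -> hull (c *: psi)%R <= `|c|%:E * hull psi.
  move=> c0; rewrite -lee_pdivrMl ?normr_gt0//.
  apply: le_hull => f Xf h; rewrite lee_pdivrMl ?normr_gt0//.
  rewrite -latticeZ//; apply: hull_le.
    by rewrite latticeZ// lte_mul_pinfty ?lee_fin.
  move: h (L0Z c psi) (@halfline_ae R); apply: aeS3 => x h -> x0.
  by rewrite kfZ// normrM ler_wpM2l.
apply/eqP; rewrite eq_le H//=.
rewrite -{1}[phi](scalerK a0) -[leRHS]mul1e -lee_pdivlMl ?normr_gt0//.
rewrite mul1e -normfV; apply: H; exact: invr_neq0.
Qed.

(** If the quasi-norm vanishes, [phi] is below K(., f) for elements f of
arbitrarily small quasi-norm, and these K-functionals tend to 0 pointwise. *)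
Lemma hull_eq0 phi : hull phi = 0 -> phi = 0%R.
Proof.
move=> h0; have [C C1 kC] := kf_bound.
have /ae_foralln H n : {ae mu, forall t : R,
    (0 < t)%R -> (`|phi t| * n.+1%:R <= Num.max 1 t * C)%R}.
  have [|f [Xf hf fn]] := @hull_lt phi (n.+1%:R^-1)%:E.
    by rewrite h0 lte_fin invr_gt0.
  move: hf; apply: aeS => t /= ht t0; rewrite -ler_pdivlMr// -mulrA.
  rewrite (le_trans ht)// (le_trans (kC _ _ Xf t0))//.
  rewrite ler_wpM2l ?le_max ?ler01// ler_wpM2l//; first by lra.
  by rewrite -lee_fin fineK ?ltW// ge0_fin_numE.
apply/L0P; move: H (@halfline_ae R) (@L00 R); apply: aeS3 => t H t0 ->.
apply/eqP; rewrite -normr_eq0 eq_le normr_ge0 andbT leNgt; apply/negP => p0.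
have := H (Num.trunc (Num.max 1 t * C / `|phi t|)%R) t0.
by rewrite mulrC -ler_pdivlMr// leNgt truncnS_gt.
Qed.

(** If f and g majorize phi and psi, then phi + psi is below the K-functional
of 2 (|f| + |g|). *)
Lemma hull_quasi : exists2 C : R, (1 <= C)%R &
  forall phi psi, hull (phi + psi)%R <= C%:E * (hull phi + hull psi).
Proof.
have [C C1 XC] := lattice_quasi X_lattice; exists (2 * C)%R; first by lra.
move=> phi psi.
have [hp|] := ltP (hull phi) +oo; last first.
  rewrite leye_eq => /eqP ->; rewrite addye ?gt_eqF// ?(lt_le_trans _ (hull_ge0 _))//.
  by rewrite gt0_muley ?leey// lte_fin; lra.
have [hq|] := ltP (hull psi) +oo; last first.
  rewrite leye_eq => /eqP ->; rewrite addey ?gt_eqF// ?(lt_le_trans _ (hull_ge0 _))//.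
  by rewrite gt0_muley ?leey// lte_fin; lra.
apply/lee_addgt0Pr => e e0.
pose d := (e / (4 * C))%R.
have d0 : (0 < d)%R by rewrite divr_gt0//; lra.
have fp : hull phi \is a fin_num by rewrite ge0_fin_numE// hull_ge0.
have fq : hull psi \is a fin_num by rewrite ge0_fin_numE// hull_ge0.
have [|f [Xf hf fd]] := @hull_lt phi (hull phi + d%:E).
  by rewrite lteDl// lte_fin.
have [|g [Xg hg gd]] := @hull_lt psi (hull psi + d%:E).
  by rewrite lteDl// lte_fin.
pose h : V := (abs0 f + abs0 g)%R.
have hE : {ae mu, forall x, h x = (`|f x| + `|g x|)%R}.
  by move: (L0D (abs0 f) (abs0 g)) (abs0E f) (abs0E g); apply: aeS3 => x -> -> ->.
have Xh : X h <= C%:E * (X f + X g).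
  apply: le_trans (XC _ _) _; rewrite lee_pmul2l ?lte_fin//; last by lra.
  by rewrite leeD// X_solid//; exact: abs0_le.
have Xhfin : X h < +oo.
  apply: le_lt_trans Xh _.
  by rewrite lte_mul_pinfty ?lee_fin ?lte_add_pinfty//; lra.
have X2h : X (2 *: h)%R = 2%:E * X h by rewrite latticeZ// ger0_norm.
have fh : {ae mu, forall x, (`|f x| <= `|h x|)%R}.
  move: hE; apply: aeS => x ->; rewrite [leRHS]ger0_norm ?addr_ge0//.
  by rewrite lerDl.
have gh : {ae mu, forall x, (`|g x| <= `|h x|)%R}.
  move: hE; apply: aeS => x ->; rewrite [leRHS]ger0_norm ?addr_ge0//.
  by rewrite lerDr.
apply: (@le_trans _ _ (X (2 *: h)%R)).
  apply: hull_le; first by rewrite X2h lte_mul_pinfty ?lee_fin.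
  have H := @halfline_ae R.
  have H1 : {ae mu, forall t, (`|phi t| <= kf h t)%R}.
    by move: hf H; apply: aeS2 => t h1 t0; rewrite (le_trans h1)// le_kf.
  have H2 : {ae mu, forall t, (0 < t)%R /\ (`|psi t| <= kf h t)%R}.
    by move: hg H; apply: aeS2 => t h1 t0; rewrite (le_trans h1)// le_kf.
  move: H1 H2 (L0D phi psi); apply: aeS3 => t h1 [t0 h2] ->.
  rewrite kfZ// [`|2|%R]ger0_norm// (le_trans (ler_normD _ _))//; lra.
rewrite X2h; apply: (@le_trans _ _ (2%:E * (C%:E * (X f + X g)))).
  by rewrite lee_pmul2l.
apply: (@le_trans _ _ (2%:E * (C%:E * (hull phi + d%:E + (hull psi + d%:E))))).
  rewrite lee_pmul2l// lee_pmul2l ?lte_fin//; last by lra.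
  by apply: leeD; exact: ltW.
rewrite -(fineK fp) -(fineK fq) -?(EFinD, EFinM) lee_fin.
have -> : e = (4 * C * d)%R by rewrite /d mulrC divfK//; lra.
lra.
Qed.

(** A subsequence has increments below K(., f k), where X (f k) is so small
that even 2^k f k have a common majorant F. The increments are then at most
2^-k K(., F), the subsequence converges pointwise, and the distance to its
limit is at most 2 * 2^-k K(., F). *)
Lemma hull_complete : complete_qnorm hull.
Proof.
have [C C1 hC] := hull_quasi; have [delta /andP[d0 d2] major] := countable_majorant X_lattice.
move=> u ufin ucau.
pose eps k := ((delta / 2) ^+ k)%R.
have e0 k : (0 < eps k)%R by rewrite exprn_gt0// divr_gt0.
have [N NP] := choice (fun k => ucau (eps k) (e0 k)).
(* an increasing sequence of indices beyond the moduli N *)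
pose M k := (\sum_(i < k.+1) N i)%N.
have MN k m : (M k <= m)%N -> (N k <= m)%N.
  by apply: leq_trans; rewrite /M big_ord_recr/= leq_addl.
have Mnd k : (M k <= M k.+1)%N by rewrite /M [in leqRHS]big_ord_recr leq_addr.
pose v k : V := u (M k).
have vk k : exists f : V, [/\ X f < +oo,
    {ae mu, forall t, (`|((v k.+1 - v k)%R : V) t| <= kf f t)%R} & X f < (eps k)%:E].
  by apply: hull_lt; apply: NP; apply: MN => //; rewrite -/(M k).
have [f fP] := choice vk.
have [|F XF hF] := major (fun k => (2 ^+ k *: f k)%R).
  move=> k; have [Xf _ fk] := fP k; rewrite latticeZ// ger0_norm ?exprn_ge0//.
  rewrite (le_trans (lee_wpmul2l _ (ltW fk))) ?lee_fin ?exprn_ge0//.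
  by rewrite /eps -exprMn mulrC divfK.
pose c := Kfun N0 N1 F.
have cE : {ae mu, forall t, 0 < t /\ c t = kf F t}%R.
  move: (@halfline_ae R); apply: aeS => t t0; split => //.
  by rewrite /c /Kfun patchT// inE /halfline /= in_itv/= t0.
have c0 : {ae mu, forall t, (0 <= c t)%R}.
  by move: cE; apply: aeS => t [t0 ->]; exact: kf_ge0.
have step k : {ae mu, forall t, (`|v k.+1 t - v k t| <= 2^-1 ^+ k * c t)%R}.
  have [Xf fk _] := fP k.
  have H : {ae mu, forall t, (`|((v k.+1 - v k)%R : V) t| <= 2^-1 ^+ k * c t)%R}.
    move: fk cE; apply: aeS2 => t h1 [t0 ->]; rewrite (le_trans h1)//.
    rewrite exprVn ler_pdivlMl ?exprn_gt0//.
    have -> : (2 ^+ k * kf (f k) t = kf (2 ^+ k *: f k) t)%R.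
      by rewrite kfZ// ?expf_neq0// ger0_norm// exprn_ge0.
    exact: le_kf (hF k) t0.
  by move: H (L0B (v k.+1) (v k)); apply: aeS2 => t + <-.
have [phi phiP] := geometric_limit (measurable_Kfun N0 N1 F) c0 step.
have vphi k : hull (v k - phi)%R <= (2 * 2^-1 ^+ k)%:E * X F.
  have e2 : (0 < 2 * 2^-1 ^+ k :> R)%R by rewrite mulr_gt0// exprn_gt0.
  have XE : X ((2 * 2^-1 ^+ k) *: F)%R = (2 * 2^-1 ^+ k)%:E * X F.
    by rewrite latticeZ// gtr0_norm.
  rewrite -XE; apply: hull_le.
    by rewrite XE lte_mul_pinfty// lee_fin ltW.
  move: (phiP k) (L0B (v k) phi) cE; apply: aeS3 => t h1 -> [t0 h2].
  by rewrite kfZ ?gt_eqF// [`|2 * _|%R]gtr0_norm// -h2.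
have Xf : X F \is a fin_num by rewrite ge0_fin_numE.
exists phi.
  have -> : phi = (v 0%N + - (v 0%N - phi))%R by rewrite opprB addrC subrK.
  apply: le_lt_trans (hC _ _) _.
  rewrite lte_mul_pinfty ?lee_fin//; first by lra.
  rewrite lte_add_pinfty//; first exact: ufin.
  have -> : hull (- (v 0%N - phi))%R = hull (v 0%N - phi)%R.
    by rewrite -scaleN1r hullZ normrN1 mul1e.
  apply: le_lt_trans (vphi 0%N) _.
  by rewrite lte_mul_pinfty// lee_fin.
have small (e : R) : (0 < e)%R -> exists k0, forall k, (k0 <= k)%N ->
    (eps k + 2 * 2^-1 ^+ k * fine (X F) < e)%R.
  move=> e_0.
  have cv : ((eps k + 2 * 2^-1 ^+ k * fine (X F))%R @[k --> \oo] -->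
      (0 + 2 * 0 * fine (X F) : R))%R.
    apply: cvgD; first by apply: cvg_expr; rewrite ger0_norm; lra.
    apply: cvgMl; apply: cvgMr; apply: cvg_expr.
    by rewrite ger0_norm ?invr_ge0// invf_lt1// ltr1n.
  move/cvgrPdist_lt : cv => /(_ e e_0)[k0 _ kP]; exists k0 => k /kP /=.
  rewrite mulr0 mul0r addr0 sub0r normrN ger0_norm//.
  rewrite addr_ge0 ?mulr_ge0 ?fine_ge0 ?exprn_ge0//; lra.
have key (e : R) : (0 < e)%R -> exists n0, forall n, (n0 <= n)%N ->
    hull (u n - phi)%R <= e%:E.
  move=> e_0; have [|k0 kP] := small (e / C)%R; first by rewrite divr_gt0//; lra.
  exists (M k0) => n Mn.
  have -> : (u n - phi = (u n - v k0) + (v k0 - phi))%R by rewrite addrA subrK.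
  apply: le_trans (hC _ _) _.
  rewrite -lee_pdivlMl ?lte_fin//; last by lra.
  rewrite -EFinM; apply: (@le_trans _ _ ((eps k0)%:E + (2 * 2^-1 ^+ k0)%:E * X F)).
    rewrite leeD// ltW//; apply: NP; exact: MN.
  rewrite -(fineK Xf) -EFinM -EFinD lee_fin [leRHS]mulrC.
  exact/ltW/kP.
by apply: cvge_to0 => [n|//]; exact: hull_ge0.
Qed.

Lemma hull_lattice : quasi_banach_lattice hull.
Proof.
split; last by move=> f g _; exact: hull_solid.
split; last exact: hull_complete.
split.
- exact: hull_ge0.
- by move=> phi; split=> [|->]; [exact: hull_eq0|exact: hull0].
- exact: hullZ.
- by have [C C1 hC] := hull_quasi; exists C => //; lra.
Qed.

(** K(., f1) is bounded below by a multiple of min(1, t), and a function of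
quasi-norm m in the intersection is at most m min(1, t). *)
Lemma hull_Delta f1 : X f1 < +oo -> (0 < kf f1 1)%R ->
  continuously_included (Delta Linfty Linfty_inv) hull.
Proof.
move=> Xf1 k1; exists (fine (X f1) / kf f1 1)%R => phi_; move: (phi_ : V) => phi Dphi.
have D0 : 0 <= Delta Linfty Linfty_inv phi by rewrite le_max Lp_ge0.
have Dfin : Delta Linfty Linfty_inv phi \is a fin_num by rewrite ge0_fin_numE.
set m := fine (Delta Linfty Linfty_inv phi).
have mE : Delta Linfty Linfty_inv phi = m%:E by rewrite fineK.
have m0 : (0 <= m)%R by rewrite fine_ge0.
have H1 : {ae mu, forall t, (`|phi t| <= m)%R}.
  by apply/Linf_le; rewrite -mE le_max lexx.
have H2 : {ae mu, forall t, (`|phi t / t| <= m)%R}.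
  by apply/Linfty_inv_le; rewrite -mE le_max lexx orbT.
have H3 : {ae mu, forall t, 0 < t /\ `|phi t| * kf f1 1 <= m * kf f1 t}%R.
  move: H1 H2 (@halfline_ae R); apply: aeS3 => t h1 h2 t0; split => //.
  have kt := kf_ge0 f1 t0.
  have [t1|/ltW t1] := leP 1%R t.
    by apply: ler_pM => //; [exact: ltW|apply: kf_nd => //; rewrite ltr01].
  have kq : (kf f1 1 <= t^-1 * kf f1 t)%R.
    by rewrite -[X in (X * _)%R](mul1r t^-1%R); apply: kf_quasiconcave => //; rewrite t0.
  have -> : (`|phi t| * kf f1 1 = `|phi t / t| * (t * kf f1 1))%R.
    by rewrite normrM normfV (gtr0_norm t0) mulrA divfK// gt_eqF.
  apply: ler_pM => //; first by rewrite mulr_ge0// ltW.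
  by rewrite -ler_pdivlMl.
rewrite mE -[X in X * _](_ : (fine (X f1))%:E * (kf f1 1)^-1%:E = _); last by [].
have XfE : (fine (X f1))%:E = X f1 by rewrite fineK// ge0_fin_numE.
move: m0; rewrite le_eqVlt => /orP[/eqP m0|m0].
  have -> : phi = 0%R.
    apply/L0P; move: H1 (@L00 R); apply: aeS2 => t + ->.
    by rewrite -m0 normr_le0 => /eqP.
  by rewrite hull0 -m0 mule0.
have c0 : (0 < m / kf f1 1)%R by rewrite divr_gt0.
have XE : X ((m / kf f1 1) *: f1)%R = (m / kf f1 1)%:E * X f1.
  by rewrite latticeZ// gtr0_norm.
have -> : (fine (X f1))%:E * (kf f1 1)^-1%:E * m%:E = X ((m / kf f1 1) *: f1)%R.
  by rewrite XE -XfE -!EFinM mulrC mulrA [in RHS]mulrAC.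
apply: hull_le; first by rewrite XE -XfE -EFinM ltry.
move: H3; apply: aeS => t [t0 h].
rewrite kfZ ?gt_eqF// [`|m / _|%R]gtr0_norm//.
by rewrite mulrAC ler_pdivlMr.
Qed.

(** The two pieces are the restrictions to s <= t and to s > t: K(s, f)
increases with s while K(s, f) / s decreases. *)
Lemma dominated_cut phi f t : X f < +oo -> (0 < t)%R ->
  {ae mu, forall s, (`|phi s| <= kf f s)%R} ->
  exists phi1 phi2 : V, [/\ phi = (phi1 + phi2)%R,
    Linfty phi1 <= (kf f t)%:E & Linfty_inv phi2 <= (kf f t / t)%:E].
Proof.
move=> Xf t0 hf.
have mD : measurable (`]-oo, t]%classic : set T) by exact: measurable_itv.
have [phi1 [phi2 [phiE cin cout]]] := cut phi mD.
have hf2 : {ae mu, forall s, (0 < s /\ `|phi s| <= kf f s)%R}.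
  by move: hf (@halfline_ae R); apply: aeS2 => s.
have k0 := kf_ge0 f t0.
exists phi1, phi2; split => //.
  apply/Linf_le; move: cin cout hf2; apply: aeS3 => s c1 c2 [s0 hs].
  have [st|ts] := leP s t.
    have [|-> _] := c1; first by rewrite /= in_itv.
    by rewrite (le_trans hs)// kf_nd// s0.
  have [|-> _] := c2; last by rewrite normr0.
  by rewrite /= in_itv/=; apply/negP; rewrite -ltNge.
apply/Linfty_inv_le; move: cin cout hf2; apply: aeS3 => s c1 c2 [s0 hs].
have [st|ts] := leP s t.
  have [|_ ->] := c1; first by rewrite /= in_itv.
  by rewrite mul0r normr0 divr_ge0// ltW.
have [|_ ->] := c2.
  by rewrite /= in_itv/=; apply/negP; rewrite -ltNge.
rewrite normrM normfV (gtr0_norm s0) ler_pdivrMr// (le_trans hs)//.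
rewrite mulrAC [(_ * s)%R]mulrC mulrAC; apply: kf_quasiconcave => //.
by rewrite t0 ltW.
Qed.

Lemma le_hull_scaled (B : \bar R) (C : R) phi : (0 < C)%R ->
  (forall f : V, X f < +oo -> {ae mu, forall t, (`|phi t| <= kf f t)%R} ->
    B <= C%:E * X f) -> B <= C%:E * hull phi.
Proof.
move=> C0 H; rewrite -lee_pdivrMl//; apply: le_hull => f Xf hf.
by rewrite lee_pdivrMl//; exact: H.
Qed.

Lemma hull_Sigma : continuously_included hull (Sigma Linfty Linfty_inv).
Proof.
have [C C1 kC] := kf_bound; exists (2 * C)%R => phi_ _; move: (phi_ : V) => phi.
apply: le_hull_scaled => [|f Xf hf]; first by lra.
have [phi1 [phi2 [-> h1 h2]]] := dominated_cut Xf ltr01 hf.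
apply: (@le_trans _ _ (Linfty phi1 + Linfty_inv phi2)).
  apply: ereal_inf_lbound; exists phi1, phi2; split => //.
    exact: le_lt_trans h1 (ltry _).
  exact: le_lt_trans h2 (ltry _).
apply: le_trans (leeD h1 h2) _.
have := kC f 1%R Xf ltr01; rewrite maxxx mul1r divr1 => k1.
rewrite -[in leRHS](@fineK _ (X f)) ?ge0_fin_numE// -EFinM -EFinD lee_fin; lra.
Qed.

(** Cutting [phi] at t gives |S phi (s)| <= M K(t, f) (1 + s / t) for almost
every s, for each t. Applying this to all rational t at once, almost every s
has a t between s / 2 and s at its disposal, where the bound is at most 3 M
K(s, f). *)
Lemma hull_bounded (S : V -> V) : linear_on_Sigma Linfty Linfty_inv S ->
  bounded_on S Linfty -> bounded_on S Linfty_inv -> bounded_on S hull.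
Proof.
move=> [_ Slin] [M0 SM0] [M1 SM1].
pose M := Num.max (Num.max M0 M1) 1%R.
have M00 : (M0 <= M)%R by rewrite /M !le_max lexx.
have M11 : (M1 <= M)%R by rewrite /M !le_max lexx orbT.
have M1' : (1 <= M)%R by rewrite /M le_max lexx orbT.
exists (3 * M)%R => phi_ _; move: (phi_ : V) => phi; apply: le_hull_scaled => [|f Xf hf]; first by lra.
have Linfty00 : Linfty (0%R : V) = 0 by exact: Lp0.
have Linfty_inv00 : Linfty_inv (0%R : V) = 0.
  apply/eqP; rewrite eq_le Linfty_inv_ge0 andbT; apply/Linfty_inv_le.
  by move: (@L00 R); apply: aeS => x ->; rewrite mul0r normr0.
have scale t : (0 < t)%R -> {ae mu, forall s, (0 < s)%R ->
    (`|S phi s| <= M * kf f t * (1 + s / t))%R}.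
  move=> t0; have [phi1 [phi2 [phiE h1 h2]]] := dominated_cut Xf t0 hf.
  have S1 : Linfty (S phi1) <= (M * kf f t)%:E.
    apply: (le_trans (SM0 _ (le_lt_trans h1 (ltry _)))).
    apply: (@le_trans _ _ (M%:E * Linfty phi1)).
      by rewrite lee_wpmul2r ?Lp_ge0.
    by rewrite EFinM lee_pmul2l ?lte_fin//; lra.
  have S2 : Linfty_inv (S phi2) <= (M * (kf f t / t))%:E.
    apply: (le_trans (SM1 _ (le_lt_trans h2 (ltry _)))).
    apply: (@le_trans _ _ (M%:E * Linfty_inv phi2)).
      by rewrite lee_wpmul2r ?Linfty_inv_ge0.
    by rewrite EFinM lee_pmul2l ?lte_fin//; lra.
  have SE : S phi = (S phi1 + S phi2)%R.
    rewrite phiE -[X in S (X + _)%R]scale1r Slin ?scale1r//; apply/Sigma_ltP.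
      exists phi1, 0%R; rewrite addr0 Linfty_inv00; split => //.
      exact: le_lt_trans h1 (ltry _).
    exists 0%R, phi2; rewrite add0r Linfty00; split => //.
    exact: le_lt_trans h2 (ltry _).
  rewrite SE; move/Linf_le : S1 => S1; move/Linfty_inv_le : S2 => S2.
  move: S1 S2 (L0D (S phi1) (S phi2)); apply: aeS3 => s a1 a2 -> s0.
  rewrite (le_trans (ler_normD _ _))// mulrDr mulr1 lerD//.
  move: a2; rewrite normrM normfV (gtr0_norm s0) ler_pdivrMr// => /le_trans; apply.
  by rewrite -!mulrA [(t^-1 * s)%R]mulrC.
have rats n : {ae mu, forall s, forall t : rat, unpickle n = Some t ->
    (0 < (ratr t : R))%R -> (0 < s)%R ->
    (`|S phi s| <= M * kf f (ratr t) * (1 + s / ratr t))%R}.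
  case: (unpickle n : option rat) => [t|]; last by apply: aeW.
  have [t0|t0] := ltP (0 : R)%R (ratr t).
    by move: (scale _ t0); apply: aeS => s h _ [<-].
  by apply: aeW => s _ [<-]; rewrite ltNge t0.
have XE : X ((3 * M) *: f)%R = (3 * M)%:E * X f.
  by rewrite latticeZ// gtr0_norm//; lra.
rewrite -XE; apply: hull_le.
  by rewrite XE lte_mul_pinfty ?lee_fin//; lra.
have /ae_foralln rats' := rats.
move: rats' (@halfline_ae R); apply: aeS2 => s rs s0.
have M3 : (0 < 3 * M)%R by lra.
rewrite kfZ ?gt_eqF// [`|3 * M|%R]gtr0_norm//.
have [t] := @rat_in_itvoo R (s / 2) s ltac:(lra).
rewrite in_itv/= => /andP[st ts].
have t0 : (0 < (ratr t : R))%R by lra.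
have := rs (pickle t) t (pickleK t) t0 s0.
move/le_trans; apply.
have kst : (kf f (ratr t) <= kf f s)%R by rewrite kf_nd// t0 ltW.
have s3 : (1 + s / ratr t <= 3)%R.
  rewrite -lerBrDl ler_pdivrMr//; lra.
rewrite [leRHS](_ : _ = M * kf f s * 3)%R; last by lra.
apply: ler_pM => //.
- by rewrite mulr_ge0 ?kf_ge0//; lra.
- by rewrite addr_ge0// divr_ge0// ltW.
- by rewrite ler_pM2l//; lra.
Qed.

(** If K(., x) <= K(., f) almost everywhere, then K(t, x) <= 2 K(t, f) for
every t, by comparison with a point s between t / 2 and t; thus x is
K-dominated by 2 f. *)
Lemma hull_equivalent (C : R) : (0 < C)%R ->
  (forall f g, X f < +oo -> (forall t, (0 < t)%R -> K t g <= K t f) ->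
    X g <= C%:E * X f) ->
  equivalent_qnorms X (Kspace N0 N1 hull).
Proof.
move=> C0 mono.
have KfunE x : Sig x < +oo -> {ae mu, forall t, 0 < t /\
    class0 mu (Kfun N0 N1 x) t = kf x t}%R.
  move=> sx; have := @repr0K _ _ R mu (Kfun N0 N1 x).
  move: (@halfline_ae R) => H1 H2.
  move: H1 H2; apply: aeS2 => t t0 /= /(_ I) e; split => //.
  rewrite [LHS]e /Kfun patchT// inE /halfline /= in_itv/= t0//.
exists (Num.max (C * 2) 1)%R; first by rewrite lt_max ltr01 orbT.
move=> x; rewrite /Kspace; case: ifPn => sx; last first.
  have Xx : X x = +oo.
    apply/eqP; rewrite -leye_eq leNgt; apply: contra sx; exact: lty_Sigma.
  by rewrite Xx gt0_muley ?lte_fin ?lt_max ?ltr01 ?orbT// !leey.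
split; last first.
  have [Xx|] := ltP (X x) +oo; last first.
    by rewrite leye_eq => /eqP ->; rewrite gt0_muley ?leey// lte_fin lt_max ltr01 orbT.
  apply: (@le_trans _ _ (X x)).
    apply: hull_le => //; move: (KfunE x sx); apply: aeS => t [t0 ->].
    by rewrite ger0_norm// kf_ge0.
  by rewrite lee_pemull// lee_fin le_max lexx orbT.
apply: (@le_trans _ _ ((C * 2)%:E * hull (class0 mu (Kfun N0 N1 x)))); last first.
  by rewrite lee_wpmul2r ?hull_ge0// lee_fin le_max lexx.
apply: le_hull_scaled => [|f Xf hf]; first by rewrite mulr_gt0.
have XE : X (2 *: f)%R = 2%:E * X f by rewrite latticeZ// gtr0_norm.
rewrite EFinM -muleA -XE; apply: mono.
  by rewrite XE lte_mul_pinfty ?lee_fin.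
move=> t t0; have sf := lty_Sigma Xf.
have H : {ae mu, forall s, (0 < s -> kf x s <= kf f s)%R}.
  move: hf (KfunE x sx); apply: aeS2 => s + [s0 e] _.
  by rewrite e ger0_norm// kf_ge0.
have [|s /andP[ts st] hs] := halfline_hits _ H (a := t / 2) (b := t); first lra.
have s0 : (0 < s)%R by lra.
have -> : K t (2 *: f)%R = 2%:E * K t f.
  by rewrite KZ//; [rewrite gtr0_norm|exact: ltW].
apply: (@le_trans _ _ ((t / s)%:E * K s x)).
  by apply: K_quasiconcave => //; rewrite s0 ltW.
apply: (@le_trans _ _ (2%:E * K s x)).
  apply: lee_wpmul2r; first by apply: K_ge0 => //; exact: ltW.
  by rewrite lee_fin ler_pdivrMr//; lra.
rewrite lee_pmul2l//; apply: (@le_trans _ _ (K s f)); last first.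
  by apply: le_K => //; rewrite !ltW.
rewrite -(K_fineK N0_ge0 N1_ge0 (ltW s0) sx) -(kfE Xf s0) lee_fin.
exact: hs.
Qed.

End hull.

(** * Operators built from the comparison of levels *)

Section levels.
Context {R : realType}.
Local Open Scope ereal_scope.
Local Notation T := (measurableTypeR R).
Local Notation mu := (halfline_measure R).
Local Notation V := (L0h R).
Implicit Types f g : V.

(** Levels are logarithmic: [level f x] is the n with e^n <= |f x| < e^(n+1).
*)
Definition level f (x : T) : int := Num.floor (ln `|f x|).

Lemma level_measurable_fun f : measurable_fun setT (fun x => (level f x)%:~R : R).
Proof.
apply: (measurableT_comp (@floor_measurable R)).
apply: (measurableT_comp (@measurable_ln R)).
exact: (measurableT_comp (@normr_measurable R setT) (measurable_L0 f)).
Qed.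

Lemma opp_level_measurable_fun f :
  measurable_fun setT (fun x => (- level f x)%:~R : R).
Proof.
apply: eq_measurable_fun (measurable_funN (level_measurable_fun f)) => x _.
by rewrite /= mulrNz.
Qed.

Lemma le_level f x (n : int) : f x <> 0%R ->
  (n <= level f x)%R = (expR n%:~R <= `|f x|)%R.
Proof.
move=> /eqP fx; have f0 : (0 < `|f x|)%R by rewrite normr_gt0.
have e : expR (ln `|f x|%R) = `|f x|%R by rewrite lnK.
by rewrite /level floor_ge_int -[in RHS]e ler_expR.
Qed.

Lemma level_lt f x (n : int) : f x <> 0%R ->
  (level f x < n)%R = (`|f x| < expR n%:~R)%R.
Proof. by move=> fx; rewrite !ltNge le_level. Qed.

Lemma int_set_measurable (l : T -> int) (D : set int) :
  measurable_fun setT (fun x => (l x)%:~R : R) ->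
  measurable [set x | D (l x)].
Proof.
move=> ml.
rewrite (_ : mkset _ = (fun x => (l x)%:~R : R) @^-1` ((fun n : int => n%:~R) @` D)).
  apply: preimage_measurable => //; apply: countable_measurable => //.
  exact: (sub_countable (card_image_le _ _) (countableP D)).
apply/seteqP; split => [x Dx|x [n Dn /= nl]]; first by exists (l x).
by move/intr_inj : nl => <-.
Qed.

Lemma powRV (x r : R) : (0 <= x)%R -> (x^-1 `^ r = (x `^ r)^-1)%R.
Proof. by move=> x0; rewrite -powR_inv1// -powRrM mulN1r powRN. Qed.

Lemma inv_measurable (h : T -> R) : measurable_fun setT h ->
  measurable_fun setT (fun x => (h x)^-1)%R.
Proof.
move=> mh.
have -> : (fun x => (h x)^-1)%R = (fun x => h x * `|h x| `^ (-2))%R.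
  apply/funext => x; have [->|hx] := eqVneq (h x) 0%R; first by rewrite invr0 mul0r.
  rewrite powRN powR_mulrn// real_normK ?num_real// expr2 invfM mulrA mulfV//.
  by rewrite mul1r.
by apply: measurable_funM => //; exact: pow_measurable.
Qed.

(** Truncating the left-hand density to the levels of [J] makes the comparison
true at every level n: the mass that remains up to n lies up to the largest
level of [J] that is at most n, where the comparison is assumed. *)
Lemma restrict_levels (a b : T -> R) (l k : T -> int) (d : int) (J : set int) :
  (forall x, (0 <= a x)%R) -> (forall x, (0 <= b x)%R) ->
  measurable_fun setT a -> measurable_fun setT b ->
  measurable_fun setT (fun x => (l x)%:~R : R) ->
  measurable_fun setT (fun x => (k x)%:~R : R) ->
  measurable [set x | J (l x)] ->
  (forall n, J n -> \int[mu]_(x in [set x | (l x <= n)%R]) (a x)%:E <=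
     \int[mu]_(x in [set x | (k x <= n + d)%R]) (b x)%:E) ->
  forall n, \int[mu]_(x in [set x | (l x <= n)%R])
      (a x * \1_[set x | J (l x)] x)%:E <=
     \int[mu]_(x in [set x | (k x <= n + d)%R]) (b x)%:E.
Proof.
move=> a0 b0 ma mb ml mk mJ H n.
have [nex|] := pselect (forall m, (m <= n)%R -> ~ J m).
  rewrite integral0_eq; first by apply: integral_ge0 => x _; rewrite lee_fin.
  move=> x /= ln; rewrite indicE memNset ?mulr0//=; exact: nex.
move=> /existsNP[m /not_implyP[mn /contrapT Jm]].
(* the largest level n - j of J that is at most n *)
have exj : exists j : nat, `[< J (n - j%:Z)%R >].
  exists `|n - m|%N; apply/asboolP; rewrite gez0_abs ?subr_ge0//.
  by rewrite subKr.
have [j /asboolP Jj jmin] := ex_minnP exj.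
apply: (@le_trans _ _ (\int[mu]_(x in [set x | (l x <= n - j%:Z)%R]) (a x)%:E)).
  rewrite integral_mkcond [leRHS]integral_mkcond.
  apply: ge0_le_integral => //.
  - by move=> x _; apply: erestrict_ge0 => y _; rewrite lee_fin mulr_ge0.
  - apply: (iffLR (measurable_restrictT _ (level_measurable _ ml))).
    by apply/measurable_EFinP; apply: measurable_funTS; apply: measurable_funM.
  - apply: (iffLR (measurable_restrictT _ (level_measurable _ ml))).
    by apply/measurable_EFinP; exact: measurable_funTS.
  - move=> x _; rewrite !patchE.
    case: ifPn => ln; last first.
      by case: ifPn => //; rewrite lee_fin.
    have [Jx|nJ] := pselect (J (l x)); last first.
      rewrite indicE memNset//= mulr0.
      by case: ifPn => //; rewrite lee_fin.
    rewrite indicE (@mem_set _ [set x | J (l x)] x Jx) mulr1 ifT// inE /=.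
    move: ln; rewrite inE /= => ln.
    rewrite lerBrDl -lerBrDr -(ler_int R).
    have : (j <= `|n - l x|)%N.
      apply: jmin; apply/asboolP; rewrite gez0_abs ?subr_ge0//.
      by rewrite subKr.
    by rewrite -lez_nat gez0_abs ?subr_ge0// ler_int.
apply: le_trans (H _ Jj) _.
apply: ge0_subset_integral.
- exact: level_measurable.
- exact: level_measurable.
- by apply/measurable_EFinP; exact: measurable_funTS.
- by move=> x _; rewrite lee_fin.
- by move=> x /=; lia.
Qed.

Section operator.
Variables (f g : V) (r C : R) (A B : set T) (l k : T -> int) (d : int).
Hypotheses (r0 : (0 < r)%R) (C0 : (0 < C)%R).
Hypotheses (mA : measurable A) (mB : measurable B).
Hypotheses (ml : measurable_fun setT (fun x => (l x)%:~R : R))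
           (mk : measurable_fun setT (fun x => (k x)%:~R : R)).

Let a x := (`|g x| `^ r * \1_B x)%R.
Let b x := (C * `|f x| `^ r * \1_A x)%R.

Hypothesis bfin : forall n : int,
  \int[mu]_(x in [set x | (k x <= n)%R]) (b x)%:E < +oo.
Hypothesis ab : forall n : int,
  \int[mu]_(x in [set x | (l x <= n)%R]) (a x)%:E <=
  \int[mu]_(x in [set x | (k x <= n + d)%R]) (b x)%:E.

(** The weighted composition operator with weight g / (f o sigma) on B, where
sigma is the transport of |g|^r on B into C |f|^r on A given by
[level_transport]. On L^r the weight is exactly what the transport allows; on the other spaces one
compares the s-th power of the weight with its r-th power, using only that
[sigma] controls levels. Sign changes of the levels [l] and [k] exchange lower
and upper tails. *)
Lemma level_operator : exists S : V -> V, [/\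
  forall (c : R) u v, S (c *: u + v)%R = (c *: S u + S v)%R,
  {ae mu, forall x, B x -> S f x = g x},
  forall (s M : R), (0 < s)%R -> (0 <= M)%R ->
    (forall x y, g x <> 0%R -> f y <> 0%R -> (k y <= l x + d + 1)%R ->
       (`|g x / f y| `^ s <= M * `|g x / f y| `^ r)%R) ->
    bounded_on S (Lp s%:E)
  & forall M : R, (0 <= M)%R ->
    (forall x y, g x <> 0%R -> f y <> 0%R -> (k y <= l x + d + 1)%R ->
       (`|g x / f y| <= M)%R) ->
    bounded_on S (Lp +oo)].
Proof.
have mf := measurable_L0 f; have mg := measurable_L0 g.
have a0 x : (0 <= a x)%R by rewrite mulr_ge0// powR_ge0.
have b0 x : (0 <= b x)%R by rewrite mulr_ge0// mulr_ge0 ?powR_ge0// ltW.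
have ma : measurable_fun setT a.
  by apply: measurable_funM; [exact: pow_measurable|exact: measurable_indic].
have mb : measurable_fun setT b.
  apply: measurable_funM; last exact: measurable_indic.
  by apply: measurable_funM => //; exact: pow_measurable.
have [sigma [ms sab sae]] := level_transport a0 b0 ma mb ml mk bfin ab.
pose w x := (\1_B x * (g x / f (sigma x)))%R.
have mw : measurable_fun setT w.
  apply: measurable_funM; first exact: measurable_indic.
  apply: measurable_funM => //; apply: inv_measurable.
  exact: (measurableT_comp mf ms).
have wP x : w x <> 0%R -> [/\ B x, g x <> 0%R, (0 < a x)%R & w x = (g x / f (sigma x))%R].
  rewrite /w /a indicE; case: (pselect (B x)) => [Bx|nB]; last first.
    by rewrite memNset// mul0r.
  rewrite mem_set// mul1r mulr1 => w0; have g0 : g x <> 0%R.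
    by move=> g0; apply: w0; rewrite g0 mul0r.
  by split => //; rewrite powR_gt0// normr_gt0; exact/eqP.
have aP x : B x -> g x <> 0%R -> (0 < a x)%R.
  by move=> Bx /eqP gx; rewrite /a indicE mem_set// mulr1 powR_gt0// normr_gt0.
have bP y : (0 < b y)%R -> A y /\ f y <> 0%R.
  rewrite /b indicE; case: (pselect (A y)) => [Ay|nA]; last first.
    by rewrite memNset// mulr0 ltxx.
  rewrite mem_set// mulr1 => by0; split => // f0; move: by0.
  by rewrite f0 normr0 powR0 ?mulr0 ?ltxx// gt_eqF.
have wab : {ae mu, forall x, w x <> 0%R -> (0 < a x)%R /\ (0 < b (sigma x))%R}.
  by move: sae; apply: aeS => x H /wP[_ _ ax _]; have [] := H ax.
exists (wcomp mw ms); split.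
- by move=> c u v; exact: (wcomp_linear a0 ma mb mw ms sab wab).
- move: sae (wcompE mw ms f); apply: aeS2 => x H -> Bx.
  have [g0|/eqP g0] := eqVneq (g x) 0%R; first by rewrite /w g0 mul0r mulr0 mul0r.
  have [/bP[_ f0] _] := H (aP _ Bx g0).
  by rewrite /w indicE mem_set// mul1r divfK//; exact/eqP.
- move=> s M s0 M0 HM.
  apply: (wcomp_bounded a0 b0 ma mb mw ms sab s0 (C := (M * C)%R)).
    by rewrite mulr_ge0// ltW.
  move: sae; apply: aeS => x H w0; have [Bx gx ax ->] := wP _ w0.
  have [bx kl] := H ax; have [Ax fx] := bP _ bx.
  apply: le_trans (HM _ _ gx fx kl) _.
  rewrite -mulrA ler_wpM2l// /a /b !indicE !mem_set// !mulr1.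
  rewrite normrM normfV powRM// powRV//.
  have F0 : (`|f (sigma x)| `^ r != 0)%R.
    by rewrite powR_eq0 negb_and normr_eq0; apply/orP; left; apply/eqP.
  by rewrite le_eqVlt; apply/orP; left; apply/eqP; field; rewrite F0 gt_eqF.
- move=> M M0 HM; apply: (wcomp_bounded_inf a0 ma mb mw ms sab wab M0).
  move: sae; apply: aeS => x H; have [->|/eqP w0] := eqVneq (w x) 0%R.
    by rewrite normr0.
  have [Bx gx ax ->] := wP _ w0.
  have [bx kl] := H ax; have [Ax fx] := bP _ bx.
  exact: HM.
Qed.

End operator.
End levels.

(** * Domination of tails, both exponents finite *)

Section level_tails.
Context {R : realType}.
Local Open Scope ereal_scope.
Local Notation T := (measurableTypeR R).
Local Notation mu := (halfline_measure R).
Local Notation V := (L0h R).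
Implicit Types (f g h : V) (n : int).

Definition upper (r : R) h n :=
  \int[mu]_(x in [set x | (- level h x <= - n)%R]) (`|h x| `^ r)%:E.
Definition lower (r : R) h n :=
  \int[mu]_(x in [set x | (level h x <= n)%R]) (`|h x| `^ r)%:E.

Lemma upper_measurable h n : measurable [set x | (- level h x <= - n)%R].
Proof. exact: level_measurable (opp_level_measurable_fun h). Qed.

Lemma lower_measurable h n : measurable [set x | (level h x <= n)%R].
Proof. exact: level_measurable (level_measurable_fun h). Qed.

Lemma upper_ge0 r h n : 0 <= upper r h n.
Proof. by apply: integral_ge0 => x _; rewrite lee_fin powR_ge0. Qed.

Lemma lower_ge0 r h n : 0 <= lower r h n.
Proof. by apply: integral_ge0 => x _; rewrite lee_fin powR_ge0. Qed.

Lemma level_ratio_le f g (m : int) x y : g x <> 0%R -> f y <> 0%R ->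
  (level g x <= level f y + m)%R -> (`|g x / f y| <= expR (m + 1)%:~R)%R.
Proof.
move=> gx fy lgf.
have g1 : (`|g x| <= expR (level g x + 1)%:~R)%R.
  by apply: ltW; rewrite -level_lt//; lia.
have f1 : (expR (level f y)%:~R <= `|f y|)%R by rewrite -le_level.
have f0 : (0 < `|f y|)%R by rewrite normr_gt0; exact/eqP.
rewrite normrM normfV ler_pdivrMr// (le_trans g1)//.
apply: (@le_trans _ _ (expR (m + 1)%:~R * expR (level f y)%:~R)%R).
  by rewrite -expRD ler_expR -intrD ler_int; lia.
by rewrite ler_pM2l// expR_gt0.
Qed.

Lemma level_ratio_ge f g (m : int) x y : g x <> 0%R -> f y <> 0%R ->
  (level f y <= level g x + m)%R -> (expR (- (m + 1))%:~R <= `|g x / f y|)%R.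
Proof.
move=> gx fy lgf; have := level_ratio_le fy gx lgf.
rewrite mulrNz expRN -[in X in _ -> X](invrK (g x / f y)%R) normfV invf_div => H.
rewrite lef_pV2// posrE ?expR_gt0// normr_gt0.
by rewrite mulf_neq0 ?invr_eq0//; exact/eqP.
Qed.

Section two_exponents.
Variables p q : R.
Hypotheses (p0 : (0 < p)%R) (pq : (p < q)%R).

Let q0 : (0 < q)%R. Proof. exact: lt_trans p0 pq. Qed.

(** The scalar making |y|^p and its multiple of |y|^q agree at |y| = e^n;
cutting at this level is then nearly optimal for the sum of the two integrals.
*)
Definition scale_weight n : R := expR (n%:~R * (p - q)).

Lemma scale_weight_gt0 n : (0 < scale_weight n)%R. Proof. exact: expR_gt0. Qed.

Lemma split_pow (r y u v : R) : (0 < r)%R -> (0 <= y)%R -> (0 <= u)%R ->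
  (0 <= v)%R -> (y <= u + v)%R ->
  (u <= v)%R -> (y `^ r <= 2 `^ r * v `^ r)%R.
Proof.
move=> r0 y0 u0 v0 yuv uv; rewrite -powRM// ge0_ler_powR ?nnegrE ?mulr_ge0//; lra.
Qed.

(** Either u or v is at least y / 2; in the second case y >= e^n allows y^p to
be replaced by the weighted y^q. *)
Lemma upper_pow n (y u v : R) : (0 <= u)%R -> (0 <= v)%R ->
  (expR n%:~R <= y)%R -> (y <= u + v)%R ->
  (y `^ p <= 2 `^ p * u `^ p + scale_weight n * (2 `^ q * v `^ q))%R.
Proof.
move=> u0 v0 cy yuv; have y0 : (0 < y)%R := lt_le_trans (expR_gt0 _) cy.
have W := scale_weight_gt0 n.
have [uv|/ltW vu] := leP u v; last first.
  have := split_pow p0 (ltW y0) v0 u0; rewrite addrC => /(_ yuv vu) H.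
  by rewrite (le_trans H)// lerDl (mulr_ge0 (ltW W))// mulr_ge0 ?powR_ge0.
apply: (@le_trans _ _ (scale_weight n * y `^ q)%R); last first.
  apply: (@le_trans _ _ (scale_weight n * (2 `^ q * v `^ q))%R).
    by rewrite ler_pM2l//; exact: (split_pow q0 (ltW y0) u0 v0 yuv uv).
  by rewrite lerDr mulr_ge0 ?powR_ge0.
rewrite /powR gt_eqF// /scale_weight -expRD ler_expR.
have ny : (n%:~R <= ln y)%R by rewrite -[n%:~R]expRK ler_ln ?posrE ?expR_gt0.
rewrite -subr_ge0; have -> : (n%:~R * (p - q) + q * ln y - p * ln y =
  (q - p) * (ln y - n%:~R))%R by ring.
by rewrite mulr_ge0// subr_ge0// ltW.
Qed.

(** As in [upper_pow]; the factor accounts for y being as large as e^(n+1). *)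
Lemma lower_pow n (y u v : R) : (0 <= u)%R -> (0 <= v)%R ->
  (0 < y)%R -> (y <= expR (n + 1)%:~R)%R -> (y <= u + v)%R ->
  (scale_weight n * y `^ q <= expR (q - p) *
     (2 `^ p * u `^ p + scale_weight n * (2 `^ q * v `^ q)))%R.
Proof.
move=> u0 v0 y0 yc yuv.
have W := scale_weight_gt0 n.
have E1 : (1 <= expR (q - p))%R by rewrite -expR0 ler_expR subr_ge0 ltW.
have [uv|/ltW vu] := leP u v.
  apply: (@le_trans _ _ (1 * (scale_weight n * (2 `^ q * v `^ q)))%R).
    by rewrite mul1r ler_pM2l//; exact: (split_pow q0 (ltW y0) u0 v0 yuv uv).
  apply: ler_pM => //; first by rewrite (mulr_ge0 (ltW W))// mulr_ge0 ?powR_ge0.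
  by rewrite lerDr mulr_ge0 ?powR_ge0.
apply: (@le_trans _ _ (expR (q - p) * y `^ p)%R).
  rewrite /powR gt_eqF// /scale_weight -!expRD ler_expR.
  have ny : (ln y <= n%:~R + 1)%R.
    by rewrite -(intrD R n 1) -[leRHS]expRK ler_ln ?posrE ?expR_gt0.
  rewrite -subr_ge0; have -> : (q - p + p * ln y - (n%:~R * (p - q) + q * ln y) =
    (q - p) * (n%:~R + 1 - ln y))%R by ring.
  by rewrite mulr_ge0// subr_ge0// ltW.
rewrite ler_pM2l ?expR_gt0//.
have := split_pow p0 (ltW y0) v0 u0; rewrite addrC => /(_ yuv vu) H.
by rewrite (le_trans H)// lerDl (mulr_ge0 (ltW W))// mulr_ge0 ?powR_ge0.
Qed.

(** The K-functional, at the scale of the level n, of the couple of the powers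
of the two quasi-norms, up to the factors 2^p and 2^q, evaluated at a given
decomposition; a decomposition of h makes it a bound for both tails of h. *)
Definition mixed n (h0 h1 : V) := (2 `^ p)%:E * pint p h0 +
  (scale_weight n)%:E * ((2 `^ q)%:E * pint q h1).

Lemma mixedE n h0 h1 : mixed n h0 h1 = \int[mu]_x (2 `^ p * `|h0 x| `^ p +
  scale_weight n * (2 `^ q * `|h1 x| `^ q))%:E.
Proof.
have W := scale_weight_gt0 n.
under eq_integral do rewrite EFinD !EFinM.
have m0 : measurable_fun setT (fun x => (`|h0 x| `^ p)%:E) by exact: epow_measurable.
have m1 : measurable_fun setT (fun x => (`|h1 x| `^ q)%:E) by exact: epow_measurable.
have n0 x : 0 <= (`|h0 x| `^ p)%:E by rewrite lee_fin powR_ge0.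
have n1 x : 0 <= (`|h1 x| `^ q)%:E by rewrite lee_fin powR_ge0.
have t0 (t r : R) : 0 <= (t `^ r)%:E by rewrite lee_fin powR_ge0.
have W0 : 0 <= (scale_weight n)%:E by rewrite lee_fin ltW.
have mq : measurable_fun setT (fun x => (2 `^ q)%:E * (`|h1 x| `^ q)%:E).
  exact: emeasurable_funM.
rewrite ge0_integralD; [|exact: measurableT|
  by move=> x _; rewrite mule_ge0|exact: emeasurable_funM|
  by move=> x _; rewrite !mule_ge0|exact: emeasurable_funM].
rewrite ge0_integralZl; [|exact: measurableT|by []|by move=> x _|by []].
rewrite ge0_integralZl; [|exact: measurableT|by []|
  by move=> x _; rewrite mule_ge0|by []].
by rewrite ge0_integralZl; [|exact: measurableT|by []|by move=> x _|by []].
Qed.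

Lemma upper_le_mixed n h h0 h1 :
  {ae mu, forall x, (`|h x| <= `|h0 x| + `|h1 x|)%R} ->
  upper p h n <= mixed n h0 h1.
Proof.
move=> hh; rewrite mixedE /upper integral_mkcond.
have mp (u : V) (r : R) := @pow_measurable R r u (measurable_L0 u).
apply: ae_ge0_le_integral.
- exact: measurableT.
- by move=> x _; apply: erestrict_ge0 => y _; rewrite lee_fin powR_ge0.
- apply: (iffLR (measurable_restrictT _ (upper_measurable h n))).
  by apply: measurable_funTS; exact: epow_measurable.
- move=> x _; rewrite lee_fin addr_ge0// ?mulr_ge0 ?powR_ge0//.
  exact: ltW (scale_weight_gt0 n).
- apply/measurable_EFinP; apply: measurable_funD; apply: measurable_funM => //.
  exact: measurable_funM.
move: hh; apply: aeS => x hx _; rewrite patchE.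
have R0 : (0 <= 2 `^ p * `|h0 x| `^ p +
    scale_weight n * (2 `^ q * `|h1 x| `^ q))%R.
  by rewrite addr_ge0// ?mulr_ge0 ?powR_ge0//; exact: ltW (scale_weight_gt0 n).
case: ifPn => [|_]; last by rewrite lee_fin.
rewrite inE /= lerN2 => nh; rewrite lee_fin.
have [h0x|/eqP h0x] := eqVneq (h x) 0%R.
  by rewrite h0x normr0 powR0 ?gt_eqF.
by apply: upper_pow => //; rewrite -le_level.
Qed.

Lemma lower_le_mixed n h h0 h1 :
  {ae mu, forall x, (`|h x| <= `|h0 x| + `|h1 x|)%R} ->
  (scale_weight n)%:E * lower q h n <= (expR (q - p))%:E * mixed n h0 h1.
Proof.
move=> hh; have W := scale_weight_gt0 n.
have E0 := expR_gt0 (q - p).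
have mp (u : V) (r : R) := @pow_measurable R r u (measurable_L0 u).
have mm : measurable_fun setT (fun x => 2 `^ p * `|h0 x| `^ p +
    scale_weight n * (2 `^ q * `|h1 x| `^ q))%R.
  apply: measurable_funD; apply: measurable_funM => //.
  exact: measurable_funM.
have R0 x : (0 <= 2 `^ p * `|h0 x| `^ p +
    scale_weight n * (2 `^ q * `|h1 x| `^ q))%R.
  by rewrite addr_ge0// ?mulr_ge0 ?powR_ge0//; exact: ltW (scale_weight_gt0 n).
rewrite mixedE -[leRHS]ge0_integralZl; [|exact: measurableT|exact/measurable_EFinP|
  by move=> x _; rewrite lee_fin|by rewrite lee_fin ltW].
rewrite /lower -[leLHS]ge0_integralZl; [|exact: lower_measurable|exact: epow_measurable|
  by move=> x _; rewrite lee_fin powR_ge0|by rewrite lee_fin ltW].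
rewrite integral_mkcond; apply: ae_ge0_le_integral.
- exact: measurableT.
- by move=> x _; apply: erestrict_ge0 => y _; rewrite mule_ge0 ?lee_fin ?powR_ge0// ltW.
- apply: (iffLR (measurable_restrictT _ (lower_measurable h n))).
  by apply: measurable_funTS; apply: emeasurable_funM => //; exact: epow_measurable.
- by move=> x _; rewrite -EFinM lee_fin mulr_ge0// ltW.
- by apply: emeasurable_funM => //; exact/measurable_EFinP.
move: hh; apply: aeS => x hx _; rewrite patchE.
case: ifPn => [|_]; last by rewrite -EFinM lee_fin mulr_ge0// ltW.
rewrite inE /= => nh; rewrite -!EFinM lee_fin.
have [h0x|/eqP h0x] := eqVneq (h x) 0%R.
  by rewrite h0x normr0 powR0 ?gt_eqF// mulr0 mulr_ge0// ltW.
apply: lower_pow => //; first by rewrite normr_gt0; exact/eqP.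
by rewrite ltW// -level_lt//; lia.
Qed.

Lemma pint_cut f n f0 f1 :
  {ae mu, forall x, [set x | (- level f x <= - n)%R] x -> f0 x = f x /\ f1 x = 0%R} ->
  {ae mu, forall x, ~ [set x | (- level f x <= - n)%R] x -> f0 x = 0%R /\ f1 x = f x} ->
  pint p f0 <= upper p f n /\ pint q f1 <= lower q f n.
Proof.
move=> cin cout; split; rewrite /pint /upper /lower [leRHS]integral_mkcond.
  apply: ae_ge0_le_integral.
  - exact: measurableT.
  - by move=> x _; rewrite lee_fin powR_ge0.
  - exact: epow_measurable.
  - by move=> x _; apply: erestrict_ge0 => y _; rewrite lee_fin powR_ge0.
  - apply: (iffLR (measurable_restrictT _ (upper_measurable f n))).
    by apply: measurable_funTS; exact: epow_measurable.
  move: cin cout; apply: aeS2 => x /= c1 c2 _; rewrite patchE.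
  case: ifPn; rewrite !(inE, notin_setE) /= => nx; first by have [-> _] := c1 nx.
  by have [-> _] := c2 nx; rewrite normr0 powR0 ?gt_eqF.
apply: ae_ge0_le_integral.
- exact: measurableT.
- by move=> x _; rewrite lee_fin powR_ge0.
- exact: epow_measurable.
- by move=> x _; apply: erestrict_ge0 => y _; rewrite lee_fin powR_ge0.
- apply: (iffLR (measurable_restrictT _ (lower_measurable f n))).
  by apply: measurable_funTS; exact: epow_measurable.
move: cin cout; apply: aeS2 => x /= c1 c2 _; rewrite patchE.
have [nx|nx] := boolP (- level f x <= - n)%R.
  have [_ ->] := c1 nx; rewrite normr0 powR0 ?gt_eqF//.
  by case: ifPn => //; rewrite lee_fin powR_ge0.
have [_ ->] := c2 (negP nx); rewrite ifT// inE /=; move: nx; lia.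
Qed.

Lemma eps_le (I : \bar R) (C x : R) : (0 < C)%R ->
  (forall e, (0 < e)%R -> I <= (C * (x + e))%:E) -> I <= (C * x)%:E.
Proof.
move=> C0 H; apply/lee_addgt0Pr => e e0; rewrite -EFinD.
apply: le_trans (H (e / C) _)%R _; first by rewrite divr_gt0.
rewrite lee_fin le_eqVlt; apply/orP; left; apply/eqP; field.
by rewrite gt_eqF.
Qed.

Lemma tails_finite f : Sigma (Lp p%:E) (Lp q%:E) f < +oo ->
  forall n, upper p f n < +oo /\ lower q f n < +oo.
Proof.
move=> /Sigma_ltP[f0_ [f1_ [fE h0 h1]]] n.
move: (f0_ : V) (f1_ : V) fE h0 h1 => f0 f1 -> h0 h1.
have ff : {ae mu, forall x, (`|((f0 + f1)%R : V) x| <= `|f0 x| + `|f1 x|)%R}.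
  by move: (L0D f0 f1); apply: aeS => x ->; exact: ler_normD.
have pfin r (u : V) : (0 < r)%R -> Lp r%:E u < +oo -> pint r u < +oo.
  move=> r0 hu; have : Lp r%:E u \is a fin_num by rewrite ge0_fin_numE// Lp_ge0.
  move=> /fineK E; have : Lp r%:E u <= (fine (Lp r%:E u))%:E by rewrite E.
  move/(Lp_le _ r0 _) => H; apply: le_lt_trans (H _) (ltry _).
  by rewrite fine_ge0// Lp_ge0.
have mfin : mixed n f0 f1 < +oo.
  have W := ltW (scale_weight_gt0 n).
  have fin2 (c : R) (y : \bar R) : (0 <= c)%R -> y < +oo -> c%:E * y < +oo.
    by move=> c0 yy; rewrite lte_mul_pinfty// lee_fin.
  by rewrite lte_add_pinfty// !fin2 ?powR_ge0// pfin.
split; first exact: le_lt_trans (upper_le_mixed n ff) mfin.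
have W := scale_weight_gt0 n.
have := lower_le_mixed n ff; rewrite -lee_pdivlMl// => /le_lt_trans; apply.
rewrite lte_mul_pinfty ?lee_fin ?invr_ge0 ?ltW//.
by rewrite lte_mul_pinfty ?lee_fin// ltW// expR_gt0.
Qed.

(** Let A be the upper tail of f and s B its weighted lower tail at the level
n. They bound the parts of f above and below e^n, so K-domination gives a
decomposition of g of mixed size at most C max(A, s B), which bounds both
tails of g. If A is the larger one this is the upper inequality, otherwise the
lower one. *)
Lemma tail_dichotomy : exists2 C : R, (0 < C)%R & forall f g,
  Sigma (Lp p%:E) (Lp q%:E) f < +oo ->
  (forall t, (0 < t)%R -> Kfunctional (Lp p%:E) (Lp q%:E) t g <=
                          Kfunctional (Lp p%:E) (Lp q%:E) t f) ->
  forall n, upper p g n <= C%:E * upper p f n \/ lower q g n <= C%:E * lower q f n.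
Proof.
pose C1 : R := (2 `^ p * 3 `^ p + 2 `^ q * 3 `^ q)%R.
have C10 : (0 < C1)%R by rewrite addr_gt0// mulr_gt0// powR_gt0.
have E0 := expR_gt0 (q - p).
have E1 : (1 <= expR (q - p))%R by rewrite -expR0 ler_expR subr_ge0 ltW.
exists (expR (q - p) * C1)%R; first by rewrite mulr_gt0.
move=> f g Sf gf n.
have [Afin Bfin] := tails_finite Sf n.
have AE : upper p f n = (fine (upper p f n))%:E.
  by rewrite fineK// ge0_fin_numE// upper_ge0.
have BE : lower q f n = (fine (lower q f n))%:E.
  by rewrite fineK// ge0_fin_numE// lower_ge0.
set A := fine (upper p f n) in AE; set B := fine (lower q f n) in BE.
have A0 : (0 <= A)%R by rewrite fine_ge0// upper_ge0.
have B0 : (0 <= B)%R by rewrite fine_ge0// lower_ge0.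
set s := scale_weight n; have s0 : (0 < s)%R := scale_weight_gt0 n.
have [f0 [f1 [fE cin cout]]] := cut f (upper_measurable f n).
have [Pf0 Pf1] := pint_cut cin cout.
(* lam must be positive for the decomposition, so the maximum of A and s B is
   approached from above *)
have main lam : (0 < lam)%R -> (A <= lam)%R -> (s * B <= lam)%R ->
    exists g0 g1 : V, g = (g0 + g1)%R /\ mixed n g0 g1 <= (C1 * lam)%:E.
  move=> l0 Al Bl.
  have pw (x r : R) : (0 < r)%R -> (0 <= x)%R -> ((x `^ r^-1) `^ r = x)%R.
    by move=> r0 x0; rewrite -powRrM mulVf ?gt_eqF// powRr1.
  have ls0 : (0 < lam / s)%R by rewrite divr_gt0.
  have [|||g0 [g1 [gE /Lp_le g0B /Lp_le g1B]]] := @K_le_decomposition R (Lp p%:E) (Lp q%:E)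
    (Lp_ge0 _) (Lp_ge0 _) (fun u v => @Lp_solid R p%:E u v p0)
    (fun u v => @Lp_solid R q%:E u v q0) f g f0 f1 (lam `^ p^-1)%R ((lam / s) `^ q^-1)%R
    (powR_gt0 _ l0) (powR_gt0 _ ls0) _ _ _ gf.
  - rewrite fE; move: (L0D f0 f1); apply: aeS => x ->; exact: ler_normD.
  - apply/Lp_le => //; first exact: powR_ge0.
    by rewrite (pw _ _ p0 (ltW l0)) (le_trans Pf0)// AE lee_fin.
  - apply/Lp_le => //; first exact: powR_ge0.
    by rewrite (pw _ _ q0 (ltW ls0)) (le_trans Pf1)// BE lee_fin ler_pdivlMr// mulrC.
  exists g0, g1; split => //.
  have G0 : pint p g0 <= (3 `^ p * lam)%:E.
    rewrite -[X in (_ * X)%R](pw lam p p0 (ltW l0)) -powRM// ?powR_ge0//.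
    by apply: g0B => //; rewrite mulr_ge0// powR_ge0.
  have G1 : pint q g1 <= (3 `^ q * (lam / s))%:E.
    rewrite -[X in (_ * X)%R](pw (lam / s)%R q q0 (ltW ls0)) -powRM// ?powR_ge0//.
    by apply: g1B => //; rewrite mulr_ge0// powR_ge0.
  apply: (@le_trans _ _ ((2 `^ p)%:E * (3 `^ p * lam)%:E +
      s%:E * ((2 `^ q)%:E * (3 `^ q * (lam / s))%:E))).
    rewrite leeD// lee_pmul2l ?lte_fin ?powR_gt0//.
    by rewrite lee_pmul2l ?lte_fin ?powR_gt0.
  rewrite -!EFinM -EFinD lee_fin /C1 le_eqVlt; apply/orP; left; apply/eqP.
  by field; rewrite gt_eqF.
have gD (g0 g1 : V) : g = (g0 + g1)%R ->
    {ae mu, forall x, (`|g x| <= `|g0 x| + `|g1 x|)%R}.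
  by move=> ->; move: (L0D g0 g1); apply: aeS => x ->; exact: ler_normD.
have [BA|/ltW AB] := leP (s * B)%R A; [left|right].
  apply: (@le_trans _ _ (C1 * A)%:E); last first.
    by rewrite AE -EFinM lee_fin -mulrA ler_peMl// mulr_ge0// ltW.
  apply: eps_le => // e e0.
  have [|||g0 [g1 [/gD gE gm]]] := main (A + e)%R; [lra|lra|lra|].
  exact: le_trans (upper_le_mixed n gE) gm.
rewrite BE -EFinM -(@lee_pmul2l _ s%:E) ?lte_fin// -EFinM.
rewrite mulrCA; apply: eps_le; first by rewrite mulr_gt0.
move=> e e0.
have [|||g0 [g1 [/gD gE gm]]] := main (s * B + e)%R.
- by rewrite ltr_wpDl// mulr_ge0// ltW.
- by lra.
- by lra.
apply: le_trans (lower_le_mixed n gE) _.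
by rewrite -mulrA EFinM lee_pmul2l ?lte_fin.
Qed.

End two_exponents.
End level_tails.

(** * K-domination implies membership *)

Section calderon.
Context {R : realType}.
Local Open Scope ereal_scope.
Local Notation T := (measurableTypeR R).
Local Notation mu := (halfline_measure R).
Local Notation V := (L0h R).
Implicit Types (f g h : V) (n : int).

(** An everywhere linear operator bounded on both spaces maps the sum space to
itself, as the definition of interpolation spaces requires. *)
Lemma interpolation_lty (N0 N1 X : V -> \bar R) (S : V -> V) f :
  (forall h, 0 <= N0 h) -> (forall h, 0 <= N1 h) -> (forall h, 0 <= X h) ->
  interpolation_space N0 N1 X ->
  (forall (c : R) u v, S (c *: u + v)%R = (c *: S u + S v)%R) ->
  bounded_on S N0 -> bounded_on S N1 -> X f < +oo -> X (S f) < +oo.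
Proof.
move=> N00 N10 X0 [_ _ _ Xint] Slin S0 S1 Xf.
have bfin (N : V -> \bar R) u : (forall h, 0 <= N h) -> bounded_on S N ->
    N u < +oo -> N (S u) < +oo.
  move=> N_ge0 [C SC] Nu; apply: le_lt_trans (SC _ Nu) _.
  have /fineK <- : N u \is a fin_num by rewrite ge0_fin_numE.
  by rewrite -EFinM ltry.
apply: (bfin) => //; apply: Xint => //; split => [x|a x y _ _]; last exact: Slin.
move=> /Sigma_ltP[x0 [x1 [-> h0 h1]]]; apply/Sigma_ltP.
exists (S x0), (S x1); split; [|exact: bfin|exact: bfin].
by rewrite -[x0 in LHS]scale1r Slin scale1r.
Qed.

Lemma lattice_sum_lty (X : V -> \bar R) g u v : quasi_banach_lattice X ->
  X u < +oo -> X v < +oo ->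
  {ae mu, forall x, (`|g x| <= `|u x| + `|v x|)%R} -> X g < +oo.
Proof.
move=> XL Xu Xv guv; have [C C1 XC] := lattice_quasi XL.
have H : X g <= X (abs0 u + abs0 v)%R.
  apply: lattice_solid => //.
  have := L0D (abs0 u) (abs0 v) => D.
  have D2 : {ae mu, forall x, ((abs0 u + abs0 v)%R : V) x = (`|u x| + `|v x|)%R}.
    by move: D (abs0E u) (abs0E v); apply: aeS3 => x -> -> ->.
  move: D2 guv; apply: aeS2 => x -> h.
  by rewrite [leRHS]ger0_norm// addr_ge0.
apply: le_lt_trans H _; apply: le_lt_trans (XC _ _) _.
rewrite lte_mul_pinfty ?lee_fin//; first by lra.
rewrite lte_add_pinfty//.
  by apply: le_lt_trans Xu; apply: lattice_solid => //; exact: abs0_le.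
by apply: le_lt_trans Xv; apply: lattice_solid => //; exact: abs0_le.
Qed.

Lemma integral_scaled (D : set T) (C r : R) (h : V) : measurable D -> (0 <= C)%R ->
  \int[mu]_(x in D) (C * `|h x| `^ r)%:E = C%:E * \int[mu]_(x in D) (`|h x| `^ r)%:E.
Proof.
move=> mD C0; under eq_integral do rewrite EFinM.
rewrite ge0_integralZl; [by []|exact: mD|exact: epow_measurable|
  by move=> x _; rewrite lee_fin powR_ge0|by rewrite lee_fin].
Qed.

Lemma upperE r h m : \int[mu]_(x in [set x | (- level h x <= m)%R]) (`|h x| `^ r)%:E =
  upper r h (- m).
Proof. by rewrite /upper opprK. Qed.

Section two_finite_exponents.
Variables (p q : R) (X : V -> \bar R).
Hypotheses (p0 : (0 < p)%R) (pq : (p < q)%R).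
Hypothesis XL : quasi_banach_lattice X.
Hypothesis Xint : interpolation_space (Lp p%:E) (Lp q%:E) X.

(** J1 (up to sign) and J2 are the levels of g at which the upper inequality
with exponent p and the lower one with exponent q hold; by [tail_dichotomy]
every level is in one of them. The operators attached to the two sets send f
to functions that agree with g there. *)
Lemma K_dominated_finite f g : X f < +oo ->
  (forall t, (0 < t)%R -> Kfunctional (Lp p%:E) (Lp q%:E) t g <=
                          Kfunctional (Lp p%:E) (Lp q%:E) t f) ->
  X g < +oo.
Proof.
move=> Xf gf; have q0 : (0 < q)%R := lt_trans p0 pq.
have X0 := lattice_ge0 XL.
have Sf : Sigma (Lp p%:E) (Lp q%:E) f < +oo.
  have [_ _ [C XC] _] := Xint; apply: le_lt_trans (XC _ Xf) _.
  have /fineK <- : X f \is a fin_num by rewrite ge0_fin_numE.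
  by rewrite -EFinM ltry.
have [C C0 dich] := tail_dichotomy p0 pq.
have tfin := tails_finite p0 pq Sf.
pose J1 : set int := [set m | upper p g (- m) <= C%:E * upper p f (- m)].
pose J2 : set int := [set m | lower q g m <= C%:E * lower q f m].
have mg r : measurable_fun setT (fun x => `|g x| `^ r)%R by exact: pow_measurable.
have mf r : measurable_fun setT (fun x => C * `|f x| `^ r * \1_[set: T] x)%R.
  by apply: measurable_funM => //; apply: measurable_funM => //; exact: pow_measurable.
have fE r (D : set T) : measurable D ->
    \int[mu]_(x in D) (C * `|f x| `^ r * \1_[set: T] x)%:E =
    C%:E * \int[mu]_(x in D) (`|f x| `^ r)%:E.
  move=> mD; rewrite -integral_scaled//; last exact: ltW.
  by apply: eq_integral => x _; rewrite indicT mulr1.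
have b0 r x : (0 <= C * `|f x| `^ r * \1_[set: T] x)%R.
  by rewrite mulr_ge0// mulr_ge0 ?powR_ge0// ltW.
have mlg := opp_level_measurable_fun g; have mlf := opp_level_measurable_fun f.
have mkg := level_measurable_fun g; have mkf := level_measurable_fun f.
have mB1 := int_set_measurable J1 mlg; have mB2 := int_set_measurable J2 mkg.
have [||S1 [S1lin S1f S1s _]] := @level_operator R f g p C setT
  [set x | J1 (- level g x)%R] (fun x => - level g x)%R (fun x => - level f x)%R 0
  p0 C0 measurableT mB1 mlg mlf.
- move=> n; rewrite fE; last exact: level_measurable.
  by rewrite upperE lte_mul_pinfty ?lee_fin ?upper_ge0//; [exact: ltW|exact: (tfin _).1].
- apply: (@restrict_levels R _ _ _ _ 0 J1) => //.
  move=> n Jn; rewrite fE; last exact: level_measurable.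
  by rewrite addr0 !upperE.
have [||S2 [S2lin S2f S2s _]] := @level_operator R f g q C setT
  [set x | J2 (level g x)] (level g) (level f) 0
  q0 C0 measurableT mB2 mkg mkf.
- move=> n; rewrite fE; last exact: level_measurable.
  by rewrite lte_mul_pinfty ?lee_fin ?lower_ge0//; [exact: ltW|exact: (tfin _).2].
- apply: (@restrict_levels R _ _ _ _ 0 J2) => //.
  move=> n Jn; rewrite fE; last exact: level_measurable.
  by rewrite addr0; exact: Jn.
have ratio0 x y : g x <> 0%R -> f y <> 0%R -> (0 < `|g x / f y|)%R.
  by move=> /eqP gx /eqP fy; rewrite normr_gt0 mulf_neq0// invr_eq0.
have pow_split (y : R) : (0 < y)%R -> (y `^ q = y `^ (q - p) * y `^ p)%R.
  by move=> y0; rewrite -powRD ?subrK// (gt_eqF y0) implybT.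
have XS1 : X (S1 f) < +oo.
  apply: (interpolation_lty (Lp_ge0 _) (Lp_ge0 _) X0 Xint S1lin) => //.
    by apply: (S1s p 1%R) => // x y *; rewrite mul1r.
  apply: (S1s q ((expR (1 + 1)%:~R) `^ (q - p))%R) => //.
  move=> x y gx fy kl; have r0 := ratio0 _ _ gx fy.
  rewrite pow_split// ler_wpM2r ?powR_ge0// ge0_ler_powR ?nnegrE ?expR_ge0//.
    by rewrite subr_ge0 ltW.
  by apply: (@level_ratio_le R f g 1 x y gx fy); move: kl; clear; lia.
have XS2 : X (S2 f) < +oo.
  apply: (interpolation_lty (Lp_ge0 _) (Lp_ge0 _) X0 Xint S2lin) => //; last first.
    by apply: (S2s q 1%R) => // x y *; rewrite mul1r.
  apply: (S2s p ((expR (- (1 + 1))%:~R) `^ (p - q))%R) => //.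
  move=> x y gx fy kl; have r0 := ratio0 _ _ gx fy.
  have e0 := expR_gt0 ((- (1 + 1))%:~R : R).
  rewrite pow_split// -opprB powRN mulrA ler_peMl ?powR_ge0// mulrC.
  rewrite ler_pdivlMr ?powR_gt0// mul1r ge0_ler_powR ?nnegrE ?expR_ge0//.
    by rewrite subr_ge0 ltW.
  by apply: (@level_ratio_ge R f g 1 x y gx fy); move: kl; clear; lia.
apply: (lattice_sum_lty XL XS1 XS2).
move: S1f S2f; apply: aeS2 => x h1 h2.
have [J|J] := dich _ _ Sf gf (level g x).
  by rewrite h1 ?lerDl// /J1 /= !opprK.
by rewrite h2 ?lerDr.
Qed.

End two_finite_exponents.

Section infinite_exponent.
Variables (p : R) (X : V -> \bar R).
Hypothesis p0 : (0 < p)%R.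
Local Notation N0 := (Lp p%:E).
Local Notation N1 := (Lp +oo).

Lemma upper_le_double g g0 n :
  {ae mu, forall x, g x <> 0%R -> (expR n%:~R <= `|g x|)%R ->
     (`|g x| <= 2 * `|g0 x|)%R} ->
  upper p g n <= (2 `^ p)%:E * pint p g0.
Proof.
move=> H; rewrite /upper /pint integral_mkcond -ge0_integralZl;
  [|exact: measurableT|exact: epow_measurable|
  by move=> x _; rewrite lee_fin powR_ge0|by rewrite lee_fin powR_ge0].
apply: ae_ge0_le_integral.
- exact: measurableT.
- by move=> x _; apply: erestrict_ge0 => y _; rewrite lee_fin powR_ge0.
- apply: (iffLR (measurable_restrictT _ (upper_measurable g n))).
  by apply: measurable_funTS; exact: epow_measurable.
- by move=> x _; rewrite mule_ge0 ?lee_fin ?powR_ge0.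
- by apply: emeasurable_funM => //; exact: epow_measurable.
move: H; apply: aeS => x H _; rewrite patchE -EFinM.
case: ifPn => [|_]; last by rewrite lee_fin mulr_ge0 ?powR_ge0.
rewrite inE /= lerN2 => nx; rewrite lee_fin.
have [gx|/eqP gx] := eqVneq (g x) 0%R.
  by rewrite gx normr0 powR0 ?gt_eqF// mulr_ge0 ?powR_ge0.
rewrite -powRM// ge0_ler_powR ?nnegrE ?mulr_ge0//; first exact: ltW.
by apply: H => //; rewrite -le_level.
Qed.

Lemma Lp_inf_bound (f : V) : N1 f < +oo -> exists2 M : R, (0 < M)%R &
  {ae mu, forall x, (`|f x| <= M)%R}.
Proof.
move=> hf; have fin : N1 f \is a fin_num by rewrite ge0_fin_numE// Lp_ge0.
exists (fine (N1 f) + 1)%R; first by rewrite ltr_wpDl// fine_ge0// Lp_ge0.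
by apply/Linf_le; rewrite EFinD fineK// leeDl.
Qed.

Lemma pint_lty (u : V) : N0 u < +oo -> pint p u < +oo.
Proof.
move=> hu; have /fineK E : N0 u \is a fin_num by rewrite ge0_fin_numE// Lp_ge0.
have : N0 u <= (fine (N0 u))%:E by rewrite E.
move/(Lp_le _ p0 _) => H; apply: le_lt_trans (H _) (ltry _).
by rewrite fine_ge0// Lp_ge0.
Qed.

Lemma le_upper f m n : (m <= n)%R -> upper p f n <= upper p f m.
Proof.
move=> mn; apply: ge0_subset_integral.
- exact: upper_measurable.
- exact: upper_measurable.
- exact: epow_measurable.
- by move=> x _; rewrite lee_fin powR_ge0.
- by move=> x /=; lia.
Qed.

Lemma upper_tail_finite f : Sigma N0 N1 f < +oo -> exists n, upper p f n < +oo.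
Proof.
move=> /Sigma_ltP[f0_ [f1_ [fE h0 h1]]].
move: (f0_ : V) (f1_ : V) fE h0 h1 => f0 f1 fE h0 h1.
have [M M0 fM] := Lp_inf_bound h1.
pose n : int := ((Num.trunc (2 * M)).+1)%:Z.
have en : (2 * M <= expR n%:~R)%R.
  apply: le_trans (expR_ge1Dx _); apply: (@le_trans _ _ n%:~R%R).
    by rewrite /n -pmulrn ltW// truncnS_gt.
  by rewrite lerDr.
exists n; apply: (@le_lt_trans _ _ ((2 `^ p)%:E * pint p f0)).
  apply: upper_le_double.
  move: fM (L0D f0 f1); rewrite -fE; apply: aeS2 => x h1' -> _ h2.
  have := ler_normD (f0 x) (f1 x); lra.
by rewrite lte_mul_pinfty ?lee_fin ?powR_ge0// pint_lty.
Qed.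

(** Cut f at the level n - 3, and g accordingly. The bounded part of g is at
most 3 e^(n-3), which is at most e^n / 2, so where |g| >= e^n the other part
is at least half of g. *)
Lemma upper_domination : exists2 C : R, (0 < C)%R & forall f g,
  (forall t, (0 < t)%R -> Kfunctional N0 N1 t g <= Kfunctional N0 N1 t f) ->
  forall n, upper p g n <= C%:E * upper p f (n - 3).
Proof.
pose C : R := (2 `^ p * 3 `^ p)%R.
have C0 : (0 < C)%R by rewrite mulr_gt0// powR_gt0.
exists C => // f g gf n.
have [Ay|] := ltP (upper p f (n - 3)) +oo; last first.
  by rewrite leye_eq => /eqP ->; rewrite gt0_muley ?leey ?lte_fin.
have AE : upper p f (n - 3) = (fine (upper p f (n - 3)))%:E.
  by rewrite fineK// ge0_fin_numE// upper_ge0.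
set A := fine _ in AE.
have A0 : (0 <= A)%R by rewrite fine_ge0// upper_ge0.
have [f0 [f1 [fE cin cout]]] := cut f (upper_measurable f (n - 3)).
have pp1 : (p < p + 1)%R by rewrite ltrDl.
have [Pf0 _] := pint_cut p0 pp1 cin cout.
have e0 := expR_gt0 ((n - 3)%:~R : R).
have f1B : N1 f1 <= (expR (n - 3)%:~R)%:E.
  apply/Linf_le; move: cin cout; apply: aeS2 => x /= c1 c2.
  have [nx|nx] := boolP (- level f x <= - (n - 3))%R.
    by have [_ ->] := c1 nx; rewrite normr0 ltW.
  have [_ ->] := c2 (negP nx).
  have [->|/eqP fx] := eqVneq (f x) 0%R; first by rewrite normr0 ltW.
  by rewrite ltW// -level_lt//; move: nx; lia.
have e3 : (6 * expR (n - 3)%:~R <= expR n%:~R :> R)%R.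
  have -> : (n%:~R = 3%:R * 1 + (n - 3)%:~R :> R)%R by rewrite intrB; ring.
  rewrite expRD ler_pM2r// expRM_natl.
  have e1 : (2 <= expR 1 :> R)%R by have := expR_ge1Dx (1 : R)%R; lra.
  apply: (@le_trans _ _ (2 ^+ 3)%R); first by lra.
  by rewrite ler_pXn2r ?nnegrE ?expR_ge0//.
rewrite AE -EFinM; apply: eps_le => // d d0.
have l0 : (0 < A + d)%R by lra.
have pw : (((A + d) `^ p^-1) `^ p = A + d)%R.
  by rewrite -powRrM mulVf ?gt_eqF// powRr1// ltW.
have [||g0 [g1 [gE /Lp_le g0B /Linf_le g1B]]] := @K_le_decomposition R N0 N1
    (Lp_ge0 _) (Lp_ge0 _) (fun u v => @Lp_solid R p%:E u v p0)
    (fun u v => @Lp_solid R +oo u v (ltry 0%R)) f g f0 f1 ((A + d) `^ p^-1)%R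
    (expR (n - 3)%:~R)%R (powR_gt0 _ l0) e0 _ _ f1B gf.
- rewrite fE; move: (L0D f0 f1); apply: aeS => x ->; exact: ler_normD.
- apply/Lp_le => //; first exact: powR_ge0.
  by rewrite pw (le_trans Pf0)// AE lee_fin; lra.
have G0 : pint p g0 <= (3 `^ p * (A + d))%:E.
  rewrite -[X in (_ * X)%R]pw -powRM// ?powR_ge0//.
  by apply: g0B => //; rewrite mulr_ge0// powR_ge0.
apply: (@le_trans _ _ ((2 `^ p)%:E * pint p g0)).
  apply: upper_le_double.
  move: g1B (L0D g0 g1); rewrite -gE; apply: aeS2 => x h1 -> _ h2.
  have := ler_normD (g0 x) (g1 x); lra.
by rewrite /C -mulrA EFinM lee_pmul2l ?lte_fin ?powR_gt0.
Qed.

(** The finiteness that the monotone rearrangement requires of both measures.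
*)
Lemma halfline_ray_lty (m : {measure set T -> \bar R}) (z : R) :
  (forall A, measurable A -> m A <= mu A) -> m (`]-oo, z]%classic : set T) < +oo.
Proof.
move=> mm; apply: le_lt_trans (mm _ _) _; first exact: measurable_itv.
rewrite -[X in X < _]/(lebesgue_measure (`]-oo, z]%classic `&` halfline R)).
apply: (@le_lt_trans _ _ (lebesgue_measure (`[0%R, z]%classic : set R))).
  apply: le_measure; rewrite ?inE//.
    by apply: measurableI; [exact: measurable_itv|exact: measurable_halfline].
  move=> x []; rewrite /halfline /= !in_itv/= andbT => xz x0.
  by rewrite xz ltW.
rewrite lebesgue_measure_itv/= lte_fin; case: ifP => // _.
by rewrite -EFinD ltry.
Qed.

(** Composition with a map that carries the half-line measure into its
restriction to [A], which has enough mass to receive it. *)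
Lemma spread_operator (A : set T) : measurable A -> mu A = +oo ->
  exists S : V -> V, [/\
    forall (c : R) u v, S (c *: u + v)%R = (c *: S u + S v)%R,
    bounded_on S N0, bounded_on S N1
    & forall (h : V) (c : R), (forall x, A x -> (c <= `|h x|)%R) ->
      {ae mu, forall x, (c <= `|S h x|)%R}].
Proof.
move=> mA muA.
pose m2 : {measure set T -> \bar R} := mrestr mu mA.
have m2le B : measurable B -> m2 B <= mu B.
  move=> mB; rewrite -[X in X <= _]/(mu (B `&` A)).
  by apply: le_measure; rewrite ?inE//; exact: measurableI.
have [||||tau [mtau tauA _]] := @monotone_transport R mu m2.
- by move=> z; exact: halfline_ray_lty.
- by move=> z; exact: halfline_ray_lty.
- exact: halfline_set1.
- by rewrite -[leRHS]/(mu (setT `&` A)) setTI muA leey.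
pose one : T -> R := cst 1%R.
have a0 (x : T) : (0 <= one x)%R by rewrite /one.
have ma : measurable_fun setT one by exact: measurable_cst.
have b0 (x : T) : (0 <= \1_A x :> R)%R by [].
have mb : measurable_fun setT (\1_A : T -> R) by exact: measurable_indic.
have sab B : measurable B ->
    \int[mu]_(x in tau @^-1` B) (one x)%:E <=
    \int[mu]_(x in B) (\1_A x : R)%:E.
  move=> mB; have mtB := preimage_measurable mtau mB.
  rewrite -[leLHS]/(\int[mu]_(x in tau @^-1` B) (cst 1%:E : T -> \bar R) x).
  rewrite integral_cst// mul1e integral_indic//.
  by apply: le_trans (tauA _ mB) _; rewrite -[X in X <= _]/(mu (B `&` A)) setIC.
have wab : {ae mu, forall x, one x <> 0%R ->
    (0 < one x)%R /\ (0 < \1_A (tau x) :> R)%R}.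
  exists (tau @^-1` (~` A)); split.
  - by apply: preimage_measurable => //; exact: measurableC.
  - apply/eqP; rewrite -measure_le0.
    rewrite (le_trans (tauA _ (measurableC mA)))//.
    by rewrite -[X in X <= _]/(mu (~` A `&` A)) setICl measure0.
  - move=> x /= nx Ax; apply: nx => _; split => //.
    by rewrite indicE mem_set.
have tauAE : {ae mu, forall x, A (tau x)}.
  move: wab; apply: aeS => x /= [|_]; first by apply/eqP; exact: oner_neq0.
  rewrite indicE; case: (pselect (A (tau x))) => // nA.
  by rewrite memNset// ltxx.
exists (wcomp ma mtau); split.
- by move=> c u v; exact: (wcomp_linear a0 ma mb ma mtau sab wab).
- apply: (wcomp_bounded a0 b0 ma mb ma mtau sab p0 ler01).
  move: tauAE; apply: aeS => x Ax _; rewrite indicE mem_set//= normr1 powR1.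
  by rewrite divr1 mulr1.
- apply: (wcomp_bounded_inf a0 ma mb ma mtau sab wab ler01).
  by apply: aeW => x /=; rewrite normr1.
- move=> h c hA; move: (wcompE ma mtau h) tauAE; apply: aeS2 => x -> Ax.
  by rewrite mul1r; exact: hA.
Qed.

Hypothesis XL : quasi_banach_lattice X.
Hypothesis Xint : interpolation_space N0 N1 X.

(** J consists of the levels at which the upper tail of f is finite. The part
of g at levels n with n - 3 in J is recovered from f by a level operator. If
some level m is not in J, then |f| >= e^m on a set of infinite measure, so X
contains the constants, and what remains of g is bounded because J contains
all large levels. *)
Lemma K_dominated_infinite f g : X f < +oo ->
  (forall t, (0 < t)%R -> Kfunctional N0 N1 t g <= Kfunctional N0 N1 t f) ->
  X g < +oo.
Proof.
move=> Xf gf.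
have X0 := lattice_ge0 XL.
have Sf : Sigma N0 N1 f < +oo.
  have [_ _ [C XC] _] := Xint; apply: le_lt_trans (XC _ Xf) _.
  have /fineK <- : X f \is a fin_num by rewrite ge0_fin_numE.
  by rewrite -EFinM ltry.
have [C C0 /(_ _ _ gf) dom] := upper_domination.
have [N fN] := upper_tail_finite Sf.
pose J n := upper p f n < +oo.
have Jup m n : (m <= n)%R -> J m -> J n.
  by move=> mn; apply: le_lt_trans; exact: le_upper.
pose J1 : set int := [set m | J (- m - 3)%R].
have mlg := opp_level_measurable_fun g; have mlf := opp_level_measurable_fun f.
have mkf := level_measurable_fun f.
have mA := int_set_measurable [set n | J n] mkf.
have mB := int_set_measurable J1 mlg.
set A := [set x | J (level f x)] in mA.
have mb : measurable_fun setT (fun x => C * `|f x| `^ p * \1_A x)%R.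
  apply: measurable_funM; last exact: measurable_indic.
  by apply: measurable_funM => //; exact: pow_measurable.
have b0 x : (0 <= C * `|f x| `^ p * \1_A x)%R.
  by rewrite mulr_ge0// mulr_ge0 ?powR_ge0// ltW.
(* on a tail, the truncated density has no more mass than f has on the levels
   of that tail that are kept *)
have bE (D : set T) n : measurable D ->
    (forall x, D x -> A x -> (- level f x <= - n)%R) ->
    \int[mu]_(x in D) (C * `|f x| `^ p * \1_A x)%:E <= C%:E * upper p f n.
  move=> mD Dn; rewrite /upper -integral_scaled//; [|exact: upper_measurable|exact: ltW].
  rewrite integral_mkcond [leRHS]integral_mkcond.
  have C1 x : (0 <= C * `|f x| `^ p)%R by rewrite mulr_ge0 ?powR_ge0// ltW.
  apply: ge0_le_integral.
  - exact: measurableT.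
  - by move=> x _; apply: erestrict_ge0 => y _; rewrite lee_fin.
  - apply: (iffLR (measurable_restrictT _ mD)).
    by apply: measurable_funTS; exact/measurable_EFinP.
  - apply: (iffLR (measurable_restrictT _ (upper_measurable f n))).
    apply: measurable_funTS; apply/measurable_EFinP; apply: measurable_funM => //.
    exact: pow_measurable.
  move=> x _; rewrite !patchE.
  case: ifPn => [|_]; last by case: ifPn => // _; rewrite lee_fin.
  rewrite inE => Dx; have [Ax|nA] := pselect (A x).
    by rewrite indicE mem_set// mulr1 ifT// inE; exact: Dn.
  rewrite indicE memNset// mulr0.
  by case: ifPn => // _; rewrite lee_fin.
have [||S1 [S1lin S1f S1s S1i]] := @level_operator R f g p C A
  [set x | J1 (- level g x)%R] (fun x => - level g x)%R (fun x => - level f x)%R 3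
  p0 C0 mA mB mlg mlf.
- move=> n; have [Jn|nJ] := pselect (J (- n)%R).
    apply: (@le_lt_trans _ _ (C%:E * upper p f (- n))).
      by apply: bE; [exact: level_measurable|move=> x /=; rewrite opprK].
    by rewrite lte_mul_pinfty ?lee_fin// ltW.
  (* f is cut off at the levels outside J, so that only levels from the least
     one of J above - n on contribute *)
  have exj : exists j : nat, `[< J (- n + j%:Z)%R >].
    exists `|(N + n)%R|%N; apply/asboolP; apply: Jup fN; lia.
  have [j /asboolP Jj jmin] := ex_minnP exj.
  apply: (@le_lt_trans _ _ (C%:E * upper p f (- n + j%:Z))).
    apply: bE; first exact: level_measurable.
    move=> x /= xn Ax; rewrite lerN2.
    have : (j <= `|(level f x + n)%R|)%N.
      apply: jmin; apply/asboolP; apply: Jup Ax; lia.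
    lia.
  by rewrite lte_mul_pinfty ?lee_fin// ltW.
- apply: (@restrict_levels R _ _ _ _ 3 J1) => //.
    exact: pow_measurable.
  move=> n Jn; rewrite upperE; apply: (le_trans (dom (- n)%R)).
  rewrite /upper -integral_scaled//; [|exact: upper_measurable|exact: ltW].
  rewrite [leRHS](_ : _ = \int[mu]_(x in [set x | (- level f x <= - (- n - 3))%R])
     (C * `|f x| `^ p)%:E)//.
  rewrite (_ : (- (- n - 3) = n + 3)%R); last by lia.
  apply: eq_integral => x; rewrite inE /= => nx.
  by rewrite indicE mem_set ?mulr1//; apply: Jup Jn; lia.
have XS1 : X (S1 f) < +oo.
  apply: (interpolation_lty (Lp_ge0 _) (Lp_ge0 _) X0 Xint S1lin) => //.
    by apply: (S1s p 1%R) => // x y *; rewrite mul1r.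
  apply: (S1i (expR (4 + 1)%:~R)); first exact: expR_ge0.
  move=> x y gx fy kl; apply: level_ratio_le => //; move: kl; lia.
have J1E x : J1 (- level g x)%R = J (level g x - 3)%R by rewrite /J1 /= opprK.
have [Jall|] := pselect (forall n, J n).
  apply: (lattice_sum_lty XL XS1 XS1).
  move: S1f; apply: aeS => x ->; first by rewrite lerDl.
  by rewrite /= J1E; exact: Jall.
move=> /existsNP[m nJm].
(* D has infinite measure: the p-th power of f has infinite mass on it, while f
   is bounded apart from a function of finite p-norm *)
pose D := [set x | (- level f x <= - m)%R] `&` [set x | f x != 0%R].
have mD : measurable D.
  apply: measurableI; first exact: upper_measurable.
  rewrite (_ : mkset _ = f @^-1` (~` [set 0%R])).
    apply: preimage_measurable => //; apply: measurableC; exact: measurable_set1.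
  by apply/seteqP; split => x /= /eqP.
have muD : mu D = +oo.
  apply/eqP; rewrite -leye_eq leNgt; apply/negP => Dfin; apply: nJm.
  move: Sf => /Sigma_ltP[f0_ [f1_ [fE h0 h1]]].
  move: (f0_ : V) (f1_ : V) fE h0 h1 => f0 f1 fE h0 h1.
  have [M M0 fM] := Lp_inf_bound h1.
  have m0 : measurable_fun setT (fun x => 2 `^ p * `|f0 x| `^ p)%R.
    by apply: measurable_funM => //; exact: pow_measurable.
  have m1 : measurable_fun setT (fun x => (2 * M) `^ p * \1_D x : R)%R.
    by apply: measurable_funM => //; exact: measurable_indic.
  apply: (@le_lt_trans _ _ (\int[mu]_x ((2 `^ p * `|f0 x| `^ p)%:E +
      ((2 * M) `^ p * \1_D x)%:E))).
    rewrite /upper integral_mkcond; apply: ae_ge0_le_integral.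
    - exact: measurableT.
    - by move=> x _; apply: erestrict_ge0 => y _; rewrite lee_fin powR_ge0.
    - apply: (iffLR (measurable_restrictT _ (upper_measurable f m))).
      by apply: measurable_funTS; exact: epow_measurable.
    - by move=> x _; rewrite adde_ge0// lee_fin mulr_ge0 ?powR_ge0.
    - by apply: emeasurable_funD; exact/measurable_EFinP.
    move: fM (L0D f0 f1); rewrite -fE; apply: aeS2 => x h1' h2 _; rewrite patchE.
    have R0 : (0 <= 2 `^ p * `|f0 x| `^ p)%R by rewrite mulr_ge0 ?powR_ge0.
    have R1 : (0 <= (2 * M) `^ p * \1_D x)%R by rewrite mulr_ge0 ?powR_ge0.
    case: ifPn => [|_]; last by rewrite -EFinD lee_fin addr_ge0.
    rewrite inE /= => mx; rewrite -EFinD lee_fin.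
    have [fx|fx] := eqVneq (f x) 0%R.
      by rewrite fx normr0 powR0 ?gt_eqF// addr_ge0.
    rewrite indicE mem_set ?mulr1//.
    have fn : (`|f x| <= `|f0 x| + M)%R.
      by rewrite h2 (le_trans (ler_normD _ _))// lerD2l.
    have [f0M|/ltW Mf0] := leP `|f0 x|%R M.
      apply: (@le_trans _ _ ((2 * M) `^ p)%R); last by rewrite lerDr.
      by rewrite ge0_ler_powR ?nnegrE//; [exact: ltW|lra|lra].
    apply: (@le_trans _ _ (2 `^ p * `|f0 x| `^ p)%R); last by rewrite lerDl powR_ge0.
    rewrite -powRM// ge0_ler_powR ?nnegrE ?mulr_ge0//; [exact: ltW|lra].
  rewrite ge0_integralD; [|exact: measurableT|
    by move=> x _; rewrite lee_fin mulr_ge0 ?powR_ge0|exact/measurable_EFinP|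
    by move=> x _; rewrite lee_fin mulr_ge0 ?powR_ge0|exact/measurable_EFinP].
  rewrite lte_add_pinfty//.
    rewrite (integral_scaled _ _ measurableT) ?powR_ge0//.
    by apply: lte_mul_pinfty; [rewrite lee_fin powR_ge0| |exact: (pint_lty h0)].
  under eq_integral do rewrite EFinM.
  rewrite ge0_integralZl; [|exact: measurableT|
    by apply/measurable_EFinP; exact: measurable_indic|
    by move=> x _; rewrite lee_fin|by rewrite lee_fin powR_ge0].
  by rewrite integral_indic// setIT lte_mul_pinfty ?lee_fin ?powR_ge0.
have [S2 [S2lin S20 S21 S2D]] := spread_operator mD muD.
have XS2 : X (S2 f) < +oo.
  exact: (interpolation_lty (Lp_ge0 _) (Lp_ge0 _) X0 Xint S2lin).
(* c scales the lower bound e^m of S2 f to the upper bound e^(N+3) of the rest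
   of g *)
pose c : R := (expR (N + 3)%:~R / expR m%:~R)%R.
have c0 : (0 < c)%R by rewrite divr_gt0 ?expR_gt0.
have XcS2 : X (c *: S2 f)%R < +oo.
  by rewrite latticeZ// lte_mul_pinfty ?lee_fin.
apply: (lattice_sum_lty XL XS1 XcS2).
have S2f : {ae mu, forall x, (expR m%:~R <= `|S2 f x|)%R}.
  apply: S2D => x [/=]; rewrite lerN2 => mx /eqP fx; by rewrite -le_level.
have cS2 : {ae mu, forall x, (expR (N + 3)%:~R <= `|((c *: S2 f)%R : V) x|)%R}.
  move: S2f (L0Z c (S2 f)); apply: aeS2 => x h1 ->.
  rewrite normrM gtr0_norm// /c mulrAC ler_pdivlMr ?expR_gt0//.
  by rewrite ler_pM2l// expR_gt0.
move: S1f cS2; apply: aeS2 => x h1 h2.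
have [Jx|nJx] := pselect (J (level g x - 3)%R).
  by rewrite h1 ?lerDl//= J1E.
have [->|/eqP gx] := eqVneq (g x) 0%R; first by rewrite normr0 addr_ge0.
apply: (@le_trans _ _ (expR (N + 3)%:~R)).
  rewrite ltW// -level_lt// ltNge; apply/negP => Ng; apply: nJx.
  by apply: Jup fN; rewrite lerBrDr.
by rewrite (le_trans h2)// lerDr.
Qed.

End infinite_exponent.
End calderon.

(** * Suprema with summable weights *)

Section weighted_suprema.
Context {R : realType}.
Local Open Scope ereal_scope.
Local Notation T := (measurableTypeR R).
Local Notation mu := (halfline_measure R).
Local Notation V := (L0h R).

Definition weighted_sup_bounded (a : nat -> R) (N : V -> \bar R) :=
  forall (c : R) (u : nat -> V), (0 <= c)%R -> (forall n, N (u n) <= c%:E) ->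
  exists2 h : V, (forall n, {ae mu, forall x, (a n * `|u n x| <= `|h x|)%R})
                 & N h <= c%:E.

Lemma Linfty_weighted_sup (a : nat -> R) : (forall n, (0 <= a n <= 1)%R) ->
  weighted_sup_bounded a (Lp +oo).
Proof.
move=> a01 c u c0 uc; exists (toL0 (@measurable_cst _ _ T R setT c)).
  move=> n; move/Linf_le: (uc n) (toL0E (@measurable_cst _ _ T R setT c)).
  apply: aeS2 => x h ->; have /andP[a0 a1] := a01 n.
  by rewrite (ger0_norm c0) (le_trans _ h)// ler_piMl.
apply/Linf_le; move: (toL0E (@measurable_cst _ _ T R setT c)); apply: aeS => x ->.
by rewrite ger0_norm.
Qed.

(** The supremum is at most the r-th root of the sum of the r-th powers, whose
integral is at most the sum of a_n^r c^r. *)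
Lemma Lp_weighted_sup (r : R) (a : nat -> R) : (0 < r)%R ->
  (forall n, (0 <= a n)%R) -> (forall n, (a n `^ r <= (2 ^ n.+1)%:R^-1)%R) ->
  weighted_sup_bounded a (Lp r%:E).
Proof.
move=> r0 a0 ar c u c0 uc.
pose w n x := ((a n * `|u n x|) `^ r)%R.
have w0 n x : 0 <= (w n x)%:E by rewrite lee_fin powR_ge0.
have mw n : measurable_fun setT (fun x => (w n x)%:E).
  apply/measurable_EFinP; apply: (measurableT_comp (@measurable_powR R r)).
  apply: measurable_funM => //.
  exact: (measurableT_comp (@normr_measurable R setT) (measurable_L0 (u n))).
pose F x := \sum_(n <oo) (w n x)%:E.
have F0 x : 0 <= F x by apply: nneseries_ge0.
have mF : measurable_fun setT F.
  exact: (@ge0_emeasurable_sum _ _ _ setT (fun n x => (w n x)%:E) xpredT).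
have iF : \int[mu]_x F x <= (c `^ r)%:E.
  rewrite integral_nneseries//.
  apply: le_trans (epsilon_trick0 xpredT (powR_ge0 c r)).
  apply: lee_nneseries => [n _ _|n _]; first exact: integral_ge0.
  under eq_integral do rewrite /w powRM// EFinM.
  rewrite ge0_integralZl//; [|exact: epow_measurable|
    by rewrite lee_fin powR_ge0].
  rewrite EFinM muleC; apply: lee_pmul; rewrite ?lee_fin ?powR_ge0//.
    exact: pint_ge0.
  by apply/Lp_le.
have Ffin : {ae mu, forall x, F x \is a fin_num}.
  have iFi : mu.-integrable setT F.
    apply/integrableP; split=> //.
    under eq_integral do rewrite gee0_abs//.
    exact: le_lt_trans iF (ltry _).
  by have := integrable_ae measurableT iFi; apply: aeS => x; apply.
have mh : measurable_fun setT (fun x => fine (F x) `^ r^-1)%R.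
  by apply: (measurableT_comp (@measurable_powR R r^-1)); exact: measurableT_comp.
exists (toL0 mh) => [n|].
  move: Ffin (toL0E mh); apply: aeS2 => x Fx ->.
  rewrite [leRHS]ger0_norm ?powR_ge0//.
  suff : (w n x `^ r^-1 <= fine (F x) `^ r^-1)%R.
    by rewrite /w -powRrM divff ?gt_eqF// powRr1// mulr_ge0.
  rewrite ge0_ler_powR ?nnegrE ?invr_ge0 ?powR_ge0 ?fine_ge0 ?(ltW r0)//.
  rewrite -lee_fin fineK//.
  apply: le_trans (nneseries_lim_ge n.+1 (fun k _ _ => w0 k x)).
  by rewrite big_nat_recr//= leeDr// sume_ge0.
apply/Lp_le => //; apply: le_trans iF.
apply: ae_ge0_le_integral => //; first by exact: epow_measurable.
move: Ffin (toL0E mh); apply: aeS2 => x Fx -> _.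
rewrite ger0_norm ?powR_ge0// -powRrM mulVf ?gt_eqF// powRr1 ?fine_ge0//.
by rewrite fineK.
Qed.

End weighted_suprema.

(** * From finiteness to a uniform constant *)

Section uniform_bound.
Context {R : realType}.
Local Open Scope ereal_scope.
Local Notation T := (measurableTypeR R).
Local Notation mu := (halfline_measure R).
Local Notation V := (L0h R).

Variables (N0 N1 X : V -> \bar R) (a : nat -> R).
Hypotheses (N0_ge0 : forall f, 0 <= N0 f) (N1_ge0 : forall f, 0 <= N1 f).
Hypotheses (N0_solid : forall f g : V,
    {ae mu, forall x, (`|g x| <= `|f x|)%R} -> N0 g <= N0 f)
  (N1_solid : forall f g : V,
    {ae mu, forall x, (`|g x| <= `|f x|)%R} -> N1 g <= N1 f).
Hypotheses (N0Z : forall a f, N0 (a *: f)%R = `|a|%:E * N0 f)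
  (N1Z : forall a f, N1 (a *: f)%R = `|a|%:E * N1 f).
Hypothesis X_lattice : quasi_banach_lattice X.
Hypothesis X_Sigma : continuously_included X (Sigma N0 N1).
Hypotheses (a_gt0 : forall n, (0 < a n)%R)
  (N0_sup : weighted_sup_bounded a N0) (N1_sup : weighted_sup_bounded a N1).

Local Notation K := (Kfunctional N0 N1).
Let X_ge0 := lattice_ge0 X_lattice.

(** The function [g] is sup a_n |G n|, a single function for all t. For fixed
t, near optimal decompositions of the G n have terms of size at most K(t, f) +
e and (K(t, f) + e) / t; the weighted suprema of the two families of terms
majorize [g], whence K(t, g) <= 2 K(t, f). *)
Lemma glue_dominated (f : V) (G : nat -> V) : X f < +oo ->
  (forall n t, (0 < t)%R -> K t (G n) <= K t f) ->
  exists2 g : V, (forall n, {ae mu, forall x, (a n * `|G n x| <= `|g x|)%R})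
    & forall t, (0 < t)%R -> K t g <= K t (2 *: f)%R.
Proof.
move=> Xf Gf; pose v n x := (a n * `|G n x|)%R.
have mv n : measurable_fun setT (v n).
  apply: measurable_funM => //.
  exact: (measurableT_comp (@normr_measurable R setT) (measurable_L0 (G n))).
have [g mg gP] := pointwise_sup mv.
have v0 n x : (0 <= v n x)%R by rewrite mulr_ge0// ltW.
have main t e : (0 < t)%R -> (0 < e)%R -> exists h0 h1 : V,
    [/\ forall n, {ae mu, forall x, (v n x <= `|h0 x| + `|h1 x|)%R},
      N0 h0 <= (kf N0 N1 f t + e)%:E & N1 h1 <= ((kf N0 N1 f t + e) / t)%:E].
  move=> t0 e0; set c := (kf N0 N1 f t + e)%R.
  have k0 : (0 <= kf N0 N1 f t)%R by rewrite fine_ge0// K_ge0// ltW.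
  have c0 : (0 < c)%R by rewrite /c; lra.
  have dec n : exists y : V * V, [/\ G n = (y.1 + y.2)%R, N0 y.1 <= c%:E
      & N1 y.2 <= (c / t)%:E].
    have : K t (G n) < c%:E.
      apply: le_lt_trans (Gf n t t0) _.
      by rewrite -(kfE N0_ge0 N1_ge0 X_lattice X_Sigma Xf t0) lte_fin /c; lra.
    move=> /ereal_inf_lt[_ [x0 [x1 [-> h0 h1 ->]]] xc].
    exists (x0, x1); split => //=.
      apply: le_trans (ltW xc); rewrite leeDl// mule_ge0// lee_fin ltW//.
    rewrite mulrC EFinM lee_pdivlMl//; apply: le_trans (ltW xc).
    by rewrite leeDr.
  have [y yP] := choice dec.
  have [|h0 h0P N0h] := N0_sup (u := fun n => (y n).1) (ltW c0).
    by move=> n; have [] := yP n.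
  have [||h1 h1P N1h] := N1_sup (u := fun n => (y n).2) (c := (c / t)%R).
  - by rewrite divr_ge0// ltW.
  - by move=> n; have [] := yP n.
  exists h0, h1; split=> // n.
  have [GE _ _] := yP n; rewrite /v GE.
  move: (h0P n) (h1P n) (L0D (y n).1 (y n).2); apply: aeS3 => x l0 l1 ->.
  apply: le_trans (lerD l0 l1); rewrite -mulrDr ler_pM2l//.
  exact: ler_normD.
exists (toL0 mg) => [n|t t0].
  have [h0 [h1 [/ae_foralln vh _ _]]] := main 1%R 1%R ltr01 ltr01.
  move: vh (toL0E mg); apply: aeS2 => x vh ->.
  have [/(_ n) vg _] := gP _ _ vh.
  exact: le_trans vg (ler_norm _).
rewrite (KZ N0_ge0 N1_ge0 N0Z N1Z)// ?pnatr_eq0 ?(ltW t0)// gtr0_norm//.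
rewrite -(kfE N0_ge0 N1_ge0 X_lattice X_Sigma Xf t0) -EFinM.
apply/lee_addgt0Pr => e e0.
have e20 : (0 < e / 2)%R by lra.
have [h0 [h1 [/ae_foralln vh h0c h1c]]] := main t _ t0 e20.
set c := (kf N0 N1 f t + e / 2)%R in h0c h1c.
apply: (@le_trans _ _ (N0 h0 + t%:E * N1 h1)).
  apply: (K_solid2 N0_solid N1_solid); rewrite ?ltW//.
  - exact: le_lt_trans h0c (ltry _).
  - exact: le_lt_trans h1c (ltry _).
  move: vh (toL0E mg); apply: aeS2 => x vh ->.
  have [vg gh] := gP _ _ vh.
  by rewrite ger0_norm// (le_trans (v0 0%N x)).
apply: (@le_trans _ _ (c%:E + c%:E)).
  apply: leeD => //; rewrite -lee_pdivlMl//.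
  by rewrite -EFinM mulrC.
by rewrite -!EFinD lee_fin /c; lra.
Qed.

(** The pair number n violates the constant r n / delta^n, with r n = (n + 1)
/ a n. Scaled by r n / X g_n it satisfies X f_n <= delta^n, which provides a
common majorant, and X g_n = r n, so that the weighted supremum has quasi-norm
at least n + 1. *)
Lemma uniform_constant :
  (forall f g, X f < +oo -> (forall t, (0 < t)%R -> K t g <= K t f) -> X g < +oo) ->
  exists2 C : R, (0 < C)%R & forall f g, X f < +oo ->
    (forall t, (0 < t)%R -> K t g <= K t f) -> X g <= C%:E * X f.
Proof.
move=> Kdom; apply: contrapT => noC.
have [delta /andP[d0 _] major] := countable_majorant X_lattice.
pose r n := (n.+1%:R / a n)%R.
have r0 n : (0 < r n)%R by rewrite divr_gt0.
have dn n : (0 < delta ^+ n)%R by rewrite exprn_gt0.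
have bad n : exists y : V * V, [/\ X y.1 < +oo,
    (forall t, (0 < t)%R -> K t y.2 <= K t y.1)
    & (r n / delta ^+ n)%:E * X y.1 < X y.2].
  apply: contrapT => good; apply: noC; exists (r n / delta ^+ n)%R.
    by rewrite divr_gt0.
  move=> f g Xf fg; rewrite leNgt; apply/negP => lt.
  by apply: good; exists (f, g).
have [y yP] := choice bad.
have Xy2 n : exists2 s : R, (0 < s)%R & X (y n).2 = s%:E.
  have [h1 h2 h3] := yP n.
  have Xfin : X (y n).2 \is a fin_num by rewrite ge0_fin_numE// (Kdom _ _ h1 h2).
  exists (fine (X (y n).2)); last by rewrite fineK.
  rewrite -lte_fin fineK//; apply: le_lt_trans h3.
  by rewrite mule_ge0// lee_fin ltW// divr_gt0.
have [s s0 sE] : exists2 s : nat -> R, (forall n, (0 < s n)%R)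
    & forall n, X (y n).2 = (s n)%:E.
  have [s sP] := choice (fun n => let: ex_intro2 s h1 h2 := Xy2 n in
    ex_intro (fun s : R => (0 < s)%R /\ X (y n).2 = s%:E) s (conj h1 h2)).
  by exists s => n; have [] := sP n.
pose l n := (r n / s n)%R.
have l0 n : (0 < l n)%R by rewrite divr_gt0.
have [n|f Xf fP] := major (fun n => (l n *: (y n).1)%R).
  have [h1 _ h3] := yP n; move: h3; rewrite latticeZ// gtr0_norm// sE.
  have /fineK <- : X (y n).1 \is a fin_num by rewrite ge0_fin_numE.
  rewrite -!EFinM lte_fin lee_fin => /ltW h3.
  rewrite /l mulrAC ler_pdivrMr//.
  by move: h3; rewrite mulrAC ler_pdivrMr// mulrC [leRHS]mulrC mulrC.
have [n t t0|g gP gK] := @glue_dominated f (fun n => (l n *: (y n).2)%R) Xf.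
  have [h1 h2 _] := yP n.
  apply: (@le_trans _ _ (K t (l n *: (y n).1)%R)).
    rewrite !(KZ N0_ge0 N1_ge0 N0Z N1Z) ?gt_eqF// ?(ltW t0)//.
    by apply: lee_wpmul2l => //; exact: h2.
  apply: (K_solid N0_solid N1_solid) => //; exact: ltW.
have Xg : X g < +oo.
  apply: (Kdom (2 *: f)%R) => //.
  by rewrite latticeZ// lte_mul_pinfty ?lee_fin.
have Xgn n : n.+1%:R%:E <= X g.
  have -> : n.+1%:R%:E = X (a n *: (l n *: (y n).2))%R.
    rewrite !latticeZ// sE !gtr0_norm// -!EFinM; congr EFin.
    by rewrite /l /r; field; rewrite !gt_eqF.
  apply: (lattice_solid X_lattice); move: (gP n) (L0Z (a n) (l n *: (y n).2)%R).
  by apply: aeS2 => x h ->; rewrite normrM gtr0_norm.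
have /fineK XgE : X g \is a fin_num by rewrite ge0_fin_numE.
have := Xgn (Num.trunc (fine (X g))); rewrite -XgE lee_fin.
by apply/negP; rewrite -ltNge; exact: truncnS_gt.
Qed.

End uniform_bound.

(** * The couple of Lebesgue spaces *)

Section lebesgue_couples.
Context {R : realType}.
Local Open Scope ereal_scope.
Local Notation T := (measurableTypeR R).
Local Notation mu := (halfline_measure R).
Local Notation V := (L0h R).

(** The p-th powers of the weights have sum 1, and so have their r-th powers a
sum of at most 1 for every r >= p: the same weights serve both spaces of the
couple. *)
Definition weight (p : R) n : R := ((2 ^ n.+1)%:R^-1 `^ p^-1)%R.

Lemma weight_gt0 p n : (0 < weight p n)%R.
Proof. by rewrite powR_gt0// invr_gt0 ltr0n expn_gt0. Qed.

Lemma weight_le1 p n : (0 < p)%R -> (weight p n <= 1)%R.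
Proof.
move=> p0; rewrite /weight [leRHS](_ : 1 = 1 `^ p^-1)%R; last by rewrite powR1.
rewrite ge0_ler_powR ?nnegrE ?invr_ge0 ?(ltW p0)//.
by rewrite invf_le1 ?ltr0n ?expn_gt0// ler1n expn_gt0.
Qed.

Lemma weight_pow p r n : (0 < p <= r)%R -> (weight p n `^ r <= (2 ^ n.+1)%:R^-1)%R.
Proof.
move=> /andP[p0 pr]; rewrite /weight -powRrM.
rewrite -[leRHS]powRr1 ?invr_ge0// ger_powR//.
  rewrite invr_gt0 ltr0n expn_gt0/=.
  by rewrite invf_le1 ?ltr0n ?expn_gt0// ler1n expn_gt0.
by rewrite mulrC ler_pdivlMr// mul1r.
Qed.

Lemma Lebesgue_weighted_sup (p : R) (r : \bar R) : (0 < p)%R -> p%:E <= r ->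
  weighted_sup_bounded (weight p) (@Lp R r).
Proof.
case: r => [r||//] p0 pr; last first.
  by apply: Linfty_weighted_sup => n; rewrite weight_le1// ltW ?weight_gt0.
rewrite lee_fin in pr; apply: Lp_weighted_sup => [|n|n]; first exact: lt_le_trans pr.
- exact: ltW (weight_gt0 _ _).
- by apply: weight_pow; rewrite p0.
Qed.

(** If K(1, f) = 0 then K(., f) = 0, so that every multiple of f is
K-dominated by f, which K-monotonicity forbids unless f = 0. *)
Lemma K_gt0 (N0 N1 X : V -> \bar R) (C : R) (f : V) :
  (forall f, 0 <= N0 f) -> (forall f, 0 <= N1 f) ->
  (forall a f, N0 (a *: f)%R = `|a|%:E * N0 f) ->
  (forall a f, N1 (a *: f)%R = `|a|%:E * N1 f) ->
  quasi_banach_lattice X -> continuously_included X (Sigma N0 N1) ->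
  (0 < C)%R ->
  (forall f g, X f < +oo -> (forall t, (0 < t)%R ->
     Kfunctional N0 N1 t g <= Kfunctional N0 N1 t f) -> X g <= C%:E * X f) ->
  X f < +oo -> f <> 0%R -> (0 < kf N0 N1 f 1)%R.
Proof.
move=> N0_ge0 N1_ge0 N0Z N1Z XL XS C0 mono Xf fN0.
rewrite lt_def fine_ge0 ?K_ge0// andbT; apply/eqP => k0; apply: fN0.
have K0 t : (0 < t)%R -> Kfunctional N0 N1 t f = 0.
  move=> t0; have K1E : Kfunctional N0 N1 1 f = 0.
    by rewrite -(kfE N0_ge0 N1_ge0 XL XS Xf ltr01) k0.
  apply/eqP; rewrite eq_le (K_ge0 N0_ge0 N1_ge0) ?(ltW t0)// andbT.
  have [t1|/ltW t1] := leP t 1%R.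
    by rewrite -K1E; apply: le_K => //; rewrite (ltW t0).
  have := @K_quasiconcave R N0 N1 N0_ge0 N1_ge0 1%R t f; rewrite ltr01 t1 K1E mule0.
  exact.
apply: (lattice_eq0 XL).
have := mono f ((2 * C) *: f)%R Xf.
have C20 : (0 < 2 * C)%R by rewrite mulr_gt0.
have Xfin : X f \is a fin_num by rewrite ge0_fin_numE// (lattice_ge0 XL).
rewrite latticeZ// gtr0_norm// -(fineK Xfin) -!EFinM lee_fin => H.
have {}H : (2 * C * fine (X f) <= C * fine (X f))%R.
  apply: H => t t0; rewrite (KZ N0_ge0 N1_ge0 N0Z N1Z) ?gt_eqF ?(ltW t0)//.
  by rewrite !K0// mule0.
have : (0 <= fine (X f))%R by rewrite fine_ge0// (lattice_ge0 XL).
by move=> X0; congr EFin; nra.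
Qed.

Lemma Delta_nontrivial (p q : \bar R) : 0 < p -> 0 < q ->
  exists2 f : V, Delta (Lp p) (Lp q) f < +oo & f <> 0%R.
Proof.
have mh : measurable_fun setT (\1_(`]0%R, 1%R[ : set T) : T -> R).
  exact: measurable_indic.
move=> p0 q0; exists (toL0 mh); last first.
  move=> h0; have H : {ae mu, forall x, (\1_(`]0%R, 1%R[ : set T) x = 0 :> R)%R}.
    by move: (toL0E mh) (@L00 R); rewrite h0; apply: aeS2 => x ->.
  have [|x x01] := halfline_hits _ H (a := 2^-1%R) (b := 1%R); first by lra.
  rewrite indicE mem_set/=; first by move/eqP; rewrite oner_eq0.
  by rewrite in_itv/=; lra.
have Lfin r : 0 < r -> Lp r (toL0 mh) < +oo.
  case: r => [r||]// r0.
    apply: (@le_lt_trans _ _ 1%:E); last exact: ltry.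
    apply/Lp_le => //.
    rewrite powR1.
    have -> : pint r (toL0 mh) = \int[mu]_x (\1_(`]0%R, 1%R[ : set T) x)%:E.
      apply: ae_eq_integral => //.
      - exact: epow_measurable.
      - exact/measurable_EFinP.
      move: (toL0E mh); apply: aeS => x -> _.
      by rewrite indicE; case: (_ \in _); rewrite ?normr1 ?powR1// normr0 powR0 ?gt_eqF.
    rewrite integral_indic// setIT.
    rewrite -[X in X <= _]/(lebesgue_measure (`]0%R, 1%R[%classic `&` halfline R)).
    rewrite setIidl; last first.
      by move=> x; rewrite /halfline /= !in_itv/= andbT => /andP[].
    by rewrite lebesgue_measure_itv/= lte_fin ltr01 oppr0 adde0.
  apply: (@le_lt_trans _ _ 1%:E); last exact: ltry.
  apply/Linf_le; move: (toL0E mh); apply: aeS => x ->.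
  by rewrite indicE; case: (_ \in _); rewrite ?normr1// normr0.
by rewrite gt_max !Lfin.
Qed.

End lebesgue_couples.

Local Open Scope ereal_scope.

Theorem theorem8p7 (R : realType) (p q : \bar R) (hp : 0 < p) (hpq : p < q)
    (X : L0h R -> \bar R) (hXlat : quasi_banach_lattice X)
    (hXint : interpolation_space (Lp p) (Lp q) X) :
  exists E : L0h R -> \bar R,
    [/\ quasi_banach_lattice E,
        interpolation_space Linfty Linfty_inv E
      & equivalent_qnorms X (Kspace (Lp p) (Lp q) E)].
Proof.
case: p hp hpq hXint => [p||]// p0 pq Xint; last by move: pq; rewrite ltNge leey.
have q0 : 0 < q := lt_trans p0 pq.
have [_ DX XS _] := Xint.
have N0_ge0 := @Lp_ge0 R p%:E; have N1_ge0 := @Lp_ge0 R q.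
have N0_solid f g := @Lp_solid R p%:E f g p0.
have N1_solid f g := @Lp_solid R q f g q0.
have N0Z a f := @LpZ R p%:E a f p0; have N1Z a f := @LpZ R q a f q0.
have Kdom f g : X f < +oo -> (forall t, (0 < t)%R ->
    Kfunctional (Lp p%:E) (Lp q) t g <= Kfunctional (Lp p%:E) (Lp q) t f) ->
    X g < +oo.
  case: q pq {q0 DX XS N1_ge0 N1_solid N1Z} Xint => [q||//] pq Xint.
    exact: K_dominated_finite.
  exact: K_dominated_infinite.
have [C C0 mono] := uniform_constant N0_ge0 N1_ge0 N0_solid N1_solid N0Z N1Z
  hXlat XS (weight_gt0 p) (Lebesgue_weighted_sup p0 (lexx _))
  (Lebesgue_weighted_sup p0 (ltW pq)) Kdom.
have [f1 Df1 f1N0] := Delta_nontrivial p0 q0.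
have Xf1 : X f1 < +oo.
  have [D /(_ _ Df1)/le_lt_trans] := DX; apply.
  have D0 : 0 <= Delta (Lp p%:E) (Lp q) f1 by rewrite le_max N0_ge0.
  have /fineK <- : Delta (Lp p%:E) (Lp q) f1 \is a fin_num by rewrite ge0_fin_numE.
  by rewrite -EFinM ltry.
have hL := hull_lattice N0_ge0 N1_ge0 N0_solid N1_solid N0Z N1Z hXlat XS.
have k1 := K_gt0 N0_ge0 N1_ge0 N0Z N1Z hXlat XS C0 mono Xf1 f1N0.
exists (hull (Lp p%:E) (Lp q) X); split => //.
  split; first by case: hL.
  - exact: (hull_Delta N0_ge0 N1_ge0 N0Z N1Z hXlat XS Xf1 k1).
  - exact: hull_Sigma.
  - by move=> S Sl S0 S1; exact: hull_bounded.
exact: (hull_equivalent N0_ge0 N1_ge0 N0Z N1Z hXlat XS C0 mono).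
Qed.
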